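(* Let $\Omega \subset \mathbb{R}^d$ be open and connected, and let $M \subset \Omega$ be a hypersurface that is contained in the typical orbit of a codimension one isometric group action. Let $u:\Omega\to\mathbb{R}$ and $\lambda\in\mathbb{R}$. If $M \subset \mathrm{crit}(u)$ and $\Delta u = \lambda u$, then $u$ is invariant under the action.
   Context: $\Delta$ is the Euclidean Laplacian, and $\mathrm{crit}(u) = \{x \in \Omega : \nabla u(x)=0\}$ is the critical set of $u$. A hypersurface is a submanifold of dimension $d-1$. Let $G$ be a group of isometries. The action of $G$ is called codimension 1 (codimension one) if the typical orbit is a hypersurface; for example, the standard action of $SO(n-k) \times \mathbb{R}^{k-1}$ on $\mathbb{R}^{n-k} \times \mathbb{R}^{k-1}$ is codimension 1.
   Formalization: The typical orbit containing M is also assumed connected (automatic for connected groups); otherwise the claim fails, e.g. for translations of {x_1=0} with the reflection x_1→−x_1, M={x_1=a}, u=cos(x_1−a), λ=−1. *)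

(* Defs.v *)
From HB Require Import structures.
From mathcomp Require Import all_boot all_order all_algebra.
From mathcomp Require Import all_classical all_reals all_analysis.

Set Implicit Arguments.
Unset Strict Implicit.
Unset Printing Implicit Defensive.

Import Order.TTheory GRing.Theory Num.Theory.
Import numFieldNormedType.Exports.

Local Open Scope classical_set_scope.
Local Open Scope ring_scope.

(* R^d is 'rV[R]_d.  The library norm on 'rV[R]_d is the sup norm: it is used
   only for the topology and for derivatives, where the choice of norm is
   immaterial.  Isometries refer to [edist].  Functions on an open set U are
   total functions that are only constrained on U. *)

Section Euclidean.
Context {R : realType} {d : nat}.
Local Notation V := 'rV[R]_d.

Definition edist (x y : V) : R :=
  Num.sqrt (\sum_(i < d) (x 0 i - y 0 i) ^+ 2).

Definition basis_vec (i : 'I_d) : V := delta_mx 0 i.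

Definition grad (f : V -> R) (x : V) : V := \row_i 'D_(basis_vec i) f x.

Definition laplacian (f : V -> R) (x : V) : R :=
  \sum_(i < d) 'D_(basis_vec i) (fun y => 'D_(basis_vec i) f y) x.

Definition crit (Omega : set V) (u : V -> R) : set V :=
  [set x | Omega x /\ grad u x = 0].

(* Meaningful for open U. *)
Fixpoint Ck (k : nat) (U : set V) (f : V -> R) : Prop :=
  match k with
  | 0 => forall x, U x -> {for x, continuous f}
  | k'.+1 => (forall x, U x -> differentiable f x) /\
             (forall v, Ck k' U (fun x => 'D_v f x))
  end.

Definition smooth (U : set V) (f : V -> R) : Prop := forall k, Ck k U f.

(* Nonempty, smooth embedded submanifolds of dimension d - 1, given by local
   defining functions; neither closedness nor connectedness is required. *)
Definition hypersurface (S : set V) : Prop :=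
  S !=set0 /\
  forall p, S p -> exists (W : set V) (f : V -> R),
    [/\ open W, W p, smooth W f,
        forall x, W x -> grad f x != 0 &
        S `&` W = [set x | W x /\ f x = 0]].

Definition isometry_group (G : set (V -> V)) : Prop :=
  [/\ G id,
      forall g h, G g -> G h -> G (g \o h),
      forall g, G g -> exists h, [/\ G h, cancel g h & cancel h g] &
      forall g, G g -> forall x y, edist (g x) (g y) = edist x y].

Definition isom_orbit (G : set (V -> V)) (p : V) : set V :=
  [set x | exists2 g, G g & x = g p].

Definition stabilizer (G : set (V -> V)) (p : V) : set (V -> V) :=
  [set g | G g /\ g p = p].

(* The typical orbits are the principal ones: [isom_orbit G p] is principal
   when the isotropy group of p is, up to conjugation (that is, up to moving q
   within its orbit), contained in the isotropy group of every q near p. *)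
Definition principal (G : set (V -> V)) (p : V) : Prop :=
  \forall q \near p,
    exists2 g, G g & stabilizer G p `<=` stabilizer G (g q).

Definition codimension_one (G : set (V -> V)) : Prop :=
  (exists p, principal G p) /\
  (forall p, principal G p -> hypersurface (isom_orbit G p)).

(* Omega need not be stable under G, so u is compared at those points of an
   orbit that lie in Omega. *)
Definition invariant_on (G : set (V -> V)) (Omega : set V) (u : V -> R) :
    Prop :=
  forall g x, G g -> Omega x -> Omega (g x) -> u (g x) = u x.

End Euclidean.

(* Main.v *)
Require Import Defs.
From HB Require Import structures.
From mathcomp Require Import all_boot all_order all_algebra.
From mathcomp Require Import all_classical all_reals all_analysis.
From mathcomp Require Import ring lra.
Set Implicit Arguments.
Unset Strict Implicit.
Unset Printing Implicit Defensive.
Import Order.TTheory GRing.Theory Num.Theory.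
Import numFieldNormedType.Exports.
Local Open Scope classical_set_scope.
Local Open Scope ring_scope.

(** The idea is that [u] can only depend on the distance to one object that is
    fixed by the group. Along [M] the function [u] is locally constant and its
    gradient vanishes. If [F] is another solution of the equation, with the same
    constant value and zero gradient on [M], then the equation forces [u] and [F]
    to have the same Hessian on [M], so that [u - F] vanishes to second order
    there. Extending [u - F] by zero across [M] gives a solution, which vanishes
    by unique continuation; hence [u = F] near [M] and then on all of [Omega].
    So it suffices to find such an [F] that is invariant under the group.

    The geometry provides it. Let [O] be the orbit of [p] and [nu] a unit normal
    of [O] at [p]. First, [O] lies on one side of its tangent hyperplanes
    ([orbit_halfspace]): if all points of space were at bounded distance from
    [O], a point far out on the normal through [p] would have its nearest point
    on the same normal, the orbit would be its own parallel hypersurface at a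
    large distance, and its shape operators at both points would be conjugate
    although one is a contraction of the other, hence zero ([cobounded_flat]);
    otherwise arbitrarily large balls touch [O] at [p]. If [O] lies in the tangent hyperplane, the signed distance
    to it is invariant ([planar_invariant]). If not, the largest balls that touch
    [O] from inside have centres that form a convex orbit, to whose affine hull
    all normals of [O] are orthogonal, and the distance to this affine subspace
    is invariant ([orbit_tube]). In both cases the equation for a function of the
    distance is an ordinary differential equation with a solution for given
    Cauchy data on [O] ([planar_profile], [radial_profile]), and this is [F]
    ([profile_coincidence]). In the second case [F] is singular on the affine
    subspace, which has codimension at least two and does not disconnect the
    domain ([tube_continuation]).

    For unique continuation the Laplacian is replaced by the limit of second
    symmetric differences ([glaplacian]), which is defined for functions glued
    along [M]. The maximum principle, with an explicit barrier, gives an interior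
    Lipschitz estimate ([symmetric_difference_le]). Finite differences of
    solutions are solutions, so iterating the estimate yields factorial bounds
    for differences of all orders, and Newton's interpolation formula shows that
    a solution that vanishes on a small cube vanishes on a cube of fixed size
    ([unique_continuation_ray]). *)

(** * Primitives and linear systems of differential equations *)

Lemma nbhs_distP (R : realType) (V : normedModType R) (x : V) (P : set V) :
  nbhs x P <-> exists2 e : R, 0 < e & forall y, `|y - x| < e -> P y.
Proof.
split=> [/nbhs_ballP[e /= e0 eP]|[e e0 eP]].
  by exists e => // y yx; apply: eP; rewrite -ball_normE /ball_/= distrC.
apply/nbhs_ballP; exists e => // y; rewrite -ball_normE /ball_/= distrC; exact: eP.
Qed.

Lemma continuous_distP (R : realType) (V W : normedModType R) (f : V -> W) (x : V) :
  {for x, continuous f} <-> forall e : R, 0 < e ->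
    exists2 d : R, 0 < d & forall y, `|y - x| < d -> `|f y - f x| < e.
Proof.
split=> [cf e e0|cf].
  have /nbhs_distP[d d0 dP] : nbhs x [set y | `|f x - f y| < e].
    by move/cvgrPdist_lt : cf; exact.
  by exists d => // y /dP; rewrite distrC.
apply/cvgrPdist_lt => e /cf[d d0 dP]; apply/nbhs_distP; exists d => // y /dP.
by rewrite distrC.
Qed.

Lemma is_derive_continuous (R : realType) (f : R -> R) (x l : R) :
  is_derive x 1 f l -> {for x, continuous f}.
Proof. by move=> [h _]; apply: differentiable_continuous; apply/derivable1_diffP. Qed.

Lemma MVT_bound (R : realType) (f df : R -> R) (a b K : R) : a <= b ->
  (forall x, a <= x <= b -> is_derive x 1 f (df x)) ->
  (forall x, a <= x <= b -> `|df x| <= K) -> `|f b - f a| <= K * (b - a).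
Proof.
move=> ab fd dfK.
have [||c cab ->] := @MVT_segment R f df a b ab.
- by move=> x; rewrite in_itv/= => /andP[ax xb]; apply: fd; rewrite !ltW.
- apply: continuous_in_subspaceT => x; rewrite inE/= in_itv/= => xab.
  exact: is_derive_continuous (fd _ xab).
rewrite normrM (ger0_norm (_ : 0 <= b - a)) ?subr_ge0//.
by apply: ler_wpM2r; [rewrite subr_ge0 | apply: dfK; move: cab; rewrite in_itv].
Qed.

Lemma continuous_integrable (R : realType) (f : R -> R) (a b : R) : continuous f ->
  (@lebesgue_measure R).-integrable `[a, b] (EFin \o f).
Proof.
move=> cf; apply: continuous_compact_integrable; first exact: segment_compact.
by apply: continuous_subspaceT.
Qed.

(** Primitives on [[- n, s]] for different [n] differ by constants, so that they
    can be patched together to a primitive on the whole line. *)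
Lemma antiderivative (R : realType) (f : R -> R) : continuous f ->
  exists2 F : R -> R, F 0 = 0 & forall x : R, is_derive x 1 F (f x).
Proof.
move=> cf.
pose G (n : nat) (s : R) : R := (\int[@lebesgue_measure R]_(t in `[(- n%:R)%R, s]) f t)%R.
have GD n (s : R) : - n%:R < s -> is_derive s 1 (G n) (f s).
  move=> ns; have [dG G'] : derivable (G n) s 1 /\ derive1 (G n) s = f s.
    by apply: (@continuous_FTC1_closed R f (- n%:R) s (s + 1)) => //;
      [rewrite ltrDl | exact: continuous_integrable | exact: cf].
  by apply: DeriveDef; [exact: dG | rewrite -derive1E].
pose N (s : R) := (Num.truncn `|s|).+1.
have Nlt (s : R) : `|s| < (N s)%:R by rewrite /N truncnS_gt.
pose F s := G (N s) s - G (N s) 0.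
exists F; first by rewrite /F subrr.
have Fn n (s : R) : `|s| < n%:R -> F s = G n s - G n 0.
  move=> sn; rewrite /F.
  pose H t := G (N s) t - G n t.
  suff : H s = H 0 by rewrite /H => h; lra.
  have n0 : 0 < n%:R :> R by apply: le_lt_trans sn.
  have N0 : 0 < (N s)%:R :> R by rewrite ltr0n.
  have Hd (t : R) : - n%:R < t -> - (N s)%:R < t -> is_derive t 1 H 0.
    move=> t1 t2; rewrite -(subrr (f t)); apply: is_deriveB; exact: GD.
  have sN := Nlt s.
  move: sn sN; rewrite !ltr_norml => /andP[sn _] /andP[sN _].
  apply/eqP; rewrite -subr_eq0 -normr_le0.
  have [s0|/ltW s0] := leP 0 s.
    have := @MVT_bound _ H (fun=> 0) 0 s 0 s0; rewrite mul0r; apply=> x /andP[x0 xs].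
      by apply: Hd; lra.
    by rewrite normr0.
  have := @MVT_bound _ H (fun=> 0) s 0 0 s0; rewrite mul0r distrC; apply=> x /andP[x0 xs].
    by apply: Hd; lra.
  by rewrite normr0.
move=> x.
pose n := (N x).+1.
have xn : `|x| < n%:R by apply: lt_trans (Nlt x) _; rewrite ltr_nat.
have : is_derive x 1 (fun t => G n t - G n 0) (f x).
  rewrite -[f x]subr0; apply: is_deriveB; apply: GD.
  by move: xn; rewrite ltr_norml => /andP[].
apply: near_eq_is_derive.
have xn' : 0 < n%:R - `|x| by rewrite subr_gt0.
apply/nbhs_distP; exists (n%:R - `|x|) => // t tx; apply/esym/Fn.
have := ler_normD (t - x) x; rewrite subrK; lra.
Qed.

(** A weighted estimate: the weight [exp (2 K |s|)] turns integration into a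
    contraction of factor 1/2, which makes the Picard iteration converge on the
    whole line at once. *)
Lemma weighted_antiderivative_le (R : realType) (W dW : R -> R) (K M L : R) :
  0 < K -> 0 <= M -> W 0 = 0 ->
  (forall s : R, `|s| <= L -> is_derive s 1 W (dW s)) ->
  (forall s : R, `|s| <= L -> `|dW s| <= K * M * expR (2 * K * `|s|)) ->
  forall s : R, `|s| <= L -> `|W s| <= M / 2 * expR (2 * K * `|s|).
Proof.
move=> K0 M0.
(* Reflecting the left half-line reduces to upper bounds on the right one. *)
suff pos (W' dW' : R -> R) (s : R) : W' 0 = 0 -> 0 <= s ->
    (forall t : R, 0 <= t <= s -> is_derive t 1 W' (dW' t)) ->
    (forall t : R, 0 <= t <= s -> dW' t <= K * M * expR (2 * K * t)) ->
    W' s <= M / 2 * expR (2 * K * s).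
  move=> W0 Wd dWle s sL; have [s0|/ltW s0] := leP 0 s.
  - rewrite (ger0_norm s0) in sL *; rewrite ler_norml; apply/andP; split.
      rewrite lerNl; apply: (pos (fun t => - W t) (fun t => - dW t)) => //.
      + by rewrite W0 oppr0.
      + move=> t /andP[t0 ts]; apply: is_deriveN; apply: Wd; rewrite ger0_norm//; lra.
      + move=> t /andP[t0 ts]; rewrite lerNl.
        have := dWle t; rewrite ger0_norm// => /(_ ltac:(lra)); rewrite ler_norml => /andP[]. lra.
    apply: (pos W dW) => // t /andP[t0 ts]; first by apply: Wd; rewrite ger0_norm//; lra.
    have := dWle t; rewrite ger0_norm// => /(_ ltac:(lra)); rewrite ler_norml => /andP[]. lra.
  - rewrite (ler0_norm s0) in sL *.
    have comp (t : R) : 0 <= t <= - s -> is_derive t 1 (fun t => W (- t)) (- dW (- t)).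
      move=> /andP[t0 ts].
      have Wt : is_derive (- t) 1 W (dW (- t)) by apply: Wd; rewrite normrN ger0_norm//; lra.
      by apply: is_derive_eq (is_derive1_comp Wt (is_deriveNid t 1)) _; rewrite mulrN1.
    rewrite -[s in W s]opprK ler_norml; apply/andP; split.
      rewrite lerNl; apply: (pos (fun t => - W (- t)) (fun t => - - dW (- t))); rewrite ?oppr0 ?W0 ?oppr0//; first lra.
      + by move=> t t0; apply: is_deriveN; apply: comp.
      + move=> t /andP[t0 ts]; rewrite opprK.
        have := dWle (- t); rewrite normrN ger0_norm// => /(_ ltac:(lra)); rewrite ler_norml => /andP[]. lra.
    apply: (pos (fun t => W (- t)) (fun t => - dW (- t))); rewrite ?oppr0//; first lra.
    move=> t /andP[t0 ts]; rewrite lerNl.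
    have := dWle (- t); rewrite normrN ger0_norm// => /(_ ltac:(lra)); rewrite ler_norml => /andP[]. lra.
move=> W0 s0 Wd dWle.
pose E (t : R) := M / 2 * expR (2 * K * t).
have Ed (t : R) : is_derive t 1 E (K * M * expR (2 * K * t)).
  rewrite /E.
  have lin : is_derive t 1 (fun t => 2 * K * t) (2 * K * 1) := is_deriveZ (2 * K) (is_derive_id t (1 : R)).
  apply: is_derive_eq (is_deriveZ (M / 2) (is_derive1_comp (is_derive_expR _) lin)) _.
  by rewrite /GRing.scale/=; field.
have := @MVT_segment R (fun t => E t - W' t) (fun t => K * M * expR (2 * K * t) - dW' t) 0 s s0.
case.
- move=> x; rewrite in_itv/= => /andP[x0 xs].
  by apply: is_deriveB (Ed x) (Wd x _); rewrite !ltW.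
- apply: continuous_in_subspaceT => x; rewrite inE/= in_itv/= => xab.
  exact: is_derive_continuous (is_deriveB (Ed x) (Wd x xab)).
move=> c; rewrite in_itv/= => /dWle dc.
rewrite W0 /E mulr0 expR0 mulr1 subr0 => eq.
have : 0 <= (K * M * expR (2 * K * c) - dW' c) * s by apply: mulr_ge0 => //; lra.
by move: eq; lra.
Qed.

(** The sequences [u n -+ 2 C / 2 ^+ n] are monotone, and enclose the limit. *)
Lemma geometric_limit (R : realType) (u : nat -> R) (C : R) :
  (forall n, `|u n.+1 - u n| <= C / 2 ^+ n) ->
  exists l, forall n, `|l - u n| <= 2 * C / 2 ^+ n.
Proof.
move=> uC.
pose a n := u n - 2 * C / 2 ^+ n; pose b n := u n + 2 * C / 2 ^+ n.
have half n : 2 * C / 2 ^+ n.+1 = C / 2 ^+ n.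
  by rewrite exprS invfM; field; rewrite expf_neq0.
have dbl n : 2 * C / 2 ^+ n = 2 * (C / 2 ^+ n) by rewrite mulrA.
have aS n : a n <= a n.+1.
  have := uC n; rewrite /a half dbl ler_norml => /andP[]; lra.
have bS n : b n.+1 <= b n.
  have := uC n; rewrite /b half dbl ler_norml => /andP[]; lra.
have an m n : (m <= n)%N -> a m <= a n.
  by move=> /subnK <-; elim: (n - m)%N => [//|k IH]; exact: le_trans IH (aS _).
have bn m n : (m <= n)%N -> b n <= b m.
  by move=> /subnK <-; elim: (n - m)%N => [//|k IH]; exact: le_trans (bS _) IH.
have ab n : a n <= b n.
  have C0 : 0 <= C / 2 ^+ n by apply: le_trans (uC n).
  by rewrite /a /b dbl; lra.
have amb m n : a m <= b n.
  by apply: le_trans (an _ _ (leq_maxl m n)) _; apply: le_trans (ab _) (bn _ _ (leq_maxr m n)).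
have sA : has_sup (range a).
  split; first by exists (a 0); exists 0.
  by exists (b 0) => _ [n _ <-].
exists (sup (range a)) => n; rewrite ler_norml; apply/andP; split.
  have : a n <= sup (range a) by apply: sup_upper_bound => //; exists n.
  rewrite /a; lra.
have : sup (range a) <= b n by apply: ge_sup; [case: sA | move=> _ [m _ <-]].
rewrite /b; lra.
Qed.

Lemma small_geometric (R : realType) (C e : R) : 0 < e -> exists n, C / 2 ^+ n < e.
Proof.
move=> e0; exists (Num.truncn (`|C| / e)).
rewrite ltr_pdivrMr ?exprn_gt0//; apply: le_lt_trans (ler_norm _) _.
rewrite mulrC -ltr_pdivrMr//; apply: lt_le_trans (truncnS_gt _) _.
rewrite -natrX ler_nat; exact: ltn_expl.
Qed.

Lemma geometric_limit_unique (R : realType) (u : nat -> R) (l l' C C' : R) :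
  (forall n, `|l - u n| <= C / 2 ^+ n) -> (forall n, `|l' - u n| <= C' / 2 ^+ n) ->
  l = l'.
Proof.
move=> ul ul'; apply/eqP; rewrite -subr_eq0 -normr_le0 leNgt; apply/negP => d0.
have [n nd] := small_geometric (C + C') d0.
have := ul n; have := ul' n; rewrite distrC => h1 h2.
have := ler_normD (l - u n) (u n - l'); rewrite subrKA.
move: nd; rewrite mulrDl; lra.
Qed.

Lemma continuous_bounded (R : realType) (f : R -> R) (L : R) : continuous f ->
  exists2 K, 0 < K & forall s : R, `|s| <= L -> `|f s| <= K.
Proof.
move=> cf; have [L0|L0] := leP 0 L; last first.
  by exists 1 => // s /(le_trans (normr_ge0 s)); lra.
have [|c _ cmax] := @EVT_max R (fun x => `|f x|) (- L) L ltac:(lra).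
  apply: continuous_subspaceT => x; apply: continuous_comp; [exact: cf|exact: norm_continuous].
exists (`|f c| + 1); first by rewrite ltr_wpDl.
move=> s; rewrite ler_norml => sL; apply: le_trans (cmax s _) _; last by rewrite lerDl.
by rewrite in_itv.
Qed.

Lemma uniform_limit_continuous (R : realType) (u : nat -> R -> R) (l : R -> R)
    (C : R -> R) : (forall n, continuous (u n)) ->
  (forall L s n, `|s| <= L -> `|l s - u n s| <= C L / 2 ^+ n) -> continuous l.
Proof.
move=> cu ul s; apply/(@continuous_distP R R^o R^o) => e e0.
have [n nC] := small_geometric (C (`|s| + 1)) (ltac:(lra) : 0 < e / 4).
have /(@continuous_distP R R^o R^o)/(_ (e / 4) (ltac:(lra)))[d d0 dP] := cu n s.
exists (Num.min d 1).
  by rewrite lt_min d0 ltr01.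
move=> t; rewrite lt_min => /andP[td t1].
have hs := ul (`|s| + 1) s n (ltac:(lra)).
have tL : `|t| <= `|s| + 1.
  have := ler_normD (t - s) s; rewrite subrK; lra.
have ht := ul (`|s| + 1) t n tL.
have := dP t td; have := le_lt_trans hs nC; have := le_lt_trans ht nC.
rewrite !ltr_norml => /andP[h1 h2] /andP[h3 h4] /andP[h5 h6].
by apply/andP; split; lra.
Qed.

(** Picard iteration; by the weighted estimate the iterates converge uniformly
    on bounded sets, fast enough to identify the limit as a fixed point. *)
Lemma linear_system_solution (R : realType) (a b : R -> R) (c : R) :
  continuous a -> continuous b ->
  exists y z : R -> R, [/\ y 0 = c, z 0 = 0 &
    forall s : R, is_derive s 1 y (a s * z s) /\ is_derive s 1 z (b s * y s)].
Proof.
move=> ca cb.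
have /choice[I IP] (f : R -> R) : exists F : R -> R, continuous f ->
    F 0 = 0 /\ forall x : R, is_derive x 1 F (f x).
  have [/antiderivative[F F0 FD]|nf] := pselect (continuous f); first by exists F.
  by exists f => /nf.
have cI f : continuous f -> continuous (I f).
  by move=> /IP[_ h] x; exact: is_derive_continuous (h x).
have cM (f g : R -> R) : continuous f -> continuous g -> continuous (fun t => f t * g t).
  by move=> cf cg x; apply: cvgM; [exact: cf|exact: cg].
pose fix P n : (R -> R) * (R -> R) := if n is m.+1 then
  (fun s => c + I (fun t => a t * (P m).2 t) s, I (fun t => b t * (P m).1 t))
  else (cst c, cst 0).
have cP n : continuous (P n).1 /\ continuous (P n).2.
  elim: n => [|n [c1 c2]] /=; first by split; exact: cst_continuous.
  split; last by apply: cI; exact: cM.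
  by move=> x; apply: cvgD; [exact: cvg_cst|apply: cI; exact: cM].
have IB f g : continuous f -> continuous g -> forall x : R,
    is_derive x 1 (fun s => I f s - I g s) (f x - g x).
  by move=> /IP[_ hf] /IP[_ hg] x; apply: is_deriveB.
have step L : exists C, forall n (s : R), `|s| <= L ->
    `|(P n.+1).1 s - (P n).1 s| <= C / 2 ^+ n /\
    `|(P n.+1).2 s - (P n).2 s| <= C / 2 ^+ n.
  have [Ka Ka0 aK] := continuous_bounded L ca.
  have [Kb Kb0 bK] := continuous_bounded L cb.
  pose K := Ka + Kb.
  have K0 : 0 < K by rewrite addr_gt0.
  have [M1 M10 PM1] := @continuous_bounded _ (fun s => (P 1%N).1 s - (P 0%N).1 s) L
    (fun x => cvgB ((cP 1%N).1 x) ((cP 0%N).1 x)).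
  have [M2 M20 PM2] := @continuous_bounded _ (fun s => (P 1%N).2 s - (P 0%N).2 s) L
    (fun x => cvgB ((cP 1%N).2 x) ((cP 0%N).2 x)).
  pose M := M1 + M2.
  have M0 : 0 < M by rewrite addr_gt0.
  pose E (s : R) := expR (2 * K * `|s|).
  suff st n (s : R) : `|s| <= L -> `|(P n.+1).1 s - (P n).1 s| <= M / 2 ^+ n * E s /\
      `|(P n.+1).2 s - (P n).2 s| <= M / 2 ^+ n * E s.
    exists (M * expR (2 * K * L)) => n s sL.
    have Ele : M / 2 ^+ n * E s <= M * expR (2 * K * L) / 2 ^+ n.
      rewrite mulrAC; apply: ler_wpM2r; first by rewrite invr_ge0 exprn_ge0.
      apply: ler_wpM2l; first exact: ltW.
      by rewrite /E ler_expR; apply: ler_wpM2l => //; rewrite mulr_ge0// ltW.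
    by have [h1 h2] := st n s sL; split; apply: le_trans Ele.
  elim: n s => [|n IH] s sL.
    have E1 : 1 <= E s by rewrite /E -expR0 ler_expR mulr_ge0// mulr_ge0// ltW.
    have ME : M <= M * E s by rewrite ler_peMr// ltW.
    by rewrite expr0 divr1; split; [have := PM1 _ sL | have := PM2 _ sL]; rewrite /M in ME *; lra.
  have Mn : 0 <= M / 2 ^+ n by rewrite divr_ge0 ?exprn_ge0// ltW.
  have hn : M / 2 ^+ n.+1 = M / 2 ^+ n / 2.
    by rewrite exprS invfM mulrCA mulrA [in RHS]mulrC mulrA.
  have [cn1 cn2] := cP n; have [cm1 cm2] := cP n.+1.
  rewrite hn; split.
    have -> : (P n.+2).1 s - (P n.+1).1 s =
        I (fun t => a t * (P n.+1).2 t) s - I (fun t => a t * (P n).2 t) s.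
      rewrite /=; lra.
    apply: (weighted_antiderivative_le
      (W := fun s => I (fun t => a t * (P n.+1).2 t) s - I (fun t => a t * (P n).2 t) s)
      K0 Mn _ (fun s _ => IB _ _ (cM _ _ ca cm2) (cM _ _ ca cn2) s) _ sL).
      by rewrite (IP _ (cM _ _ ca cm2)).1 (IP _ (cM _ _ ca cn2)).1 subrr.
    move=> t tL; rewrite -mulrBr normrM -mulrA; apply: ler_pM => //.
      by have := aK _ tL; rewrite /K; lra.
    exact: (IH _ tL).2.
  apply: (weighted_antiderivative_le
      (W := fun s => I (fun t => b t * (P n.+1).1 t) s - I (fun t => b t * (P n).1 t) s)
      K0 Mn _ (fun s _ => IB _ _ (cM _ _ cb cm1) (cM _ _ cb cn1) s) _ sL).
    by rewrite (IP _ (cM _ _ cb cm1)).1 (IP _ (cM _ _ cb cn1)).1 subrr.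
  move=> t tL; rewrite -mulrBr normrM -mulrA; apply: ler_pM => //.
    by have := bK _ tL; rewrite /K; lra.
  exact: (IH _ tL).1.
have [C CP] := choice step.
have [y yP] := choice (fun s : R => geometric_limit (fun n => (CP `|s| n s (lexx _)).1)).
have [z zP] := choice (fun s : R => geometric_limit (fun n => (CP `|s| n s (lexx _)).2)).
have yU L s n : `|s| <= L -> `|y s - (P n).1 s| <= 2 * C L / 2 ^+ n.
  move=> sL; have [l lP] := geometric_limit (fun n => (CP L n s sL).1).
  by rewrite (geometric_limit_unique (yP s) lP).
have zU L s n : `|s| <= L -> `|z s - (P n).2 s| <= 2 * C L / 2 ^+ n.
  move=> sL; have [l lP] := geometric_limit (fun n => (CP L n s sL).2).
  by rewrite (geometric_limit_unique (zP s) lP).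
have cy : continuous y := uniform_limit_continuous (fun n => (cP n).1) yU.
have cz : continuous z := uniform_limit_continuous (fun n => (cP n).2) zU.
have fix_pt (e f g : R -> R) (k : R) (u v : nat -> R -> R) (A B : R -> R) :
    continuous e -> continuous g -> (forall n, continuous (v n)) ->
    (forall n s, u n.+1 s = k + I (fun t => e t * v n t) s) ->
    (forall L s n, `|s| <= L -> `|f s - u n s| <= A L / 2 ^+ n) ->
    (forall L s n, `|s| <= L -> `|g s - v n s| <= B L / 2 ^+ n) ->
    forall s, f s = k + I (fun t => e t * g t) s.
  move=> ce cg cv uS fu gv s.
  have [K K0 eK] := continuous_bounded `|s| ce.
  have B0 : 0 <= B `|s| by have := le_trans (normr_ge0 _) (gv `|s| s 0%N (lexx _)); rewrite divr1.
  pose G := expR (2 * K * `|s|).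
  apply: (@geometric_limit_unique _ (fun n => u n.+1 s) _ _ (A `|s|) (B `|s| * G)) => n.
    apply: le_trans (fu _ _ _ (lexx _)) _; rewrite exprS invfM.
    have A0 : 0 <= A `|s| / 2 ^+ n := le_trans (normr_ge0 _) (fu _ _ n (lexx _)).
    have -> : A `|s| * (2^-1 / 2 ^+ n) = (A `|s| / 2 ^+ n) / 2 by rewrite mulrCA mulrC.
    by lra.
  rewrite uS opprD addrACA subrr add0r.
  have Mn : 0 <= B `|s| / 2 ^+ n by rewrite divr_ge0 ?exprn_ge0// ltW.
  have := weighted_antiderivative_le
    (W := fun s => I (fun t => e t * g t) s - I (fun t => e t * v n t) s)
    K0 Mn _ (fun s _ => IB _ _ (cM _ _ ce cg) (cM _ _ ce (cv n)) s) _ (lexx `|s|).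
  move=> /(_ _ _)/le_trans; apply.
  - by rewrite (IP _ (cM _ _ ce cg)).1 (IP _ (cM _ _ ce (cv n))).1 subrr.
  - move=> t tL; rewrite -mulrBr normrM -mulrA; apply: ler_pM => //; first exact: eK.
    apply: le_trans (gv _ _ n tL) _; rewrite ler_peMr//.
    by rewrite -expR0 ler_expR mulr_ge0// mulr_ge0// ltW.
  rewrite -/G mulrAC (mulrAC (B _)) ler_piMr//; last lra.
  by rewrite mulr_ge0 ?invr_ge0 ?exprn_ge0// mulr_ge0// expR_ge0.
have yE := fix_pt _ _ _ _ _ _ _ _ ca cz (fun n => (cP n).2) (fun n s => erefl) yU zU.
have zE := fix_pt _ _ _ 0 _ _ _ _ cb cy (fun n => (cP n).1) (fun n s => esym (add0r _)) zU yU.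
exists y, z; split.
- by rewrite yE (IP _ (cM _ _ ca cz)).1 addr0.
- by rewrite zE (IP _ (cM _ _ cb cy)).1 addr0.
move=> s; split.
  have -> : y = (fun s => c + I (fun t => a t * z t) s) by apply/funext.
  rewrite -[X in is_derive _ _ _ X]add0r; apply: is_deriveD.
  exact: (IP _ (cM _ _ ca cz)).2.
have -> : z = (fun s => 0 + I (fun t => b t * y t) s) by apply/funext.
rewrite -[X in is_derive _ _ _ X]add0r; apply: is_deriveD.
exact: (IP _ (cM _ _ cb cy)).2.
Qed.

(** * The Laplacian by second differences, and the maximum principle *)

Section SupNorm.
Context {R : realType} {d : nat}.
Local Notation V := 'rV[R]_d.

Lemma coord_le (x : V) i : `|x 0 i| <= `|x|.
Proof.
rewrite [leRHS]/Num.norm /= mx_normrE; apply/bigmax_geP; right => /=.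
by exists (0, i); rewrite ?lexx.
Qed.

Lemma norm_le_coord (x : V) (r : R) : 0 <= r -> (forall i, `|x 0 i| <= r) -> `|x| <= r.
Proof.
move=> r0 xr; rewrite [leLHS]/Num.norm /= mx_normrE; apply/bigmax_leP; split => //= -[i j] _ /=.
by rewrite [i]ord1; exact: xr.
Qed.

Lemma norm_lt_coord (x : V) (r : R) : 0 < r -> (forall i, `|x 0 i| < r) -> `|x| < r.
Proof.
move=> r0 xr; rewrite [ltLHS]/Num.norm /= mx_normrE; apply/bigmax_ltP; split => //= -[i j] _ /=.
by rewrite [i]ord1; exact: xr.
Qed.

Lemma basis_vecE (i j : 'I_d) : (basis_vec i : V) 0 j = (i == j)%:R.
Proof. by rewrite /basis_vec mxE eqxx eq_sym. Qed.

Lemma continuous_coord (i : 'I_d) (x : V) : {for x, continuous (fun y : V => y 0 i)}.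
Proof. exact: coord_continuous. Qed.

Lemma continuous_sum (T : topologicalType) (I : Type) (r : seq I) (F : I -> T -> R) (x : T) :
  (forall i, {for x, continuous (F i)}) ->
  {for x, continuous (fun y => \sum_(i <- r) F i y)}.
Proof.
move=> cF; elim: r => [|i r IH].
  rewrite (_ : (fun _ => _) = cst 0); first exact: cst_continuous.
  by apply/funext => y; rewrite big_nil.
rewrite (_ : (fun _ => _) = (fun y => F i y + \sum_(i <- r) F i y)).
  by apply: cvgD => //; exact: cF.
by apply/funext => y; rewrite big_cons.
Qed.

Lemma continuous_sqr (T : topologicalType) (f : T -> R) (x : T) :
  {for x, continuous f} -> {for x, continuous (fun y => f y ^+ 2)}.
Proof.
move=> cf; rewrite (_ : (fun _ => _) = (fun y => f y * f y)); first exact: cvgM.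
by apply/funext => y; rewrite expr2.
Qed.

Lemma continuous_scal (T : topologicalType) (f : T -> R) (a : R) (x : T) :
  {for x, continuous f} -> {for x, continuous (fun y => a * f y)}.
Proof. by move=> cf; apply: cvgM => //; exact: cvg_cst. Qed.

End SupNorm.

Section GeneralizedLaplacian.
Context {R : realType} {d : nat}.
Local Notation V := 'rV[R]_d.

Definition sdiff (w : V -> R) (x v : V) : R := w (x + v) + w (x - v) - 2 * w x.

(** The Laplacian as a limit of second symmetric differences: unlike second
    partial derivatives, this notion makes sense for functions that are glued
    from two pieces along a hypersurface, and it is all that the maximum
    principle needs. *)
Definition glaplacian (w : V -> R) (x : V) (L : R) : Prop :=
  forall e : R, 0 < e -> exists2 r : R, 0 < r & forall t : R, 0 < t < r ->
    `|\sum_i sdiff w x (t *: basis_vec i) - L * t ^+ 2| <= e * t ^+ 2.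

Definition helmholtz (lambda : R) (U : set V) (w : V -> R) : Prop :=
  forall x, U x -> {for x, continuous w} /\ glaplacian w x (lambda * w x).

Lemma glaplacian_lin (w1 w2 : V -> R) x (a L1 L2 : R) :
  glaplacian w1 x L1 -> glaplacian w2 x L2 ->
  glaplacian (fun y => w1 y + a * w2 y) x (L1 + a * L2).
Proof.
move=> g1 g2 e e0.
have [r1 r10 h1] := g1 (e / 2) (ltac:(lra)).
have a0 : 0 < 2 * (`|a| + 1) by rewrite mulr_gt0// ltr_wpDl.
have [r2 r20 h2] := g2 (e / (2 * (`|a| + 1))) (divr_gt0 e0 a0).
exists (Num.min r1 r2); first by rewrite lt_min r10.
move=> t /andP[t0]; rewrite lt_min => /andP[t1 t2].
have := h1 t (ltac:(by rewrite t0)); have := h2 t (ltac:(by rewrite t0)).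
set S1 := \sum_i sdiff w1 _ _; set S2 := \sum_i sdiff w2 _ _ => H2 H1.
have -> : \sum_i sdiff (fun y => w1 y + a * w2 y) x (t *: basis_vec i) = S1 + a * S2.
  by rewrite mulr_sumr -big_split/=; apply: eq_bigr => i _; rewrite /sdiff; ring.
have -> : S1 + a * S2 - (L1 + a * L2) * t ^+ 2 =
  (S1 - L1 * t ^+ 2) + a * (S2 - L2 * t ^+ 2) by ring.
apply: le_trans (ler_normD _ _) _; rewrite normrM.
have : `|a| * `|S2 - L2 * t ^+ 2| <= e / 2 * t ^+ 2.
  apply: le_trans (ler_wpM2l (normr_ge0 a) H2) _.
  rewrite mulrA; apply: ler_wpM2r; first exact: sqr_ge0.
  set q := e / (2 * _).
  have q0 : 0 < q by rewrite divr_gt0.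
  have fq (A : R) : A != 0 -> e / (2 * A) * A = e / 2 by move=> ?; field.
  have qA : q * (`|a| + 1) = e / 2 by apply: fq; rewrite gt_eqF// ltr_wpDl.
  by rewrite mulrC; move: qA; rewrite mulrDr; lra.
lra.
Qed.

Lemma glaplacian_shift (w : V -> R) (a x : V) L :
  glaplacian w (x + a) L -> glaplacian (fun y => w (y + a)) x L.
Proof.
move=> g e e0; have [r r0 h] := g e e0; exists r => // t tr.
move: (h t tr); congr (`| _ - _ | <= _); apply: eq_bigr => i _.
by rewrite /sdiff [x + a + _]addrAC [x + a - _]addrAC.
Qed.

Lemma glaplacian_near (w1 w2 : V -> R) (x : V) L (r0 : R) : 0 < r0 ->
  (forall y, `|y - x| < r0 -> w1 y = w2 y) -> glaplacian w1 x L -> glaplacian w2 x L.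
Proof.
move=> r00 ww g e e0; have [r rp h] := g e e0.
exists (Num.min r r0); first by rewrite lt_min rp.
move=> t /andP[t0]; rewrite lt_min => /andP[tr tr0].
have tb i : `|t *: (basis_vec i : V)| < r0.
  apply: norm_lt_coord => // j; rewrite mxE basis_vecE normrM (gtr0_norm t0).
  by case: eqP => _; rewrite ?normr1 ?normr0 ?mulr1// mulr0.
have := h t (ltac:(by rewrite t0)); congr (`| _ - _ | <= _); apply: eq_bigr => i _.
by rewrite /sdiff !ww// ?subrr ?normr0// addrC addKr ?normrN.
Qed.

Lemma continuous_near (w1 w2 : V -> R) (x : V) (r0 : R) : 0 < r0 ->
  (forall y, `|y - x| < r0 -> w1 y = w2 y) ->
  {for x, continuous w1} -> {for x, continuous w2}.
Proof.
move=> r00 ww /(@continuous_distP R V R^o) c; apply/(@continuous_distP R V R^o) => e /c[r rp h].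
exists (Num.min r r0); first by rewrite lt_min rp.
by move=> y; rewrite lt_min => /andP[yr yr0]; rewrite -!ww ?subrr ?normr0//; exact: h.
Qed.

(** At an interior minimum all second symmetric differences are nonnegative, so
    the generalized Laplacian cannot be negative. *)
Lemma box_minimum_principle (h : V -> R) (a b : V) :
  (forall z : V, (forall i, a 0 i <= z 0 i <= b 0 i) -> {for z, continuous h}) ->
  (forall z : V, (forall i, a 0 i < z 0 i < b 0 i) -> exists2 L, L < 0 & glaplacian h z L) ->
  (forall z : V, (forall i, a 0 i <= z 0 i <= b 0 i) ->
     (exists i, z 0 i = a 0 i \/ z 0 i = b 0 i) -> 0 <= h z) ->
  forall z : V, (forall i, a 0 i <= z 0 i <= b 0 i) -> 0 <= h z.
Proof.
move=> hc hL hb z zB.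
pose B : set V := [set v | forall i, v 0 i \in `[a 0 i, b 0 i]].
have BE (v : V) : B v <-> forall i, a 0 i <= v 0 i <= b 0 i.
  by split=> H i; have := H i; rewrite in_itv.
have cB : compact B.
  by apply: (@rV_compact _ _ (fun i => `[a 0 i, b 0 i]%classic)) => i; exact: segment_compact.
have [|c] := @EVT_min_rV R d h B (ex_intro _ z (iffRL (BE z) zB)) cB.
  by apply: continuous_in_subspaceT => x; rewrite inE => /BE; exact: hc.
rewrite inE => /BE cB' cmin.
have hz : h c <= h z by apply: cmin; rewrite inE; apply/BE.
apply: le_trans hz.
have [[i ci]|nb] := pselect (exists i, c 0 i = a 0 i \/ c 0 i = b 0 i).
  by apply: hb => //; exists i.
have cint i : a 0 i < c 0 i < b 0 i.
  have /andP[h1 h2] := cB' i; rewrite !lt_neqAle h1 h2 !andbT.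
  by apply/andP; split; apply/eqP => e; apply: nb; exists i; [left|right].
have [L L0 gL] := hL c cint.
exfalso.
have [r r0 hr] := gL (- L / 2) (ltac:(lra)).
have [m m0 mP] : exists2 m : R, 0 < m & forall i, m <= c 0 i - a 0 i /\ m <= b 0 i - c 0 i.
  pose f i := Num.min (c 0 i - a 0 i) (b 0 i - c 0 i).
  exists (\big[Num.min/1]_i f i).
    by apply/bigmin_gtP; split => // i _; rewrite lt_min !subr_gt0.
  move=> i; have : \big[Num.min/1]_i f i <= f i by apply: bigmin_le_cond.
  by rewrite le_min => /andP[].
pose t := Num.min (r / 2) (m / 2).
have t0 : 0 < t by rewrite lt_min !divr_gt0.
have tr' : t <= r / 2 by rewrite ge_min lexx.
have tr : t < r by lra.
have tm' : t <= m / 2 by rewrite ge_min lexx orbT.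
have tm : t <= m by lra.
have := hr t (ltac:(by rewrite t0)).
have S0 : 0 <= \sum_i sdiff h c (t *: basis_vec i).
  apply: sumr_ge0 => i _; rewrite /sdiff.
  have Bp s : `|s| = t -> h c <= h (c + s *: basis_vec i).
    move=> st; apply: cmin; rewrite inE; apply/BE => j; rewrite !mxE eqxx/=.
    have [m1 m2] := mP j; have := cB' j; move: st => /eqP; rewrite eqr_norml => /andP[/orP[]/eqP -> _];
    by case: eqP => _; rewrite ?mulr1 ?mulr0; lra.
  have := Bp t (gtr0_norm t0); have := Bp (- t) (ltac:(by rewrite normrN gtr0_norm)).
  rewrite scaleNr; lra.
have t2 : 0 < t ^+ 2 by rewrite exprn_gt0.
have Lt : L * t ^+ 2 < 0 by rewrite nmulr_rlt0.
move/(le_trans (ler_norm _)).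
have -> : - L / 2 * t ^+ 2 = - (L * t ^+ 2) / 2 by ring.
lra.
Qed.
End GeneralizedLaplacian.

Section InteriorEstimate.
Context {R : realType} {d : nat}.
Local Notation V := 'rV[R]_d.
Local Notation e_ := (@basis_vec R d).

(** A ball of the sup norm, which is the shape that coordinatewise barriers need. *)
Definition cube (c : V) (r : R) : set V := [set x | `|x - c| < r].

Let sq (z : V) : R := \sum_j z 0 j ^+ 2.

Let sq_sdiff z v : sq (z + v) + sq (z - v) - 2 * sq z = 2 * sq v.
Proof.
rewrite /sq !mulr_sumr -big_split -sumrB/=; apply: eq_bigr => j _; rewrite !mxE; ring.
Qed.

Let sq_basis t i : sq (t *: e_ i) = t ^+ 2.
Proof.
rewrite /sq (bigD1 i)//= big1 ?addr0 => [|j ji]; rewrite !mxE /=.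
  by rewrite eqxx mulr1.
by rewrite (negbTE ji) mulr0 expr0n.
Qed.

Let flip (n : 'I_d) (z : V) : V := z - (2 * z 0 n) *: e_ n.

Let flipE n z j : flip n z 0 j = if j == n then - z 0 n else z 0 j.
Proof.
rewrite /flip !mxE /=; case: eqP => [->|_] /=; first ring.
by rewrite mulr0 subr0.
Qed.

Let flip_basis n z t i : flip n (z + t *: e_ i) = flip n z + (if i == n then - t else t) *: e_ i.
Proof.
apply/rowP => j; rewrite /flip !mxE !eqxx/= [n == i]eq_sym.
have [ei|ni] := eqVneq i n; first by subst i; case: eqP => _ /=; ring.
by have [ej|nj] := eqVneq j n; [subst j; rewrite eq_sym (negbTE ni)|]; rewrite /=; ring.
Qed.

(** Reflections in coordinate hyperplanes permute the coordinate differences. *)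
Lemma glaplacian_flip (w : V -> R) n z c L :
  glaplacian w (c + flip n z) L -> glaplacian (fun y => w (c + flip n y)) z L.
Proof.
move=> g e e0; have [r r0 h] := g e e0; exists r => // t tr.
move: (h t tr); congr (`| _ - _ | <= _); apply: eq_bigr => i _.
rewrite /sdiff -!scaleNr !flip_basis !addrA; case: eqP => _ //.
rewrite opprK; exact: (congr1 (+%R^~ _) (addrC _ _)).
Qed.

(** The barrier [psi] dominates the antisymmetrized solution on the boundary of
    a half cube and vanishes linearly on its face [z_n = 0], which bounds the
    difference quotient there. *)
Lemma symmetric_difference_le (lambda r rho mu t : R) (w : V -> R) (c : V) (n : 'I_d) :
  0 < rho <= 1 -> rho < r -> 0 < mu -> helmholtz lambda (cube c r) w ->
  (forall x, cube c r x -> `|w x| <= mu) -> 0 <= t <= rho ->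
  `|w (c + t *: e_ n) - w (c - t *: e_ n)| <= 2 * (d%:R + `|lambda| + 1) * mu / rho * t.
Proof.
move=> /andP[rho0 rho1] rr mu0 wh wmu /andP[t0 tr].
suff bound s : s = 1 \/ s = -1 ->
    s * (w (c + t *: e_ n) - w (c - t *: e_ n)) <= 2 * (d%:R + `|lambda| + 1) * mu / rho * t.
  have := bound 1 (or_introl erefl); have := bound (-1) (or_intror erefl).
  by rewrite ler_norml; move=> ? ?; apply/andP; split; lra.
move=> s1.
have d1 : 1 <= d%:R :> R by rewrite ler1n; case: (d) n => [[]|].
pose A := mu / rho ^+ 2; pose N := (`|lambda| + 1) * mu.
have A0 : 0 < A by rewrite divr_gt0// exprn_gt0.
have N0 : 0 < N by rewrite mulr_gt0// ltr_wpDl.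
(* The Laplacian of the [A] terms vanishes; the [N] term makes [psi] a strict
   supersolution, and [s] selects the sign of the estimate. *)
pose psi (z : V) := A * (sq z + d%:R * rho * z 0 n - d%:R * z 0 n ^+ 2) +
   N / 2 * (rho * z 0 n - z 0 n ^+ 2).
pose phi (z : V) := w (z + c) + (-1) * w (c + flip n z).
pose h z := psi z + (- s / 2) * phi z.
pose a : V := \row_i (if i == n then 0 else - rho).
pose b : V := \row_i rho.
have psiL (z : V) : glaplacian psi z (- N).
  move=> e e0; exists 1 => // u _.
  suff -> : \sum_i sdiff psi z (u *: e_ i) = - N * u ^+ 2 by rewrite subrr normr0 mulr_ge0// ?sqr_ge0// ltW.
  have sd i : sdiff psi z (u *: e_ i) =
      2 * A * u ^+ 2 - (2 * d%:R * A + N) * u ^+ 2 * (i == n)%:R.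
    have := sq_sdiff z (u *: e_ i); rewrite sq_basis /sdiff /psi.
    set s1' := sq (z + _); set s2' := sq (z - _) => hs.
    have -> : s1' = 2 * u ^+ 2 + 2 * sq z - s2' by lra.
    by rewrite !mxE /= [n == i]eq_sym; case: eqP => _ /=; field.
  rewrite (eq_bigr _ (fun i _ => sd i)) sumrB sumr_const card_ord -mulr_sumr.
  rewrite (bigD1 n)//= big1 ?addr0 ?eqxx => [|j /negbTE ->//].
  rewrite -(mulr_natr _ d) /=; ring.
have inbox (z : V) : (forall i, a 0 i <= z 0 i <= b 0 i) ->
    [/\ cube c r (z + c), cube c r (c + flip n z) & forall i, `|z 0 i| <= rho].
  move=> zB.
  have zr i : `|z 0 i| <= rho.
    by have := zB i; rewrite !mxE ler_norml; case: eqP => _ /andP[z1 z2]; apply/andP; split; lra.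
  split => //; rewrite /cube/=.
    rewrite addrK; apply: le_lt_trans rr; apply: norm_le_coord => //; exact: ltW.
  rewrite addrC addKr; apply: le_lt_trans rr; apply: norm_le_coord => [|i]; first exact: ltW.
  by rewrite flipE; case: eqP => // _; rewrite normrN.
have hz (z : V) : (forall i, a 0 i <= z 0 i <= b 0 i) -> 0 <= h z.
  apply: box_minimum_principle => {}z zB.
  - have [/wh[c1 _] /wh[c2 _] _] := inbox z zB.
    have csq : {for z, continuous sq}.
      by apply: continuous_sum => j; apply: continuous_sqr; exact: continuous_coord.
    have cn : {for z, continuous (fun y : V => y 0 n)} := @continuous_coord R d n z.
    have cw1 : {for z, continuous (fun y : V => w (y + c))}.
      apply/(@continuous_distP R V R^o) => e /(proj1 (@continuous_distP R V R^o _ _) c1)[u u0 uP].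
      by exists u => // y yz; apply: uP; rewrite opprD addrACA subrr addr0.
    have cw2 : {for z, continuous (fun y : V => w (c + flip n y))}.
      apply/(@continuous_distP R V R^o) => e /(proj1 (@continuous_distP R V R^o _ _) c2)[u u0 uP].
      exists u => // y yz; apply: uP; rewrite opprD addrACA subrr add0r.
      apply: le_lt_trans yz; apply: norm_le_coord => // j.
      have sub (x y' : V) i : (x - y') 0 i = x 0 i - y' 0 i by rewrite mxE [(- y') 0 i]mxE.
      have := coord_le (y - z) j; have := coord_le (y - z) n; rewrite (sub (flip n y) (flip n z) j) (sub y z j) (sub y z n) !flipE.
      by case: eqP => // _ hn _; rewrite -opprB normrN opprK addrC.
    have csn := continuous_sqr cn.
    have hA (k : R) f : {for z, continuous f} -> {for z, continuous (fun y : V => k * f y)}.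
      exact: continuous_scal.
    have hD f g : {for z, continuous f} -> {for z, continuous g} ->
        {for z, continuous (fun y : V => f y + g y : R)} by move=> cf cg; exact: (cvgD cf cg).
    have hB f g : {for z, continuous f} -> {for z, continuous g} ->
        {for z, continuous (fun y : V => f y - g y : R)} by move=> cf cg; exact: (cvgB cf cg).
    exact: (hD _ _ (hD _ _ (hA A _ (hB _ _ (hD _ _ csq (hA (d%:R * rho) _ cn)) (hA d%:R _ csn)))
      (hA (N / 2) _ (hB _ _ (hA rho _ cn) csn))) (hA (- s / 2) _ (hD _ _ cw1 (hA (-1) _ cw2)))).
  - have [|c1 c2 _] := inbox z; first by move=> i; have /andP[/ltW -> /ltW ->] := zB i.
    have [_ g1] := wh _ c1; have [_ g2] := wh _ c2.
    have g := glaplacian_lin (- s / 2) (psiL z)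
      (glaplacian_lin (-1) (glaplacian_shift g1) (glaplacian_flip g2)).
    eexists; last exact: g.
    have := wmu _ c1; have := wmu _ c2.
    set w1 := w (z + c); set w2 := w _ => h2 h1.
    have -> : - N + - s / 2 * (lambda * w1 + -1 * (lambda * w2)) =
      - N - s * (lambda * ((w1 - w2) / 2)) by field.
    have : `|s * (lambda * ((w1 - w2) / 2))| <= `|lambda| * mu.
      rewrite !normrM (_ : `|s| = 1) ?mul1r; last by case: s1 => ->; rewrite ?normrN normr1.
      rewrite ler_wpM2l// (ger0_norm (_ : 0 <= 2^-1))//.
      by have := ler_normB w1 w2; lra.
    by rewrite ler_norml /N => /andP[+ _]; lra.
  - move=> [i ib]; have [c1 c2 zr] := inbox z zB.
    have phile : `|phi z| <= 2 * mu.
      rewrite /phi mulN1r; apply: le_trans (ler_normB _ _) _.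
      by have := wmu _ c1; have := wmu _ c2; lra.
    have shalf : `|s / 2 * phi z| <= mu.
      rewrite !normrM (_ : `|s| = 1) ?mul1r; last by case: s1 => ->; rewrite ?normrN normr1.
      by rewrite (ger0_norm (_ : 0 <= 2^-1))//; lra.
    have zn : 0 <= z 0 n <= rho by have := zB n; rewrite !mxE eqxx.
    have [zn1 zn2] := andP zn.
    have q0 : 0 <= rho * z 0 n - z 0 n ^+ 2.
      by rewrite (_ : _ - _ = z 0 n * (rho - z 0 n)); [rewrite mulr_ge0//; lra | ring].
    have sqge : z 0 n ^+ 2 <= sq z.
      by rewrite /sq (bigD1 n)//= lerDl sumr_ge0// => j _; exact: sqr_ge0.
    have key : rho ^+ 2 <= sq z + d%:R * rho * z 0 n - d%:R * z 0 n ^+ 2 -> 0 <= h z.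
      move=> /(ler_wpM2l (ltW A0)); rewrite {1}/A divfK ?expf_neq0 ?gt_eqF// => Amu.
      have Nq : 0 <= N / 2 * (rho * z 0 n - z 0 n ^+ 2) by rewrite mulr_ge0// ltW// divr_gt0.
      move: shalf; rewrite ler_norml /h /psi => /andP[_ hs].
      have -> : - s / 2 * phi z = - (s / 2 * phi z) by ring.
      lra.
    case: (eqVneq i n) => [ein|nin].
      subst i; case: ib => [z0|zrho].
        have z00 : z 0 n = 0 by rewrite z0 mxE eqxx.
        have fz : flip n z = z by apply/rowP => j; rewrite flipE; case: eqP => // ->; rewrite z00 oppr0.
        have phi0 : phi z = 0 by rewrite /phi fz [z + c]addrC mulN1r subrr.
        have : 0 <= A * sq z by rewrite mulr_ge0 ?(ltW A0)// sumr_ge0// => j _; exact: sqr_ge0.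
        by rewrite /h phi0 /psi z00; lra.
      apply: key; move: sqge; rewrite zrho mxE; lra.
    apply: key.
    have zi2 : z 0 i ^+ 2 = rho ^+ 2.
      by case: ib => ->; rewrite mxE ?(negbTE nin) ?sqrrN.
    have sq2 : z 0 i ^+ 2 + z 0 n ^+ 2 <= sq z.
      rewrite /sq (bigD1 i)//= (bigD1 n)/= 1?eq_sym// addrA lerDl sumr_ge0// => j _; exact: sqr_ge0.
    have : 0 <= d%:R * (rho * z 0 n - z 0 n ^+ 2) by rewrite mulr_ge0// ?ler0n.
    have := sqr_ge0 (z 0 n); move: sq2; rewrite zi2; lra.
have box (i : 'I_d) : a 0 i <= (t *: e_ n) 0 i <= b 0 i.
  by rewrite !mxE !eqxx/=; case: (i == n); rewrite ?mulr1 ?mulr0; apply/andP; split; lra.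
have zn : (t *: e_ n) 0 n = t by rewrite !mxE !eqxx mulr1.
have fl : flip n (t *: e_ n) = - (t *: e_ n).
  apply/rowP => j; rewrite flipE zn !mxE eqxx /=.
  by case: eqP => _ /=; rewrite ?mulr1// mulr0 oppr0.
have := hz (t *: e_ n) box.
rewrite /h /psi /phi sq_basis zn fl [t *: _ + c]addrC.
set w1 := w (c + t *: e_ n); set w2 := w (c - t *: e_ n) => H.
pose m := mu / rho.
have m0 : 0 < m by rewrite divr_gt0.
have muE : mu = m * rho by rewrite /m divfK// gt_eqF.
have AE : A * rho = m by rewrite /A /m; field; rewrite gt_eqF.
have h1 : A * (t ^+ 2 + d%:R * rho * t - d%:R * t ^+ 2) <= d%:R * m * t.
  have : 0 <= A * ((d%:R - 1) * t ^+ 2).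
    by rewrite mulr_ge0 ?(ltW A0)// mulr_ge0 ?sqr_ge0// subr_ge0.
  by rewrite -AE; lra.
have h2 : N / 2 * (rho * t - t ^+ 2) <= (`|lambda| + 1) * m * t.
  have l0 : 0 <= (`|lambda| + 1) * m by rewrite mulr_ge0// ltW.
  have r2 : rho ^+ 2 <= 1 by rewrite expr_le1// ltW.
  have : 0 <= N * t ^+ 2 by rewrite mulr_ge0 ?sqr_ge0// ltW.
  have : 0 <= (`|lambda| + 1) * m * (1 - rho ^+ 2) * t.
    by rewrite mulr_ge0// mulr_ge0// subr_ge0.
  have : 0 <= (`|lambda| + 1) * m * t by rewrite mulr_ge0.
  by rewrite /N muE; lra.
have -> : 2 * (d%:R + `|lambda| + 1) * mu / rho * t =
  2 * (d%:R * m * t) + 2 * ((`|lambda| + 1) * m * t) by rewrite /m; ring.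
lra.
Qed.
End InteriorEstimate.

(** * Unique continuation *)

Lemma bin_le_expn2 n k : ('C(n, k) <= 2 ^ n)%N.
Proof.
elim: n k => [|n IH] [|k] //; first by rewrite bin0 expn_gt0.
by rewrite binS expnS mul2n -addnn leq_add.
Qed.

Lemma expn_le_ffact k j : (k ^ j <= (k + j) ^_ j)%N.
Proof.
elim: j => [|j IH]; first by rewrite ffactn0.
by rewrite addnS ffactSS expnS leq_mul// leqW// leq_addr.
Qed.

(** A substitute for the formula of Stirling. *)
Lemma expn_self_le k : (k ^ k <= 4 ^ k * k`!)%N.
Proof.
apply: leq_trans (expn_le_ffact k k) _; rewrite -bin_ffact leq_mul2r.
by apply/orP; right; apply: leq_trans (bin_le_expn2 _ _) _; rewrite addnn -mul2n expnM.
Qed.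

Lemma ffact_le_expn N k : (N ^_ k <= N ^ k)%N.
Proof.
elim: k => [|k IH]; first by rewrite ffactn0.
by rewrite ffactnSr expnSr leq_mul// leq_subr.
Qed.

(** The bound for a difference of order [k] contains [k ^ k], the price of
    splitting the cube into [k] layers; it is absorbed here. *)
Lemma bin_expn_le N k : ('C(N, k) * k ^ k <= (4 * N) ^ k)%N.
Proof.
apply: leq_trans (_ : 'C(N, k) * (4 ^ k * k`!) <= _)%N; first by rewrite leq_mul// expn_self_le.
by rewrite mulnCA bin_ffact expnMn leq_mul// ffact_le_expn.
Qed.

Lemma geometric_tail (R : realType) m j :
  \sum_(k < m.+1 + j) (m < k)%:R / 2 ^+ k <= (2 ^+ m)^-1 - (2 ^+ (m + j))^-1 :> R.
Proof.
elim: j => [|j IH].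
  rewrite !addn0 subrr big1// => k _.
  by rewrite ltnNge -ltnS ltn_ord mul0r.
rewrite addnS big_ord_recr/= ltnS addSn leq_addr mul1r addnS.
have E : (2 ^+ (m + j))^-1 = 2 * (2 ^+ (m + j).+1)^-1 :> R.
  by rewrite exprS invfM mulrA divff ?mul1r.
by rewrite addSn E in IH *; lra.
Qed.

Section FiniteDifferences.
Context {R : realType} {d : nat}.
Local Notation V := 'rV[R]_d.
Local Notation e_ := (@basis_vec R d).

Definition fdiff (v : V) (w : V -> R) : V -> R := fun x => w (x + v) + (-1) * w x.

Lemma newton_forward (v : V) N (w : V -> R) x :
  w (x + v *+ N) = \sum_(k < N.+1) ('C(N, k))%:R * iter k (fdiff v) w x.
Proof.
elim: N x => [|N IH] x; first by rewrite mulr0n addr0 big_ord_recl big_ord0 bin0 mul1r addr0.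
have shift k y : iter k (fdiff v) w (y + v) = iter k (fdiff v) w y + iter k.+1 (fdiff v) w y.
  by rewrite iterS; set f := iter k _ _; rewrite /fdiff; ring.
rewrite mulrS addrA IH.
under eq_bigr do rewrite shift mulrDr.
rewrite big_split/=; pose a k := iter k (fdiff v) w x.
transitivity (a 0%N + \sum_(k < N.+1) ('C(N.+1, k.+1))%:R * a k.+1); last first.
  by rewrite [RHS]big_ord_recl bin0 mul1r.
transitivity (a 0%N + (\sum_(k < N.+1) ('C(N, k.+1))%:R * a k.+1 +
    \sum_(k < N.+1) ('C(N, k))%:R * a k.+1)); last first.
  by congr (_ + _); rewrite -big_split/=; apply: eq_bigr => k _; rewrite binS natrD mulrDl.
rewrite addrA; congr (_ + _).
rewrite big_ord_recl bin0 mul1r; congr (_ + _).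
by rewrite [in RHS]big_ord_recr/= bin_small// mul0r addr0.
Qed.

Lemma iter_fdiff_eq0 (v : V) (w : V -> R) k x :
  (forall j, (j <= k)%N -> w (x + v *+ j) = 0) -> iter k (fdiff v) w x = 0.
Proof.
elim: k x => [|k IH] x h /=; first by have := h 0%N (leqnn _); rewrite mulr0n addr0.
rewrite /fdiff !IH ?mulr0 ?addr0// => j jk; first exact: h (leqW jk).
by rewrite -addrA -mulrS; exact: h.
Qed.

Lemma helmholtz_sub (lambda : R) (U U' : set V) w :
  U' `<=` U -> helmholtz lambda U w -> helmholtz lambda U' w.
Proof. by move=> UU h x /UU; exact: h. Qed.

Lemma continuous_shift (w : V -> R) (v x : V) :
  {for x + v, continuous w} -> {for x, continuous (fun y : V => w (y + v))}.
Proof.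
move=> /(@continuous_distP R V R^o) c; apply/(@continuous_distP R V R^o) => e /c[r r0 h].
by exists r => // y yx; apply: h; rewrite opprD addrACA subrr addr0.
Qed.

Lemma continuous_lin (w1 w2 : V -> R) (a : R) (x : V) :
  {for x, continuous w1} -> {for x, continuous w2} ->
  {for x, continuous (fun y : V => w1 y + a * w2 y)}.
Proof. by move=> c1 c2; exact: (cvgD c1 (continuous_scal (a := a) c2)). Qed.

Lemma helmholtz_lin (lambda a : R) (U : set V) (w1 w2 : V -> R) :
  helmholtz lambda U w1 -> helmholtz lambda U w2 ->
  helmholtz lambda U (fun y => w1 y + a * w2 y).
Proof.
move=> h1 h2 x Ux; have [c1 g1] := h1 x Ux; have [c2 g2] := h2 x Ux.
split; first exact: continuous_lin.
by rewrite mulrDr mulrCA; exact: glaplacian_lin.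
Qed.

Lemma helmholtz_shift (lambda : R) (U : set V) (v : V) (w : V -> R) :
  helmholtz lambda U w -> helmholtz lambda [set x | U (x + v)] (fun y => w (y + v)).
Proof.
move=> h x /h[c g]; split; first exact: continuous_shift.
exact: glaplacian_shift.
Qed.

Lemma cube_sub (c m : V) (r s : R) : `|m - c| + s <= r -> cube m s `<=` cube c r.
Proof.
move=> ms x; rewrite /cube/= => xm.
by have := ler_normD (x - m) (m - c); rewrite subrKA; lra.
Qed.

Definition lip_const (lambda : R) : R := d%:R * (d%:R + `|lambda| + 1) + 1.

Lemma lip_const_ge1 lambda : 1 <= lip_const lambda.
Proof. by rewrite lerDr mulr_ge0// addr_ge0// addr_ge0. Qed.

(** The increment is performed one coordinate at a time, and each of these
    increments is a symmetric difference around its midpoint. *)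
Lemma lipschitz_le (lambda r rho mu h : R) (w : V -> R) (c v : V) :
  0 < rho <= 1 -> 2 * rho < r -> 0 < mu -> helmholtz lambda (cube c r) w ->
  (forall x, cube c r x -> `|w x| <= mu) -> `|v| <= h -> h <= rho ->
  `|w (c + v) - w c| <= lip_const lambda * h / rho * mu.
Proof.
move=> rho01 rr mu0 wh wmu vh hrho; have /andP[rho0 rho1] := rho01.
pose K := (d%:R + `|lambda| + 1) * h / rho * mu.
have h0 : 0 <= h by apply: le_trans vh.
have K0 : 0 <= K by rewrite !mulr_ge0 ?invr_ge0 ?(ltW rho0) ?(ltW mu0)// addr_ge0// addr_ge0.
pose y k : V := \row_j (if (j < k)%N then v 0 j else 0).
have step (k : 'I_d) : `|w (c + y k.+1) - w (c + y k)| <= K.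
  pose s := v 0 k / 2.
  pose m : V := c + y k + s *: e_ k.
  have ym : c + y k = m - s *: e_ k by rewrite addrK.
  have yS : c + y k.+1 = m + s *: e_ k.
    rewrite /m -!addrA; congr (_ + _); apply/rowP => j; rewrite !mxE eqxx/= ltnS leq_eqVlt.
    case: (eqVneq j k) => [->|jk]; first by rewrite eqxx ltnn /= /s; field.
    by rewrite (_ : (j == k :> nat) = false) ?(negbTE jk)//= ?mulr0 ?addr0//; apply/negbTE.
  have mc : `|m - c| <= rho.
    apply: le_trans (_ : `|v| <= _); last exact: le_trans vh _.
    rewrite /m -(addrA c) [c + _]addrC addrK; apply: norm_le_coord => // j; have := coord_le v j.
    rewrite !mxE eqxx/=; case: (eqVneq j k) => [->|jk]; rewrite ?ltnn ?mulr1 ?add0r ?mulr0 ?addr0.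
      rewrite /s normrM (ger0_norm (_ : 0 <= 2^-1))//.
      by have := normr_ge0 (v 0 k); lra.
    by case: ifP; rewrite ?normr0.
  have sub : cube m (r - rho) `<=` cube c r by apply: cube_sub; lra.
  have sh : `|s| <= h / 2.
    rewrite /s normrM (ger0_norm (_ : 0 <= 2^-1))//.
    by have := coord_le v k; lra.
  have est t : `|t| <= h / 2 -> 0 <= t -> `|w (m + t *: e_ k) - w (m - t *: e_ k)| <= K.
    move=> th t0; rewrite ger0_norm// in th.
    have tr : 0 <= t <= rho by rewrite t0; lra.
    apply: le_trans (symmetric_difference_le k rho01 (_ : rho < r - rho) mu0
      (helmholtz_sub sub wh) (fun x xm => wmu x (sub x xm)) tr) _; first lra.
    have -> : 2 * (d%:R + `|lambda| + 1) * mu / rho * t =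
      (d%:R + `|lambda| + 1) * mu / rho * (2 * t) by ring.
    have -> : K = (d%:R + `|lambda| + 1) * mu / rho * h by rewrite /K; ring.
    apply: ler_wpM2l; last lra.
    by rewrite !mulr_ge0 ?invr_ge0 ?(ltW rho0) ?(ltW mu0)// addr_ge0// addr_ge0.
  rewrite yS ym; have [s0|/ltW s0] := leP 0 s; first exact: est.
  have := est (- s) (ltac:(by rewrite normrN)) (ltac:(by rewrite oppr_ge0)).
  by rewrite scaleNr opprK distrC.
have sum k : (k <= d)%N -> `|w (c + y k) - w c| <= k%:R * K.
  elim: k => [_|k IH kd].
    have -> : y 0%N = 0 by apply/rowP => j; rewrite !mxE.
    by rewrite addr0 subrr normr0 mul0r.
  have := step (Ordinal kd); have := IH (ltnW kd).
  have := ler_normD (w (c + y k.+1) - w (c + y k)) (w (c + y k) - w c).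
  by rewrite subrKA -natr1 /=; lra.
have := sum d (leqnn d).
have -> : y d = v by apply/rowP => j; rewrite mxE ltn_ord.
move/le_trans; apply.
have -> : d%:R * K = (d%:R * (d%:R + `|lambda| + 1)) * (h / rho * mu) by rewrite /K; ring.
have -> : lip_const lambda * h / rho * mu = lip_const lambda * (h / rho * mu) by ring.
apply: ler_wpM2r; last by rewrite lerDl.
by rewrite mulr_ge0 ?(ltW mu0)// divr_ge0// ltW.
Qed.

(** Differences of solutions are solutions, so the Lipschitz estimate can be
    iterated; each step costs a layer of width [3 rho]. *)
Lemma iter_fdiff_le (lambda r rho mu h : R) (w : V -> R) (c v : V) k :
  0 < rho <= 1 -> 0 < mu -> 0 < h -> helmholtz lambda (cube c r) w ->
  (forall x, cube c r x -> `|w x| <= mu) -> `|v| <= h -> h <= rho ->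
  helmholtz lambda (cube c (r - 3 * rho * k%:R)) (iter k (fdiff v) w) /\
  forall x, cube c (r - 3 * rho * k%:R) x ->
    `|iter k (fdiff v) w x| <= (lip_const lambda * h / rho) ^+ k * mu.
Proof.
move=> rho01 mu0 h0 wh wmu vh hrho; have /andP[rho0 rho1] := rho01.
have q0 : 0 < lip_const lambda * h / rho.
  by rewrite divr_gt0// mulr_gt0// (lt_le_trans ltr01)// lip_const_ge1.
elim: k => [|k [IH1 IH2]].
  by rewrite mulr0 subr0; split => // x /wmu; rewrite expr0 mul1r.
have sub : cube c (r - 3 * rho * k.+1%:R) `<=` cube c (r - 3 * rho * k%:R).
  by apply: cube_sub; rewrite subrr normr0 -natr1; lra.
split.
  refine (helmholtz_lin (w1 := fun y => iter k (fdiff v) w (y + v)) (-1) _ (helmholtz_sub sub IH1)).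
  have S := helmholtz_shift (v := v) IH1.
  refine (helmholtz_sub _ S) => x; rewrite /cube/= => xc.
  apply: le_lt_trans (_ : `|x - c| + `|v| < _); first by rewrite addrAC ler_normD.
  by rewrite -natr1 in xc; lra.
move=> x xc; rewrite iterS {1}/fdiff mulN1r.
have subx : cube x (3 * rho) `<=` cube c (r - 3 * rho * k%:R).
  by apply: cube_sub; move: xc; rewrite /cube/= -natr1; lra.
have := lipschitz_le rho01 (_ : 2 * rho < 3 * rho) _ (helmholtz_sub subx IH1)
  (fun y yx => IH2 y (subx y yx)) vh hrho.
move=> /(_ ltac:(lra) (mulr_gt0 (exprn_gt0 _ q0) mu0)); rewrite mulrA -exprS; exact.
Qed.

End FiniteDifferences.

Section UniqueContinuation.
Context {R : realType} {d : nat}.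
Local Notation V := 'rV[R]_d.

(** Chosen so that the term of order [k] in the formula of Newton is at most
    [2 ^- k]. *)
Definition ucp_const (lambda : R) : R := (48 * lip_const (d := d) lambda)^-1.

Lemma ucp_const_bounds lambda : 0 < ucp_const lambda <= 1 / 48.
Proof.
have c1 := lip_const_ge1 (d := d) lambda.
rewrite /ucp_const; apply/andP; split; first by rewrite invr_gt0; lra.
by rewrite div1r lef_pV2 ?posrE; lra.
Qed.

(** With step [e / N] the differences of order [k <= m ~ sigma N] vanish at the
    starting point, those of higher order are at most [2 ^ - k], and [m] tends
    to infinity with [N]. *)
Lemma unique_continuation_ray (lambda r mu sigma : R) (w : V -> R) (c e : V) :
  0 < r <= 1 -> 0 < mu -> helmholtz lambda (cube c r) w ->
  (forall x, cube c r x -> `|w x| <= mu) -> `|e| <= ucp_const lambda * r ->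
  0 < sigma -> (forall s, 0 <= s <= sigma -> w (c + s *: e) = 0) ->
  w (c + e) = 0.
Proof.
move=> /andP[r0 r1] mu0 wh wmu er s0 w0.
apply/eqP; rewrite -normr_le0 leNgt; apply/negP => wpos.
have [m mw] := small_geometric mu wpos.
pose N := (Num.truncn (m%:R / sigma)).+1.
have N0 : 0 < N%:R :> R by rewrite ltr0n.
have mN : m%:R / N%:R <= sigma.
  by rewrite ler_pdivrMr// mulrC -ler_pdivrMr//; apply/ltW/truncnS_gt.
have /andP[eta0 eta1] := ucp_const_bounds lambda.
have C1 := lip_const_ge1 (d := d) lambda.
pose v : V := N%:R^-1 *: e.
pose h := ucp_const lambda * r / N%:R.
have vh : `|v| <= h.
  rewrite /h normrZ ger0_norm; last by rewrite invr_ge0 ltW.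
  rewrite [leLHS]mulrC; apply: ler_wpM2r => //.
have h0 : 0 < h by rewrite divr_gt0// mulr_gt0.
have vN j : c + v *+ j = c + (j%:R / N%:R) *: e.
  by rewrite /v -scaler_nat scalerA.
have Eq : w (c + e) = \sum_(k < N.+1) ('C(N, k))%:R * iter k (fdiff v) w c.
  by rewrite -newton_forward vN divff ?scale1r// gt_eqF.
have bound (k : 'I_N.+1) : `|('C(N, k))%:R * iter k (fdiff v) w c| <= (m < k)%:R / 2 ^+ k * mu.
  have [km|mk] := leqP k m.
    rewrite iter_fdiff_eq0 ?mulr0 ?normr0 ?mul0r// => j jk; rewrite vN w0//.
    apply/andP; split; first by rewrite divr_ge0.
    apply: le_trans mN; apply: ler_wpM2r; first by rewrite invr_ge0 ltW.
    by rewrite ler_nat (leq_trans jk).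
  have k0 : 0 < k%:R :> R by rewrite ltr0n (leq_trans _ mk).
  have kN : k%:R <= N%:R :> R by rewrite ler_nat -ltnS.
  have k1 : 1 <= k%:R :> R by rewrite ler1n (leq_trans _ mk).
  (* The [k] layers of width [3 rho] fill half of the cube. *)
  pose rho := r / (6 * k%:R).
  have rho0 : 0 < rho by rewrite divr_gt0// mulr_gt0.
  have rhok : rho * k%:R = r / 6 by rewrite /rho; field; rewrite gt_eqF.
  have rho1 : rho <= 1.
    by rewrite ler_pdivrMr ?mulr_gt0//; lra.
  have hrho : h <= rho.
    rewrite /h ler_pdivrMr//.
    have : rho * k%:R <= rho * N%:R by rewrite ler_wpM2l// ltW.
    have : ucp_const lambda * r <= 1 / 48 * r by rewrite ler_wpM2r// ltW.
    by rewrite rhok; lra.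
  have [_ /(_ c)] := @iter_fdiff_le R d lambda r rho mu h w c v k
    (ltac:(by rewrite rho0)) mu0 h0 wh wmu vh hrho.
  rewrite /cube/= subrr normr0 => /(_ _)H.
  rewrite normrM normr_nat; apply: le_trans (ler_wpM2l (ler0n _ _) (H _)) _.
    by rewrite -mulrA rhok; lra.
  have -> : lip_const (d := d) lambda * h / rho = k%:R / (8 * N%:R).
    rewrite /h /rho /ucp_const; field.
    by rewrite !gt_eqF//; lra.
  rewrite mulrA ler_wpM2r ?(ltW mu0)// mul1r expr_div_n mulrA.
  rewrite ler_pdivrMr ?exprn_gt0 ?mulr_gt0// -exprVn -exprMn.
  have -> : 2^-1 * (8 * N%:R) = (4 * N)%:R :> R by rewrite natrM; field.
  by rewrite -!natrX -natrM ler_nat; exact: bin_expn_le.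
have : `|w (c + e)| <= mu / 2 ^+ m.
  rewrite Eq; apply: le_trans (ler_norm_sum _ _ _) _.
  apply: le_trans (ler_sum _ (fun k _ => bound k)) _.
  rewrite -mulr_suml mulrC ler_wpM2l ?(ltW mu0)//.
  have mN' : (m.+1 + (N - m) = N.+1)%N \/ (N <= m)%N.
    by have [?|?] := leqP N m; [right|left; rewrite addSn subnKC// ltnW].
  case: mN' => [<-|Nm].
    apply: le_trans (geometric_tail _ _ _) _.
    by rewrite lerBlDr lerDl invr_ge0 exprn_ge0.
  rewrite big1 ?invr_ge0 ?exprn_ge0// => k _.
  by rewrite ltnNge (leq_trans _ Nm) ?mul0r// -ltnS.
by rewrite leNgt mw.
Qed.

Lemma locally_bounded (w : V -> R) (x : V) : {for x, continuous w} ->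
  exists2 r : R, 0 < r & forall y, `|y - x| < r -> `|w y| <= `|w x| + 1.
Proof.
move=> /(@continuous_distP R V R^o)/(_ 1 ltr01)[r r0 h]; exists r => // y /h yx.
by have := ler_normD (w y - w x) (w x); rewrite subrK; lra.
Qed.

(** All points close to the centre are ends of rays that start inside the
    given cube of zeros. *)
Lemma unique_continuation_local (lambda r : R) (w : V -> R) (x : V) : 0 < r ->
  helmholtz lambda (cube x r) w ->
  exists2 s, 0 < s & forall x1 e, cube x s x1 -> 0 < e ->
    (forall y, cube x1 e y -> w y = 0) -> forall y, cube x s y -> w y = 0.
Proof.
move=> r0 wh; have cx : cube x r x by rewrite /cube/= subrr normr0.
have [r' r'0 wb] := locally_bounded (wh x cx).1.
pose rho := Num.min 1 (Num.min r r').
have rho0 : 0 < rho by rewrite !lt_min ltr01 r0.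
have /and3P[rho1 rhor rhor'] : [&& rho <= 1, rho <= r & rho <= r'].
  by rewrite !ge_min !lexx !orbT.
have /andP[eta0 eta1] := ucp_const_bounds lambda.
exists (ucp_const lambda * rho / 4) => [|x1 e x1x e0 w0 y yx]; first by rewrite divr_gt0 ?mulr_gt0.
have etarho : ucp_const lambda * rho <= 1 / 48 * rho by rewrite ler_wpM2r// ltW.
have sub : cube x1 (rho / 2) `<=` cube x rho.
  by apply: cube_sub; move: x1x; rewrite /cube/=; lra.
have ye : `|y - x1| <= ucp_const lambda * (rho / 2).
  have := ler_normD (y - x) (x - x1); rewrite subrKA distrC.
  by move: x1x yx; rewrite /cube/= [`|x - _|]distrC; lra.
pose sigma := e / 2 / (`|y - x1| + 1).
have n0 : 0 < `|y - x1| + 1 by rewrite ltr_wpDl.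
have := @unique_continuation_ray lambda (rho / 2) (`|w x| + 1) sigma w x1 (y - x1).
rewrite [x1 + (y - x1)]addrC subrK; apply => //.
- by apply/andP; split; lra.
- by apply: helmholtz_sub wh => z /sub; rewrite /cube/=; lra.
- by move=> z /sub zx; apply: wb; move: zx; rewrite /cube/=; lra.
- by rewrite !divr_gt0.
move=> s /andP[s0]; rewrite /sigma ler_pdivlMr// => se.
apply: w0; rewrite /cube/= addrC addKr normrZ ger0_norm//.
by move: se; rewrite mulrDr mulr1; lra.
Qed.

(** Unique continuation along an arbitrary connected set, for instance a
    segment or the whole domain. *)
Lemma unique_continuation (lambda : R) (U E : set V) (w : V -> R) (x0 : V) :
  open U -> E `<=` U -> connected E -> helmholtz lambda U w -> E x0 ->
  (\forall y \near x0, w y = 0) -> forall x, E x -> \forall y \near x, w y = 0.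
Proof.
move=> oU EU cE wh Ex0 w0.
pose A : set V := [set x | \forall y \near x, w y = 0].
have oA : open A.
  rewrite openE => x Ax; exact: nbhs_interior Ax.
suff : E `&` A = E by move=> EA x; rewrite -EA => -[].
apply: cE.
- by exists x0.
- by exists A.
exists (closure A); first exact: closed_closure.
apply/seteqP; split => x [Ex Ax]; split => //; first exact: subset_closure.
have /nbhs_distP[r r0 rU] : nbhs x U by apply: open_nbhs_nbhs; split => //; exact: EU.
have [s s0 h] := @unique_continuation_local lambda r w x r0 (helmholtz_sub rU wh).
have [y [Ay yx]] : (A `&` cube x s) !=set0.
  by apply: Ax; apply/nbhs_distP; exists s.
have /nbhs_distP[e e0 we] : nbhs y [set z | w z = 0] by [].
apply/nbhs_distP; exists s => // z zx; exact: (h y e).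
Qed.
End UniqueContinuation.

(** * Inner products and differential calculus *)

Section InnerProduct.
Context {R : realType} {d : nat}.
Local Notation V := 'rV[R]_d.
Implicit Types x y z : V.

Definition dot x y : R := \sum_i x 0 i * y 0 i.
Definition enorm x : R := Num.sqrt (dot x x).

Lemma dotC x y : dot x y = dot y x.
Proof. by apply: eq_bigr => i _; rewrite mulrC. Qed.
Lemma dotDl x y z : dot (x + y) z = dot x z + dot y z.
Proof. by rewrite -big_split; apply: eq_bigr => i _; rewrite mxE mulrDl. Qed.
Lemma dotDr x y z : dot z (x + y) = dot z x + dot z y.
Proof. by rewrite !(dotC z) dotDl. Qed.
Lemma dotZl a x y : dot (a *: x) y = a * dot x y.
Proof. by rewrite mulr_sumr; apply: eq_bigr => i _; rewrite mxE mulrA. Qed.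
Lemma dotZr a x y : dot x (a *: y) = a * dot x y.
Proof. by rewrite !(dotC x) dotZl. Qed.
Lemma dotNl x y : dot (- x) y = - dot x y.
Proof. by rewrite -scaleN1r dotZl mulN1r. Qed.
Lemma dotNr x y : dot x (- y) = - dot x y.
Proof. by rewrite !(dotC x) dotNl. Qed.
Lemma dot0l x : dot 0 x = 0.
Proof. by rewrite -(scale0r 0) dotZl mul0r. Qed.
Lemma dot0r x : dot x 0 = 0.
Proof. by rewrite dotC dot0l. Qed.
Definition dotE := (dotDl, dotDr, dotNl, dotNr, dotZl, dotZr, dot0l, dot0r).

Lemma dot_ge0 x : 0 <= dot x x.
Proof. by apply: sumr_ge0 => i _; rewrite -expr2 sqr_ge0. Qed.

Lemma dot_eq0 x : (dot x x == 0) = (x == 0).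
Proof.
apply/eqP/eqP => [x0|->]; last by rewrite dot0l.
apply/rowP => i; rewrite mxE; apply/eqP; rewrite -sqrf_eq0 expr2; apply/eqP.
by apply: (psumr_eq0P _ x0) => // j _; rewrite -expr2 sqr_ge0.
Qed.

Lemma enorm_ge0 x : 0 <= enorm x. Proof. exact: sqrtr_ge0. Qed.
Lemma sqr_enorm x : enorm x ^+ 2 = dot x x.
Proof. by rewrite sqr_sqrtr// dot_ge0. Qed.
Lemma enorm_eq0 x : (enorm x == 0) = (x == 0).
Proof. by rewrite -sqrf_eq0 sqr_enorm dot_eq0. Qed.
Lemma enorm0 : enorm 0 = 0. Proof. by apply/eqP; rewrite enorm_eq0. Qed.
Lemma enorm_gt0 x : (0 < enorm x) = (x != 0).
Proof. by rewrite lt_def enorm_eq0 enorm_ge0 andbT. Qed.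
Lemma enormZ a x : enorm (a *: x) = `|a| * enorm x.
Proof. by rewrite /enorm dotZl dotZr mulrA -expr2 sqrtrM ?sqr_ge0// sqrtr_sqr. Qed.
Lemma enormN x : enorm (- x) = enorm x.
Proof. by rewrite -scaleN1r enormZ normrN1 mul1r. Qed.
Lemma enormB x y : enorm (x - y) = enorm (y - x).
Proof. by rewrite -enormN opprB. Qed.

Lemma cauchy_schwarz x y : `|dot x y| <= enorm x * enorm y.
Proof.
rewrite -(ler_pXn2r (_ : (0 < 2)%N)) ?nnegrE ?mulr_ge0 ?enorm_ge0//.
rewrite exprMn !sqr_enorm real_normK ?num_real//.
have [->|y0] := eqVneq y 0; first by rewrite !dot0r expr0n mulr0.
have yy : 0 < dot y y by rewrite lt_def dot_eq0 y0 dot_ge0.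
have := dot_ge0 (dot y y *: x - dot x y *: y).
rewrite !dotE (dotC y x) => H.
rewrite -subr_ge0 -(pmulr_rge0 _ yy); move: H; congr (_ <= _); ring.
Qed.

Lemma enormD x y : enorm (x + y) <= enorm x + enorm y.
Proof.
rewrite -(ler_pXn2r (_ : (0 < 2)%N)) ?nnegrE ?addr_ge0 ?enorm_ge0//.
rewrite sqrrD !sqr_enorm !dotE (dotC y x).
by have := le_trans (ler_norm _) (cauchy_schwarz x y); lra.
Qed.

Lemma edistE x y : Defs.edist x y = enorm (x - y).
Proof. by rewrite /Defs.edist /enorm; congr Num.sqrt; apply: eq_bigr => i _; rewrite !mxE expr2. Qed.

Lemma enorm_dist x y z : enorm (x - z) <= enorm (x - y) + enorm (y - z).
Proof. by have := enormD (x - y) (y - z); rewrite addrA subrK. Qed.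

Lemma ler_enorm_sub x y : `|enorm x - enorm y| <= enorm (x - y).
Proof.
have := enormD (x - y) y; have := enormD (y - x) x; rewrite !subrK (enormB y x).
by rewrite ler_norml => ? ?; apply/andP; split; lra.
Qed.

Lemma norm_le_enorm x : `|x| <= enorm x.
Proof.
apply: norm_le_coord; first exact: enorm_ge0.
move=> i; rewrite -(ler_pXn2r (_ : (0 < 2)%N)) ?nnegrE ?enorm_ge0// sqr_enorm real_normK ?num_real//.
by rewrite /dot (bigD1 i)//= -expr2 lerDl sumr_ge0// => j _; rewrite -expr2 sqr_ge0.
Qed.

Lemma enorm_le_norm x : enorm x <= (d%:R + 1) * `|x|.
Proof.
rewrite -(ler_pXn2r (_ : (0 < 2)%N)) ?nnegrE ?mulr_ge0 ?enorm_ge0 ?addr_ge0// sqr_enorm exprMn.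
apply: le_trans (_ : d%:R * `|x| ^+ 2 <= _).
  rewrite /dot mulr_natl -[X in _ *+ X]card_ord -sumr_const; apply: ler_sum => i _.
  by rewrite -expr2 -real_normK ?num_real// lerXn2r ?nnegrE// coord_le.
apply: ler_wpM2r; first by rewrite sqr_ge0.
by have := ler0n R d; have := sqr_ge0 (d%:R : R); lra.
Qed.

Lemma dot_basis x (i : 'I_d) : dot (basis_vec i) x = x 0 i.
Proof.
rewrite /dot (bigD1 i)//= basis_vecE eqxx mul1r big1 ?addr0// => j ji.
by rewrite basis_vecE eq_sym (negbTE ji) mul0r.
Qed.

Lemma sum_basis x : x = \sum_i x 0 i *: basis_vec i.
Proof. by rewrite [LHS]row_sum_delta. Qed.

Lemma dot_mulmx n (x : V) (A : 'M[R]_(d, n)) (y : 'rV[R]_n) :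
  \sum_i (x *m A) 0 i * y 0 i = dot x (y *m A^T).
Proof.
have dmx m (u v : 'rV[R]_m) : \sum_i u 0 i * v 0 i = (u *m v^T) 0 0.
  by rewrite mxE; apply: eq_bigr => i _; rewrite mxE.
by rewrite /dot !dmx trmx_mul trmxK mulmxA.
Qed.

Lemma dot_mxr x (A : 'M[R]_d) y : dot (x *m A) y = dot x (y *m A^T).
Proof. exact: dot_mulmx. Qed.

Lemma nbhs_enormP (x : V) (P : set V) :
  nbhs x P <-> exists2 e : R, 0 < e & forall y, enorm (y - x) < e -> P y.
Proof.
split=> [/nbhs_distP[e e0 eP]|[e e0 eP]].
  by exists e => // y yx; apply: eP; apply: le_lt_trans yx; exact: norm_le_enorm.
apply/nbhs_distP; exists (e / (d%:R + 1)); first by rewrite divr_gt0// ltr_wpDl.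
move=> y yx; apply: eP; apply: le_lt_trans (enorm_le_norm _) _.
by rewrite mulrC -ltr_pdivlMr// ltr_wpDl.
Qed.

Lemma continuous_enormP (W : normedModType R) (f : V -> W) (x : V) :
  {for x, continuous f} <-> forall e : R, 0 < e ->
    exists2 r : R, 0 < r & forall y, enorm (y - x) < r -> `|f y - f x| < e.
Proof.
split=> [/continuous_distP h e /h[r r0 hr]|h].
  by exists r => // y yx; apply: hr; apply: le_lt_trans yx; exact: norm_le_enorm.
apply/continuous_distP => e /h[r r0 hr].
exists (r / (d%:R + 1)); first by rewrite divr_gt0// ltr_wpDl.
move=> y yx; apply: hr; apply: le_lt_trans (enorm_le_norm _) _.
by rewrite mulrC -ltr_pdivlMr// ltr_wpDl.
Qed.

Lemma open_enormP (A : set V) : open A -> forall x, A x ->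
  exists2 e : R, 0 < e & forall y, enorm (y - x) < e -> A y.
Proof. by move=> oA x Ax; apply/nbhs_enormP; apply: open_nbhs_nbhs. Qed.

End InnerProduct.

Section Differentials.
Context {R : realType} {d : nat}.
Local Notation V := 'rV[R]_d.
Local Notation e_ := (@basis_vec R d).

Lemma is_derive_eps (g : R -> R) (x l : R) : is_derive x 1 g l ->
  forall e : R, 0 < e -> exists2 r : R, 0 < r & forall t, `|t| < r ->
    `|g (x + t) - g x - t * l| <= e * `|t|.
Proof.
move=> [gd gl] e e0.
have /cvgrPdist_lt/(_ e e0)/nbhs_distP[r /= r0 h] : (fun h => h^-1 *: (g (h *: 1 + x) - g x)) @ 0^' --> l.
  by rewrite -gl; exact: gd.
exists r => // t tr; have [->|t0] := eqVneq t 0; first by rewrite addr0 subrr mul0r subr0 normr0 mulr0.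
have := h t; rewrite subr0 => /(_ tr t0)/ltW.
rewrite -(ler_pM2r (_ : 0 < `|t|)) ?normr_gt0// -normrM; congr (_ <= _).
rewrite distrC /GRing.scale/= mulr1 [t + x]addrC; congr `|_|; field; exact: t0.
Qed.

Lemma diff_eps (f : V -> R) (x : V) : differentiable f x ->
  forall e : R, 0 < e -> exists2 r : R, 0 < r & forall h : V, enorm h < r ->
    `|f (x + h) - f x - 'D_h f x| <= e * enorm h.
Proof.
move=> df e e0.
have /eqaddoE/eqaddoP/(_ e e0)/nbhs_distP[r r0 hr] := diff_locally df.
exists r => // h hh.
have hn : `|h| < r by apply: le_lt_trans hh; exact: norm_le_enorm.
rewrite deriveE//; apply: le_trans (_ : e * `|h| <= _).
  have -> : f (x + h) - f x - 'd f x h = (f \o shift x - (cst (f x) + 'd f x)) h.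
    by rewrite [x + h]addrC -[RHS]/(f (h + x) - (f x + 'd f x h)) opprD addrA.
  by have := hr h; rewrite subr0 => /(_ hn).
by rewrite ler_pM2l// norm_le_enorm.
Qed.

Lemma derive_dot (f : V -> R) (x v : V) : differentiable f x -> 'D_v f x = dot v (grad f x).
Proof.
move=> df; rewrite deriveE// {1}[v]sum_basis linear_sum; apply: eq_bigr => i _.
by rewrite linearZ mxE deriveE.
Qed.

Lemma grad_eps (f : V -> R) (x : V) : differentiable f x ->
  forall e : R, 0 < e -> exists2 r : R, 0 < r & forall y : V, enorm (y - x) < r ->
    `|f y - f x - dot (y - x) (grad f x)| <= e * enorm (y - x).
Proof.
move=> df e e0; have [r r0 h] := diff_eps df e0; exists r => // y yx.
by have := h _ yx; rewrite derive_dot// [x + _]addrC subrK.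
Qed.

Lemma is_derive_line (f : V -> R) (x v : V) (t : R) : differentiable f (x + t *: v) ->
  is_derive t 1 (fun s : R => f (x + s *: v)) ('D_v f (x + t *: v)).
Proof.
move=> df.
have E : (fun h : R => h^-1 *: (f (x + (h *: (1 : R) + t) *: v) - f (x + t *: v))) =
    (fun h : R => h^-1 *: (f (h *: v + (x + t *: v)) - f (x + t *: v))).
  apply/funext => h; congr (_ *: (f _ - _)).
  by rewrite scalerDl addrCA /GRing.scale/= mulr1.
have fv : derivable f (x + t *: v) v := diff_derivable df.
apply: DeriveDef; first by rewrite /derivable E.
by rewrite /derive E.
Qed.

Lemma grad_continuous (f : V -> R) (x : V) :
  (forall v, {for x, continuous (fun y => 'D_v f y)}) ->
  forall e : R, 0 < e -> exists2 r : R, 0 < r & forall y : V,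
    enorm (y - x) < r -> enorm (grad f y - grad f x) <= e.
Proof.
move=> cD e e0; pose e' := e / (d%:R + 1).
have e'0 : 0 < e' by rewrite divr_gt0// ltr_wpDl.
have /nbhs_enormP[r r0 h] : \forall y \near x, forall i : 'I_d, `|'D_(e_ i) f y - 'D_(e_ i) f x| < e'.
  apply: (@filter_forall V 'I_d (fun i y => `|'D_(e_ i) f y - 'D_(e_ i) f x| < e') (nbhs x)) => i.
  by apply/nbhs_enormP; apply: (iffLR (@continuous_enormP R d R^o _ _) (cD (e_ i))).
exists r => // y /h hy; apply: le_trans (enorm_le_norm _) _.
rewrite mulrC -ler_pdivlMr ?ltr_wpDl//; apply: norm_le_coord; first exact: ltW.
by move=> i; rewrite !mxE ltW.
Qed.

Lemma enorm_segment (x y z : V) (r t : R) : 0 <= t <= 1 ->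
  enorm (y - x) < r -> enorm (z - x) < r -> enorm (z + t *: (y - z) - x) < r.
Proof.
move=> /andP[t0 t1] yr zr.
have -> : z + t *: (y - z) - x = t *: (y - x) + (1 - t) *: (z - x).
  by apply/rowP => i; rewrite !mxE; ring.
apply: le_lt_trans (enormD _ _) _; rewrite !enormZ (ger0_norm t0) ger0_norm ?subr_ge0//.
have [->|tn0] := eqVneq t 0; first by lra.
have : 0 < t * (r - enorm (y - x)) by rewrite mulr_gt0 ?subr_gt0// lt_def tn0.
have : 0 <= (1 - t) * (r - enorm (z - x)) by rewrite mulr_ge0// subr_ge0// ltW.
lra.
Qed.

(** The mean value inequality on the segment from [z] to [y]. *)
Lemma strict_diff (f : V -> R) (x : V) :
  (\forall y \near x, differentiable f y) ->
  (forall v, {for x, continuous (fun y => 'D_v f y)}) ->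
  forall e : R, 0 < e -> exists2 r : R, 0 < r & forall y z : V,
    enorm (y - x) < r -> enorm (z - x) < r ->
    `|f y - f z - dot (y - z) (grad f x)| <= e * enorm (y - z).
Proof.
move=> /nbhs_enormP[r1 r10 fd] cD e e0.
have [r2 r20 h2] := grad_continuous cD e0.
exists (Num.min r1 r2); first by rewrite lt_min r10.
move=> y z; rewrite !lt_min => /andP[y1 y2] /andP[z1 z2].
pose g := dot (y - z) (grad f x).
have := @MVT_bound R (fun t => f (z + t *: (y - z)) - t * g)
  (fun t => 'D_(y - z) f (z + t *: (y - z)) - g) 0 1 (e * enorm (y - z)) ler01.
rewrite subr0 mulr1 scale1r scale0r mul1r mul0r addr0 subr0 [z + _]addrC subrK addrAC.
apply=> t t01.
  apply: is_deriveB; first by apply: is_derive_line; apply: fd; exact: enorm_segment.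
  by apply: is_derive_eq (is_deriveM (is_derive_id t (1 : R)) (is_derive_cst g t 1)) _;
    rewrite /= scaler0 add0r /GRing.scale/= mulr1.
rewrite derive_dot; last by apply: fd; exact: enorm_segment.
rewrite -dotNr -dotDr; apply: le_trans (cauchy_schwarz _ _) _.
by rewrite mulrC ler_wpM2r ?enorm_ge0//; apply: h2; exact: enorm_segment.
Qed.

(** Both mixed derivatives are limits of the same second-order difference
    quotient. *)
Lemma schwarz (f : V -> R) (x v w : V) :
  (\forall y \near x, differentiable f y) ->
  differentiable ('D_v f) x -> differentiable ('D_w f) x ->
  'D_v ('D_w f) x = 'D_w ('D_v f) x.
Proof.
move=> /nbhs_enormP[r0 r00 fd] dv dw.
pose D t := f (x + t *: v + t *: w) - f (x + t *: v) - f (x + t *: w) + f x.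
suff key (a b : V) (da : differentiable ('D_a f) x) : forall e : R, 0 < e ->
    exists2 r : R, 0 < r & forall t : R, 0 < t < r ->
    `|f (x + t *: a + t *: b) - f (x + t *: a) - f (x + t *: b) + f x -
      t ^+ 2 * 'D_b ('D_a f) x| <= e * t ^+ 2.
  apply/eqP; rewrite -subr_eq0 -normr_le0 leNgt; apply/negP => n0.
  have [q qE q0] : exists2 q, q = `|'D_v ('D_w f) x - 'D_w ('D_v f) x| & 0 < q by eexists.
  have [ra ra0 ha] := key v w dv (q / 4) (ltac:(lra)).
  have [rb rb0 hb] := key w v dw (q / 4) (ltac:(lra)).
  pose t := Num.min (ra / 2) (rb / 2).
  have t0 : 0 < t by rewrite lt_min !divr_gt0.
  have ta : t <= ra / 2 by rewrite ge_min lexx.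
  have tb : t <= rb / 2 by rewrite ge_min lexx orbT.
  have := ha t (ltac:(apply/andP; split; lra)); have := hb t (ltac:(apply/andP; split; lra)).
  rewrite [x + t *: w + _]addrAC.
  have gen (S S1 S2 F A B T : R) : `|S - S1 - S2 + F - T * A| <= q / 4 * T ->
      `|S - S2 - S1 + F - T * B| <= q / 4 * T -> `|T * (A - B)| <= q / 2 * T.
    by rewrite !ler_norml => /andP[? ?] /andP[? ?]; apply/andP; split; lra.
  have t2 : 0 < t ^+ 2 by rewrite exprn_gt0.
  move=> h1 h2; have := gen _ _ _ _ _ _ _ h1 h2.
  rewrite normrM (ger0_norm (ltW t2)) mulrC ler_pM2r// -qE.
  by move: q0; clear; lra.
move=> e e0; pose C := enorm a + enorm b + 1.
have C0 : 0 < C by rewrite ltr_wpDl ?addr_ge0 ?enorm_ge0.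
have e2 : 0 < e / (2 * C) by rewrite divr_gt0// mulr_gt0.
have [r1 r10 h1] := diff_eps da e2.
pose rr := Num.min r0 r1.
have rr0 : 0 < rr by rewrite lt_min r00.
exists (rr / C); first by rewrite divr_gt0.
move=> t /andP[t0]; rewrite ltr_pdivlMr// => tC.
have near (s u : R) : 0 <= s <= t -> 0 <= u <= t -> enorm (s *: a + u *: b) <= t * C - t.
  move=> /andP[s0 st] /andP[u0 ut]; apply: le_trans (enormD _ _) _.
  rewrite !enormZ !ger0_norm// /C.
  have : s * enorm a <= t * enorm a by rewrite ler_wpM2r// enorm_ge0.
  have : u * enorm b <= t * enorm b by rewrite ler_wpM2r// enorm_ge0.
  lra.
have [rr1 rr2] : rr <= r0 /\ rr <= r1 by rewrite !ge_min !lexx orbT.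
have near0 (s u : R) : 0 <= s <= t -> 0 <= u <= t -> differentiable f (x + s *: a + u *: b).
  by move=> hs hu; apply: fd; rewrite -(addrA x) [x + _]addrC addrK; have := near s u hs hu; lra.
pose m := 'D_b ('D_a f) x.
have := @MVT_bound R (fun s => f (x + t *: b + s *: a) - f (x + s *: a) - s * (t * m))
  (fun s => 'D_a f (x + t *: b + s *: a) - 'D_a f (x + s *: a) - t * m) 0 t (e * t) (ltW t0).
rewrite !scale0r !addr0 mul0r !subr0 [x + t *: b + t *: a]addrAC.
have -> : f (x + t *: a + t *: b) - f (x + t *: a) - t * (t * m) - (f (x + t *: b) - f x) =
  f (x + t *: a + t *: b) - f (x + t *: a) - f (x + t *: b) + f x - t ^+ 2 * m by ring.
rewrite -mulrA -expr2; apply=> s st.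
  have tt : 0 <= t <= t by apply/andP; split; [exact: ltW|exact: lexx].
  have z0 : 0 <= (0 : R) <= t by apply/andP; split; [exact: lexx|exact: ltW].
  apply: is_deriveB.
    apply: is_deriveB; apply: is_derive_line.
      by rewrite addrAC; exact: near0.
    by have := near0 s 0 st z0; rewrite scale0r addr0.
  by apply: is_derive_eq (is_deriveM (is_derive_id s (1 : R)) (is_derive_cst (t * m) s 1)) _;
    rewrite /= scaler0 add0r /GRing.scale/= mulr1.
have tt : 0 <= t <= t by apply/andP; split; [exact: ltW|exact: lexx].
have z0 : 0 <= (0 : R) <= t by apply/andP; split; [exact: lexx|exact: ltW].
have n1 := near s t st tt; have n2 := near s 0 st z0; rewrite scale0r addr0 in n2.
have E1 := h1 (s *: a + t *: b) (ltac:(lra)).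
have E2 := h1 (s *: a) (ltac:(lra)).
have dab (s' u : R) : 'D_(s' *: a + u *: b) ('D_a f) x = s' * 'D_a ('D_a f) x + u * m.
  by rewrite /m !derive_dot// dotDl !dotZl.
have da0 : 'D_(s *: a) ('D_a f) x = s * 'D_a ('D_a f) x by rewrite !derive_dot// dotZl.
rewrite dab in E1; rewrite da0 in E2.
rewrite [x + t *: b + _]addrAC.
rewrite addrA in E1.
have Ct : e / (2 * C) * (t * C - t) <= e / 2 * t.
  have -> : e / 2 * t = e / (2 * C) * (t * C) by field; rewrite gt_eqF.
  by rewrite ler_pM2l// gerBl ltW.
have F1 : e / (2 * C) * enorm (s *: a + t *: b) <= e / 2 * t by apply: le_trans Ct; rewrite ler_pM2l.
have F2 : e / (2 * C) * enorm (s *: a) <= e / 2 * t by apply: le_trans Ct; rewrite ler_pM2l.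
have gen (X Y Z sA tm b' : R) : `|X - Z - (sA + tm)| <= b' / 2 * t ->
    `|Y - Z - sA| <= b' / 2 * t -> `|X - Y - tm| <= b' * t.
  clear; rewrite !ler_norml => /andP[? ?] /andP[? ?]; apply/andP; split; lra.
exact: gen (le_trans E1 F1) (le_trans E2 F2).
Qed.

Lemma peano2 (g g1 : R -> R) (g2 r : R) : 0 < r ->
  (forall t : R, `|t| < r -> is_derive t 1 g (g1 t)) -> is_derive (0 : R) 1 g1 g2 ->
  forall e : R, 0 < e -> exists2 r' : R, 0 < r' & forall t, `|t| < r' ->
    `|g t - g 0 - t * g1 0 - t ^+ 2 / 2 * g2| <= e * t ^+ 2.
Proof.
move=> r0 gd g1d e e0.
have [r1 r10 h1] := is_derive_eps g1d e0.
exists (Num.min r r1); first by rewrite lt_min r0.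
move=> t; rewrite lt_min => /andP[tr tr1].
pose k s := g s - s * g1 0 - s ^+ 2 / 2 * g2.
have kd (s : R) : `|s| <= `|t| -> is_derive s 1 k (g1 s - g1 0 - s * g2).
  move=> st; apply: is_deriveB.
    apply: is_deriveB; first by apply: gd; apply: le_lt_trans tr.
    by apply: is_derive_eq (is_deriveM (is_derive_id s (1 : R)) (is_derive_cst (g1 0) s 1)) _;
      rewrite /= scaler0 add0r /GRing.scale/= mulr1.
  have sq : is_derive s 1 (fun s : R => s ^+ 2 / 2 * g2) (s * g2).
    have -> : (fun s : R => s ^+ 2 / 2 * g2) = (fun s : R => (g2 / 2) * (s * s)).
      by apply/funext => u; ring.
    have ss := is_deriveM (is_derive_id s (1 : R)) (is_derive_id s (1 : R)).
    apply: is_derive_eq (is_deriveZ (g2 / 2) ss) _.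
    by rewrite /GRing.scale/=; field.
  exact: sq.
have kb (s : R) : `|s| <= `|t| -> `|g1 s - g1 0 - s * g2| <= e * `|t|.
  move=> st; have := h1 s (le_lt_trans st tr1); rewrite add0r => /le_trans; apply.
  by rewrite ler_pM2l.
have -> : g t - g 0 - t * g1 0 - t ^+ 2 / 2 * g2 = k t - k 0.
  by rewrite /k expr0n/=; ring.
have -> : e * t ^+ 2 = e * `|t| * `|t| by rewrite -mulrA -expr2 real_normK ?num_real.
have [t0|/ltW t0] := leP 0 t.
  have := @MVT_bound _ k (fun s => g1 s - g1 0 - s * g2) 0 t (e * `|t|) t0.
  rewrite subr0 (ger0_norm t0); apply=> s /andP[s0 st].
    by apply: kd; rewrite !ger0_norm.
  by rewrite -[in leRHS](ger0_norm t0); apply: kb; rewrite !ger0_norm.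
have := @MVT_bound _ k (fun s => g1 s - g1 0 - s * g2) t 0 (e * `|t|) t0.
rewrite sub0r distrC (ler0_norm t0); apply=> s /andP[s0 st].
  by apply: kd; rewrite !ler0_norm// lerN2.
by rewrite -[in leRHS](ler0_norm t0); apply: kb; rewrite !ler0_norm// lerN2.
Qed.

End Differentials.

(** * Hypersurfaces and their normals *)

Section Hypersurfaces.
Context {R : realType} {d : nat}.
Local Notation V := 'rV[R]_d.
Local Notation e_ := (@basis_vec R d).
Implicit Types (S : set V) (q n x : V).

(** The gradient at the centre is given by its length and its direction, since
    estimates are relative to the length. *)
Record chart S q (f : V -> R) (k : R) (nu : V) (r : R) : Prop := Chart {
  chart_r : 0 < r;
  chart_k : 0 < k;
  chart_nu : dot nu nu = 1;
  chart_zero : forall x, enorm (x - q) < r -> S x <-> f x = 0;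
  chart_diff : forall x, enorm (x - q) < r -> differentiable f x;
  chart_diff2 : forall x, enorm (x - q) < r -> forall v, differentiable ('D_v f) x;
  chart_neq0 : forall x, enorm (x - q) < r -> grad f x != 0;
  chart_grad : grad f q = k *: nu }.

Lemma enorm1 (x : V) : dot x x = 1 -> enorm x = 1.
Proof. by move=> x1; rewrite /enorm x1 sqrtr1. Qed.

Lemma hypersurface_chart S q : hypersurface S -> S q ->
  exists f k nu r, chart S q f k nu r.
Proof.
move=> [_ /[apply]] [W [f [oW Wq sm gn0 SE]]].
have [r r0 rW] := open_enormP oW Wq.
have gq := gn0 q Wq.
have k0 : 0 < enorm (grad f q) by rewrite enorm_gt0.
have [fd D2] := sm 2; have D1 v := (D2 v).1.
exists f, (enorm (grad f q)), ((enorm (grad f q))^-1 *: grad f q), r; split => //.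
- by rewrite !dotE -sqr_enorm expr2; field; rewrite gt_eqF.
- move=> x /rW Wx; split => [Sx|fx].
    by have : (S `&` W) x by []; rewrite SE => -[].
  by have : [set x | W x /\ f x = 0] x by []; rewrite -SE => -[].
- by move=> x /rW; exact: fd.
- by move=> x /rW Wx v; exact: D1.
- by move=> x /rW; exact: gn0.
by rewrite scalerA divff ?scale1r// gt_eqF.
Qed.

Lemma chart_center S q f k nu r : chart S q f k nu r -> enorm (q - q) < r.
Proof. by move=> c; rewrite subrr enorm0; exact: chart_r c. Qed.

Lemma chart_strict S q f k nu r : chart S q f k nu r ->
  forall e : R, 0 < e -> exists2 r' : R, 0 < r' <= r & forall y z : V,
    enorm (y - q) < r' -> enorm (z - q) < r' ->
    `|f y - f z - k * dot (y - z) nu| <= e * enorm (y - z).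
Proof.
move=> c e e0.
have [||r1 r10 h] := @strict_diff R d f q _ _ e e0.
- by apply/nbhs_enormP; exists r; [exact: chart_r c|exact: chart_diff c].
- by move=> v; apply/differentiable_continuous/(chart_diff2 c)/(chart_center c).
exists (Num.min r r1); first by rewrite lt_min (chart_r c) r10 ge_min lexx.
move=> y z; rewrite !lt_min => /andP[_ y1] /andP[_ z1].
by have := h y z y1 z1; rewrite (chart_grad c) dotZr.
Qed.

(** Intermediate values along the direction [nu], which is transverse to the
    level set. *)
Lemma chart_crossing S q f k nu r : S q -> chart S q f k nu r ->
  exists2 r' : R, 0 < r' <= r &
  [/\ forall y, enorm (y - q) + 2 * `|f y| / k < r' ->
    exists2 t : R, `|t| <= 2 * `|f y| / k & S (y + t *: nu) /\ enorm (y + t *: nu - q) < r',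
    forall x y, S x -> S y -> enorm (x - q) < r' -> enorm (y - q) < r' ->
      `|dot (x - y) nu| <= enorm (x - y) / 4 &
    forall y, enorm (y - q) < r' -> `|f y| <= k * `|dot (y - q) nu| + k / 4 * enorm (y - q)].
Proof.
move=> Sq c; have k0 := chart_k c.
have f0 : f q = 0 := (chart_zero c (chart_center c)).1 Sq.
have nu1 := enorm1 (chart_nu c).
have [r' /andP[r'0 r'r] h] := chart_strict c (ltac:(lra) : 0 < k / 4).
exists r'; first by rewrite r'0.
split.
- move=> y yr; pose T := 2 * `|f y| / k.
  have T0 : 0 <= T by rewrite divr_ge0 ?(ltW k0)// mulr_ge0.
  have kT : k * T = 2 * `|f y| by rewrite /T mulrC divfK// gt_eqF.
  have near t : `|t| <= T -> enorm (y + t *: nu - q) < r'.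
    move=> tT; rewrite addrAC; apply: le_lt_trans (enormD _ _) _.
    by rewrite enormZ nu1 mulr1; move: yr; rewrite -/T; lra.
  have fy t : `|t| <= T -> `|f (y + t *: nu) - f y - k * t| <= k / 4 * `|t|.
    move=> tT; have := h (y + t *: nu) y (near t tT).
    have := near 0; rewrite normr0 scale0r addr0 => /(_ T0) yq /(_ yq).
    by rewrite [y + _]addrC addrK enormZ nu1 mulr1 dotZl (chart_nu c) mulr1.
  have ct : {within `[- T, T], continuous (fun t : R => f (y + t *: nu))}.
    apply: continuous_in_subspaceT => t; rewrite inE/= in_itv/= => tT.
    apply: is_derive_continuous (is_derive_line _); apply: (chart_diff c).
    by apply: lt_le_trans (near t _) r'r; rewrite ler_norml.
  have := @IVT R (fun t => f (y + t *: nu)) (- T) T 0 (ltac:(lra)) ct.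
  have := fy T (ltac:(by rewrite ger0_norm)); have := fy (- T) (ltac:(by rewrite normrN ger0_norm)).
  rewrite normrN !(ger0_norm T0) !ler_norml.
  have kT4 : k / 4 * T = `|f y| / 2 by rewrite mulrAC kT; field.
  rewrite kT4 mulrN kT.
  have := ler_norm (f y); have := ler_norm (- f y); rewrite normrN.
  move=> n1 n2 /andP[l1 u1] /andP[l2 u2].
  case.
    rewrite ge_min le_max; apply/andP; split; [apply/orP; left; lra | apply/orP; right; lra].
  move=> t; rewrite in_itv/= -ler_norml => tT ft; exists t => //.
  split; last exact: near.
  by apply/(chart_zero c) => //; apply: lt_le_trans r'r; exact: near.
- move=> x y Sx Sy xr yr; have := h x y xr yr.
  have zx := (chart_zero c (lt_le_trans xr r'r)).1 Sx.
  have zy := (chart_zero c (lt_le_trans yr r'r)).1 Sy.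
  rewrite zx zy subr0 sub0r normrN normrM (gtr0_norm k0) mulrAC -mulrA ler_pM2l//.
- move=> y yr; have := h y q yr (ltac:(by rewrite subrr enorm0)); rewrite f0 subr0.
  have := ler_normD (f y - k * dot (y - q) nu) (k * dot (y - q) nu).
  by rewrite subrK normrM (gtr0_norm k0); lra.
Qed.

(** One-sided on purpose: this is what a nearest-point condition provides.  On
    a hypersurface both signs follow. *)
Definition normal_at S q n := forall e : R, 0 < e ->
  exists2 r : R, 0 < r & forall x, S x -> enorm (x - q) < r ->
    dot (x - q) n <= e * enorm (x - q).

(** The point [q + s a] is pushed back to the level set along [nu]. *)
Lemma chart_tangent S q f k nu r (a : V) : S q -> chart S q f k nu r -> dot a nu = 0 ->
  forall e : R, 0 < e -> exists2 r' : R, 0 < r' & forall s : R, 0 < s < r' ->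
    exists2 x, S x & enorm (x - q - s *: a) <= e * s.
Proof.
move=> Sq c anu e e0; have k0 := chart_k c.
have f0 : f q = 0 := (chart_zero c (chart_center c)).1 Sq.
have nu1 := enorm1 (chart_nu c).
have [r1 /andP[r10 r1r] [cross _ _]] := chart_crossing Sq c.
pose A := enorm a + 1.
have A0 : 0 < A by rewrite ltr_wpDl ?enorm_ge0.
have A1 : enorm a <= A by rewrite lerDl.
pose e' := e * k / (2 * A).
have e'0 : 0 < e' by rewrite divr_gt0 ?mulr_gt0.
have [r2 r20 h] := grad_eps (chart_diff c (chart_center c)) e'0.
pose B := A + e.
have B0 : 0 < B by rewrite addr_gt0.
exists (Num.min (r1 / B) (r2 / B)); first by rewrite lt_min !divr_gt0.
move=> s /andP[s0]; rewrite lt_min !ltr_pdivlMr// => /andP[s1 s2].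
have sA : s * enorm a <= s * A by rewrite ler_pM2l.
have se : 0 < s * e by rewrite mulr_gt0.
have sB : s * B = s * A + s * e by rewrite mulrDr.
have eya : enorm (q + s *: a - q) = s * enorm a by rewrite addrC addKr enormZ gtr0_norm.
have fy : `|f (q + s *: a)| <= e' * (s * A).
  have := h (q + s *: a); rewrite eya => /(_ ltac:(lra)).
  rewrite f0 subr0 (chart_grad c) dotZr [q + _]addrC addrK dotZl anu !mulr0 subr0 => /le_trans; apply.
  by rewrite ler_pM2l.
have T : 2 * `|f (q + s *: a)| / k <= e * s.
  rewrite ler_pdivrMr//; apply: le_trans (ler_wpM2l _ fy) _ => //.
  by rewrite /e' le_eqVlt; apply/orP; left; apply/eqP; field; rewrite gt_eqF.
have [|t tT [Sx _]] := cross (q + s *: a).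
  by rewrite eya; lra.
exists (q + s *: a + t *: nu) => //.
have -> : q + s *: a + t *: nu - q - s *: a = t *: nu.
  by apply/rowP => i; rewrite !mxE; ring.
by rewrite enormZ nu1 mulr1; apply: le_trans tT T.
Qed.

(** The component of [n] orthogonal to [nu] is a tangent direction, and can be
    tested against points of [S]. *)
Lemma chart_normal_parallel S q f k nu r n : S q -> chart S q f k nu r ->
  normal_at S q n -> n = dot n nu *: nu.
Proof.
move=> Sq c nn; apply/eqP; rewrite -subr_eq0; set a := n - _.
have anu : dot a nu = 0 by rewrite /a !dotE (chart_nu c); ring.
have an : dot a n = dot a a.
  by rewrite {3}/a dotDr dotNr dotZr anu; ring.
rewrite -dot_eq0 -an eq_le; apply/andP; split; last by rewrite an dot_ge0.
rewrite leNgt; apply/negP => al0.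
pose C := enorm n + enorm a + 1.
have C0 : 0 < C by rewrite ltr_wpDl// addr_ge0 ?enorm_ge0.
pose e := Num.min 1 (dot a n / (2 * C)).
have e0 : 0 < e by rewrite lt_min ltr01 divr_gt0// mulr_gt0.
have [e1 eC] : e <= 1 /\ e <= dot a n / (2 * C) by rewrite !ge_min !lexx orbT.
have [r1 r10 h1] := nn e e0.
have [r2 r20 h2] := chart_tangent Sq c anu e0.
pose s := Num.min (r2 / 2) (r1 / (2 * C)).
have s0 : 0 < s by rewrite lt_min !divr_gt0// mulr_gt0.
have [sr2 sr1] : s <= r2 / 2 /\ s <= r1 / (2 * C) by rewrite !ge_min !lexx orbT.
have [x Sx xs] := h2 s (ltac:(apply/andP; split; lra)).
have xq : enorm (x - q) <= s * (enorm a + e).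
  have := enormD (x - q - s *: a) (s *: a); rewrite subrK enormZ (gtr0_norm s0).
  by rewrite mulrDr; lra.
have sC : s * C <= r1 / 2.
  have -> : r1 / 2 = r1 / (2 * C) * C by field; rewrite gt_eqF.
  by rewrite ler_pM2r.
have xr : enorm (x - q) < r1.
  apply: le_lt_trans xq _; apply: le_lt_trans (_ : s * C < _); last lra.
  by rewrite ler_pM2l// /C; have := enorm_ge0 n; lra.
have H := h1 x Sx xr.
have E : dot (x - q) n = s * dot a n + dot (x - q - s *: a) n.
  by rewrite -dotZl -dotDl [s *: a + _]addrC subrK.
have cs : - (e * s * enorm n) <= dot (x - q - s *: a) n.
  have := le_trans (cauchy_schwarz _ n) (ler_wpM2r (enorm_ge0 n) xs).
  by rewrite ler_norml => /andP[].
have H2 : s * dot a n <= s * (e * C).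
  have : e * enorm (x - q) <= e * (s * (enorm a + 1)).
    rewrite ler_pM2l//; apply: le_trans xq _; rewrite ler_pM2l//; lra.
  by rewrite /C; rewrite E in H; lra.
have : e * C <= dot a n / 2.
  have -> : dot a n / 2 = dot a n / (2 * C) * C by field; rewrite gt_eqF.
  by rewrite ler_pM2r.
by rewrite ler_pM2l// in H2; lra.
Qed.

Lemma chart_normal S q f k nu r : S q -> chart S q f k nu r -> normal_at S q nu.
Proof.
move=> Sq c e e0; have k0 := chart_k c.
have [r1 r10 h] := grad_eps (chart_diff c (chart_center c)) (mulr_gt0 e0 k0).
exists (Num.min r r1); first by rewrite lt_min (chart_r c).
move=> x Sx; rewrite lt_min => /andP[xr xr1].
have fx : f x = 0 := (chart_zero c xr).1 Sx.
have fq : f q = 0 := (chart_zero c (chart_center c)).1 Sq.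
have := h x xr1; rewrite fx fq subr0 sub0r normrN (chart_grad c) dotZr.
rewrite normrM (gtr0_norm k0) mulrC mulrAC ler_pM2r// ler_norml => /andP[_]; exact.
Qed.

Lemma chart_recenter S q f k nu r x : chart S q f k nu r -> enorm (x - q) < r ->
  chart S x f (enorm (grad f x)) ((enorm (grad f x))^-1 *: grad f x) (r - enorm (x - q)).
Proof.
move=> c xr; have g0 := chart_neq0 c xr.
have k0 : 0 < enorm (grad f x) by rewrite enorm_gt0.
have sub y : enorm (y - x) < r - enorm (x - q) -> enorm (y - q) < r.
  by move=> h; have := enorm_dist y x q; lra.
split => //.
- by rewrite subr_gt0.
- by rewrite !dotE -sqr_enorm expr2; field; rewrite gt_eqF.
- by move=> y /sub; exact: chart_zero c y.
- by move=> y /sub; exact: chart_diff c y.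
- by move=> y /sub; exact: chart_diff2 c y.
- by move=> y /sub; exact: chart_neq0 c y.
by rewrite scalerA divff ?scale1r// gt_eqF.
Qed.

Definition unit_normal S q n := normal_at S q n /\ dot n n = 1.

Lemma normalize_lipschitz (u v : V) : u != 0 -> v != 0 ->
  enorm ((enorm u)^-1 *: u - (enorm v)^-1 *: v) <= 2 * enorm (u - v) / enorm v.
Proof.
rewrite -!enorm_gt0 => u0 v0.
have -> : (enorm u)^-1 *: u - (enorm v)^-1 *: v =
   (enorm v)^-1 *: (u - v) + ((enorm u)^-1 - (enorm v)^-1) *: u.
  by apply/rowP => i; rewrite !mxE; ring.
apply: le_trans (enormD _ _) _; rewrite !enormZ.
have -> : `|(enorm u)^-1 - (enorm v)^-1| * enorm u = `|enorm v - enorm u| / enorm v.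
  have -> : (enorm u)^-1 - (enorm v)^-1 = (enorm v - enorm u) / (enorm u * enorm v).
    by field; rewrite !gt_eqF.
  by rewrite normrM normfV (gtr0_norm (mulr_gt0 u0 v0)); field; rewrite !gt_eqF.
rewrite (ger0_norm (_ : 0 <= (enorm v)^-1)) ?invr_ge0 ?enorm_ge0//.
have := ler_enorm_sub v u; rewrite (enormB v u) => h.
rewrite [X in X + _]mulrC -mulrDl ler_pM2r ?invr_gt0//; lra.
Qed.

(** The normalized gradient of a defining function, with the sign of [nu]. *)
Lemma normal_field S q nu : hypersurface S -> S q -> unit_normal S q nu ->
  exists N : V -> V, exists2 r : R, 0 < r & N q = nu /\ forall x, S x -> enorm (x - q) < r ->
    [/\ unit_normal S x (N x), enorm (N x - nu) < 1 / 2,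
       forall n, normal_at S x n -> n = dot n (N x) *: N x &
       forall e : R, 0 < e -> exists2 s : R, 0 < s & forall y, enorm (y - x) < s ->
         enorm (N y - N x) < e].
Proof.
move=> hS Sq [nn n1]; have [f [k [nu0 [r c]]]] := hypersurface_chart hS Sq.
have k0 := chart_k c.
pose sg := dot nu nu0.
have nuE : nu = sg *: nu0 := chart_normal_parallel Sq c nn.
have sg2 : sg ^+ 2 = 1.
  by move: n1; rewrite nuE !dotE (chart_nu c) mulr1 expr2.
have sgn : `|sg| = 1 by apply/eqP; rewrite -sqrp_eq1// real_normK ?num_real// sg2.
pose N0 x := (enorm (grad f x))^-1 *: grad f x.
have N0q : N0 q = nu0.
  rewrite /N0 (chart_grad c) enormZ (enorm1 (chart_nu c)) mulr1 (gtr0_norm k0).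
  by rewrite scalerA mulVf ?scale1r// gt_eqF.
have cN x : enorm (x - q) < r -> forall e : R, 0 < e ->
    exists2 s : R, 0 < s & forall y, enorm (y - x) < s -> enorm (sg *: N0 y - sg *: N0 x) < e.
  move=> xr e e0; have g0 : 0 < enorm (grad f x) by rewrite enorm_gt0 (chart_neq0 c xr).
  have [||s s0 hs] := @grad_continuous R d f x _ (e * enorm (grad f x) / 4).
  - by move=> v; apply/differentiable_continuous/(chart_diff2 c xr).
  - by rewrite divr_gt0// mulr_gt0.
  exists (Num.min s (r - enorm (x - q))); first by rewrite lt_min s0 subr_gt0.
  move=> y; rewrite lt_min => /andP[ys yr].
  have yq : enorm (y - q) < r by have := enorm_dist y x q; lra.
  rewrite -scalerBr enormZ sgn mul1r.
  apply: le_lt_trans (normalize_lipschitz (chart_neq0 c yq) (chart_neq0 c xr)) _.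
  rewrite ltr_pdivrMr//; have := hs y ys.
  have : 0 < e * enorm (grad f x) by rewrite mulr_gt0.
  lra.
have [s s0 hs] := cN q (chart_center c) (1 / 2) (ltac:(lra)).
exists (fun x => sg *: N0 x), (Num.min r s); first by rewrite lt_min (chart_r c).
split => [|x Sx]; first by rewrite N0q nuE.
rewrite lt_min => /andP[xr xs].
have cx := chart_recenter c xr.
have N01 : dot (N0 x) (N0 x) = 1 := chart_nu cx.
have par n : normal_at S x n -> n = dot n (N0 x) *: N0 x := chart_normal_parallel Sx cx.
split => //.
- split; last by rewrite dotZl dotZr N01 mulr1 -expr2 sg2.
  move=> e e0.
  have [r1 r10 h] := grad_eps (chart_diff cx (chart_center cx)) (mulr_gt0 e0 (chart_k cx)).
  exists (Num.min (r - enorm (x - q)) r1); first by rewrite lt_min subr_gt0 xr.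
  move=> y Sy; rewrite lt_min => /andP[yr yr1].
  have fx := (chart_zero cx (chart_center cx)).1 Sx; have fy := (chart_zero cx yr).1 Sy.
  have gE : dot (y - x) (grad f x) = enorm (grad f x) * dot (y - x) (N0 x).
    by rewrite {1}(chart_grad cx) dotZr.
  have := h y yr1; rewrite fx fy subr0 sub0r normrN gE.
  rewrite normrM (gtr0_norm (chart_k cx)) (mulrC e) -mulrA ler_pM2l ?(chart_k cx)//.
  by apply: le_trans; apply: le_trans (ler_norm _) _; rewrite dotZr normrM sgn mul1r.
- by rewrite nuE -N0q; exact: hs.
- by move=> n /par nE; rewrite dotZr scalerA mulrAC -expr2 sg2 mul1r.
- exact: cN.
Qed.

Lemma unit_normal_pm S q n n' : hypersurface S -> S q ->
  unit_normal S q n -> unit_normal S q n' -> n' = n \/ n' = - n.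
Proof.
move=> hS Sq [nn n1] [nn' n'1]; have [f [k [nu0 [r c]]]] := hypersurface_chart hS Sq.
have E := chart_normal_parallel Sq c nn; have E' := chart_normal_parallel Sq c nn'.
have s2 : dot n nu0 ^+ 2 = 1 by move: n1; rewrite {1 2}E !dotE (chart_nu c) mulr1 expr2.
have s2' : dot n' nu0 ^+ 2 = 1 by move: n'1; rewrite {1 2}E' !dotE (chart_nu c) mulr1 expr2.
have /eqP : dot n' nu0 ^+ 2 = dot n nu0 ^+ 2 by rewrite s2.
rewrite eqf_sqr => /orP[]/eqP h; [left|right]; first by rewrite E E' h.
by rewrite E' h scaleNr -E.
Qed.

Lemma normal_exists S q : hypersurface S -> S q -> exists n, unit_normal S q n.
Proof.
move=> hS Sq; have [f [k [nu0 [r c]]]] := hypersurface_chart hS Sq.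
by exists nu0; split; [exact: chart_normal c|exact: chart_nu c].
Qed.

Lemma normal_parallel S q n w : hypersurface S -> S q -> unit_normal S q n ->
  normal_at S q w -> w = dot w n *: n.
Proof.
move=> hS Sq un nw; have [N [r r0 [Nq h]]] := normal_field hS Sq un.
by have [_ _ p _] := h q Sq (ltac:(by rewrite subrr enorm0)); rewrite {1}(p w nw) Nq.
Qed.

Lemma tangent_approx S q n (a : V) : hypersurface S -> S q -> unit_normal S q n ->
  dot a n = 0 -> forall e : R, 0 < e -> exists2 r' : R, 0 < r' & forall s : R, 0 < s < r' ->
    exists2 x, S x & enorm (x - q - s *: a) <= e * s.
Proof.
move=> hS Sq [nn n1] an; have [f [k [nu0 [r c]]]] := hypersurface_chart hS Sq.
apply: (chart_tangent Sq c).
have E := chart_normal_parallel Sq c nn.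
have : dot n nu0 ^+ 2 = 1 by move: n1; rewrite {1 2}E !dotE (chart_nu c) mulr1 expr2.
move: an; rewrite {1}E dotZr => /eqP; rewrite mulf_eq0 => /orP[]/eqP -> //.
by rewrite expr0n => /esym/eqP; rewrite oner_eq0.
Qed.

End Hypersurfaces.

Lemma is_derive_flat (R : realType) (g : R -> R) (x : R) :
  (forall e : R, 0 < e -> exists2 r : R, 0 < r & forall t, `|t| < r ->
     `|g (x + t) - g x| <= e * `|t|) -> is_derive x 1 g 0.
Proof.
move=> h.
have lim0 : (fun t : R => t^-1 *: (g (t *: (1 : R) + x) - g x)) @ 0^' --> (0 : R).
  apply/cvgrPdist_le => e e0; have [r r0 hr] := h e e0.
  apply/nbhs_distP; exists r => // t; rewrite subr0 => tr t0.
  rewrite sub0r normrN normrZ normfV mulrC ler_pdivrMr ?normr_gt0//.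
  by have := hr t tr; rewrite /GRing.scale/= mulr1 [t + x]addrC.
apply: DeriveDef; first by apply/cvg_ex; exists 0.
by apply: cvg_lim.
Qed.

(** Composed with the projection of the line onto [[0, 1]], the function has
    zero derivative everywhere. *)
Lemma flat_constant (R : realType) (g : R -> R) :
  (forall s : R, 0 <= s <= 1 -> forall e : R, 0 < e ->
     exists2 r : R, 0 < r & forall t, 0 <= t <= 1 -> `|t - s| < r ->
       `|g t - g s| <= e * `|t - s|) -> g 1 = g 0.
Proof.
move=> h; pose cl (s : R) := Num.max 0 (Num.min s 1).
have cl01 s : 0 <= cl s <= 1 by rewrite /cl le_max ge_max lexx ler01 ge_min lexx orbT.
have clE s : 0 <= s <= 1 -> cl s = s by move=> /andP[s0 s1]; rewrite /cl (min_idPl s1) (max_idPr s0).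
have minl (s t : R) : s <= t -> cl t - cl s <= t - s /\ cl s <= cl t.
  move=> st; have [h1 h2] : Num.min s 1 <= Num.min t 1 /\ Num.min t 1 - Num.min s 1 <= t - s.
    rewrite /Num.min; case: (ltP s 1) => s1; case: (ltP t 1) => t1; split; lra.
  rewrite /cl; move: (Num.min s 1) (Num.min t 1) h1 h2 => a b h1 h2.
  by rewrite /Num.max; case: (ltP 0 a) => a0; case: (ltP 0 b) => b0; split; lra.
have cll (s t : R) : `|cl t - cl s| <= `|t - s|.
  have [st|/ltW st] := leP s t; last rewrite distrC [leRHS]distrC;
    by have [h1 h2] := minl _ _ st; rewrite !ger0_norm ?subr_ge0.
have := @is_derive_0_is_cst R (fun s => g (cl s)) 1 0; rewrite !clE ?lexx ?ler01//; apply=> s.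
apply: is_derive_flat => e e0; have [r r0 hr] := h _ (cl01 s) e e0.
exists r => // t tr; have := cll s (s + t); rewrite [s + t - s]addrC addKr => H.
by apply: le_trans (hr _ (cl01 _) (le_lt_trans H tr)) _; rewrite ler_pM2l.
Qed.

Section FlatFunctions.
Context {R : realType} {d : nat}.
Local Notation V := 'rV[R]_d.
Local Notation e_ := (@basis_vec R d).
Implicit Types (S : set V) (q n x : V).

(** The derivative along [S] vanishes; only the values on [S] matter. *)
Definition flat_at S (h : V -> R) x := forall e : R, 0 < e ->
  exists2 r : R, 0 < r & forall y, S y -> enorm (y - x) < r -> `|h y - h x| <= e * enorm (y - x).

(** A hypersurface is locally a Lipschitz graph, so nearby points are joined by
    Lipschitz curves inside it; along such a curve a flat function has zero
    derivative. *)
Lemma flat_locally_constant S q (r0 : R) : hypersurface S -> S q -> 0 < r0 ->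
  exists2 r : R, 0 < r & forall h : V -> R,
    (forall y, S y -> enorm (y - q) < r0 -> flat_at S h y) ->
    forall x, S x -> enorm (x - q) < r -> h x = h q.
Proof.
move=> hS Sq r00; have [f [k [nu [r1 c]]]] := hypersurface_chart hS Sq.
have k0 := chart_k c; have nu1 := enorm1 (chart_nu c).
have [r2 /andP[r20 r21] [cross cone small]] := chart_crossing Sq c.
exists (Num.min (r2 / 4) (r0 / 4)); first by rewrite lt_min !divr_gt0.
move=> h hf x Sx; rewrite lt_min => /andP[xr xr0].
pose al := dot (x - q) nu; pose a := x - q - al *: nu.
have anu : dot a nu = 0 by rewrite /a dotDl dotNl dotZl (chart_nu c) -/al; ring.
have ale : enorm a <= enorm (x - q).
  rewrite -(ler_pXn2r (_ : (0 < 2)%N)) ?nnegrE ?enorm_ge0// !sqr_enorm.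
  have -> : x - q = a + al *: nu by rewrite subrK.
  have E (b : V) : dot b nu = 0 -> dot (b + al *: nu) (b + al *: nu) = dot b b + al * al.
    by move=> bn; rewrite !(dotDl, dotDr, dotZl, dotZr) (dotC nu b) bn (chart_nu c); ring.
  by rewrite E// lerDl -expr2 sqr_ge0.
(* A curve in [S] over the segment from [q] to the projection of [x] to the
   tangent hyperplane. *)
have pt (s : R) : exists t : R, 0 <= s <= 1 ->
    [/\ S (q + s *: a + t *: nu), enorm (q + s *: a + t *: nu - q) < r2 & `|t| <= enorm a / 2].
  have [/andP[s0 s1]|ns] := pselect (0 <= s <= 1); last by exists 0 => /ns.
  have sa : enorm (q + s *: a - q) = s * enorm a by rewrite [q + _]addrC addrK enormZ ger0_norm.
  have sa1 : s * enorm a <= enorm a by rewrite ler_piMl ?enorm_ge0.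
  have fy : `|f (q + s *: a)| <= k / 4 * enorm a.
    apply: le_trans (small _ (_ : _ < r2)) _; first by rewrite sa; lra.
    rewrite sa [q + _]addrC addrK dotZl anu mulr0 normr0 mulr0 add0r.
    by rewrite ler_wpM2l// divr_ge0// ltW.
  have T : 2 * `|f (q + s *: a)| / k <= enorm a / 2 by rewrite ler_pdivrMr//; lra.
  have [|t tT [St tr]] := cross (q + s *: a); first by rewrite sa; lra.
  by exists t => _; split => //; apply: le_trans tT T.
have [tau tauP] := choice pt.
pose X s := q + s *: a + tau s *: nu.
have XS s : 0 <= s <= 1 -> S (X s) /\ enorm (X s - q) < r2 by move=> /tauP[].
have Xr0 s : 0 <= s <= 1 -> enorm (X s - q) < r0.
  move=> s01; have [_ _ ts] := tauP s s01; have /andP[s0 s1] := s01.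
  have -> : X s - q = s *: a + tau s *: nu by rewrite /X -(addrA q) [q + _]addrC addrK.
  apply: le_lt_trans (enormD _ _) _; rewrite !enormZ nu1 mulr1 (ger0_norm s0).
  have : s * enorm a <= enorm a by rewrite ler_piMl ?enorm_ge0.
  by have := enorm_ge0 a; lra.
have lip (y z : V) (b t : R) : S y -> S z -> enorm (y - q) < r2 -> enorm (z - q) < r2 ->
    y - z = b *: a + t *: nu -> `|t| <= `|b| * enorm a /\ enorm (y - z) <= 2 * enorm a * `|b|.
  move=> Sy Sz yr zr yz; have := cone y z Sy Sz yr zr.
  rewrite yz dotDl !dotZl anu (chart_nu c) mulr0 mulr1 add0r.
  have := enormD (b *: a) (t *: nu); rewrite !enormZ nu1 mulr1.
  have := mulr_ge0 (normr_ge0 b) (enorm_ge0 a); have := normr_ge0 t.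
  by move=> ? ? ? ?; split; lra.
have Xst (s t : R) : X t - X s = (t - s) *: a + (tau t - tau s) *: nu.
  by rewrite /X; apply/rowP => i; rewrite !mxE; ring.
have X0 : X 0 = q.
  have [SX Xr] := XS 0 (ltac:(by rewrite lexx ler01)).
  have [||E _] := @lip (X 0) q 0 (tau 0) SX Sq Xr.
  - by rewrite subrr enorm0.
  - by rewrite /X -(addrA q) [q + _]addrC addrK.
  by move: E; rewrite normr0 mul0r normr_le0 => /eqP E; rewrite /X E !scale0r !addr0.
have X1 : X 1 = x.
  have [SX Xr] := XS 1 (ltac:(by rewrite lexx ler01)).
  have E0 : X 1 - x = (tau 1 - al) *: nu.
    by rewrite /X /a scale1r; apply/rowP => i; rewrite !mxE; ring.
  have [||E _] := @lip (X 1) x 0 (tau 1 - al) SX Sx Xr.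
  - by lra.
  - by rewrite scale0r add0r.
  move: E; rewrite normr0 mul0r normr_le0 => /eqP E.
  by apply/eqP; rewrite -subr_eq0 E0 E scale0r.
rewrite -X1 -X0; apply: (@flat_constant R (fun s => h (X s))) => s s01 e e0.
have [Ss sr] := XS s s01.
pose A := 2 * enorm a + 1.
have A0 : 0 < A by have := enorm_ge0 a; rewrite /A; lra.
have [r r0' hr] := hf _ Ss (Xr0 s s01) (e / A) (divr_gt0 e0 A0).
exists (r / A) => [|t t01]; first by rewrite divr_gt0.
rewrite ltr_pdivlMr// => tsr.
have [St tr] := XS t t01.
have [_ XL] := lip _ _ _ _ St Ss tr sr (Xst s t).
have XA : enorm (X t - X s) <= `|t - s| * A.
  by apply: le_trans XL _; rewrite mulrC ler_wpM2l// /A; lra.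
apply: le_trans (hr _ St (le_lt_trans XA tsr)) _.
rewrite -mulrA ler_pM2l// mulrC ler_pdivrMr//.
Qed.

Lemma hypersurface_locally_closed S q : hypersurface S -> S q ->
  exists2 r : R, 0 < r & forall x, enorm (x - q) < r ->
    (forall e : R, 0 < e -> exists2 y, S y & enorm (y - x) < e) -> S x.
Proof.
move=> hS Sq; have [f [k [nu [r c]]]] := hypersurface_chart hS Sq.
exists r; first exact: chart_r c.
move=> x xr cl; apply/(chart_zero c xr)/eqP; rewrite -normr_le0 leNgt; apply/negP => fx.
have /(@continuous_enormP R d R^o)/(_ _ fx)[s s0 hs] : {for x, continuous f}.
  exact/differentiable_continuous/(chart_diff c xr).
have [|y Sy yx] := cl (Num.min s (r - enorm (x - q))); first by rewrite lt_min s0 subr_gt0.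
move: yx; rewrite lt_min => /andP[ys yr].
have yq : enorm (y - q) < r by have := enorm_dist y x q; lra.
by have := hs y ys; rewrite ((chart_zero c yq).1 Sy) sub0r normrN ltxx.
Qed.

(** A point of the hyperplane can be moved to [S] along the normal, but this
    leaves the hyperplane unless the point is already on [S]. *)
Lemma hypersurface_in_plane S q n : hypersurface S -> S q -> dot n n = 1 ->
  (forall x, S x -> dot (x - q) n = 0) ->
  exists2 r : R, 0 < r & forall x, enorm (x - q) < r -> dot (x - q) n = 0 -> S x.
Proof.
move=> hS Sq n1 Sn; have [f [k [nu [r1 c]]]] := hypersurface_chart hS Sq.
have nn : normal_at S q n.
  by move=> e e0; exists 1 => // x Sx _; rewrite Sn// mulr_ge0 ?enorm_ge0// ltW.
have nE := chart_normal_parallel Sq c nn.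
have s0 : dot n nu != 0.
  by apply: contra_eq_neq n1 => s0; rewrite nE s0 scale0r dot0l eq_sym oner_neq0.
have k0 := chart_k c; have nu1 := enorm1 (chart_nu c).
have [r2 /andP[r20 r21] [cross cone small]] := chart_crossing Sq c.
exists (r2 / 2); first by rewrite divr_gt0.
move=> x xr xn.
have xnu : dot (x - q) nu = 0.
  by move: xn; rewrite nE dotZr => /eqP; rewrite mulf_eq0 (negbTE s0) => /eqP.
have fx : `|f x| <= k / 4 * enorm (x - q).
  by apply: le_trans (small x _) _; [lra | rewrite xnu normr0 mulr0 add0r].
have T : 2 * `|f x| / k <= enorm (x - q) / 2 by rewrite ler_pdivrMr//; lra.
have [|t tT [St tr]] := cross x; first lra.
have : dot (x + t *: nu - q) n = 0 by exact: Sn.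
rewrite addrAC dotDl xn add0r dotZl dotC => /eqP; rewrite mulf_eq0 (negbTE s0) orbF => /eqP t0.
by move: St; rewrite t0 scale0r addr0.
Qed.

End FlatFunctions.

(** * Shape operators *)

Section ShapeOperator.
Context {R : realType} {d : nat}.
Local Notation V := 'rV[R]_d.
Local Notation e_ := (@basis_vec R d).
Implicit Types (S : set V) (q n x : V).

(** [A] is the derivative of the unit normal at [q], extended by zero to the
    normal line. The condition [enorm (n - nu) < 1] selects one of the two unit
    normals at [x]. *)
Definition shape_at S q (nu : V) (A : 'M[R]_d) := [/\ A^T = A, nu *m A = 0 &
  forall e : R, 0 < e -> exists2 r : R, 0 < r & forall x n, S x -> enorm (x - q) < r ->
    unit_normal S x n -> enorm (n - nu) < 1 -> enorm (n - nu - (x - q) *m A) <= e * enorm (x - q)].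

Lemma mulmx_bounded m (A : 'M[R]_(d, m)) : exists2 C : R, 0 < C & forall x : V,
  enorm (x *m A) <= C * enorm x.
Proof.
exists (\sum_i enorm (row i A) + 1).
  by rewrite ltr_wpDl// sumr_ge0// => i _; exact: enorm_ge0.
move=> x; rewrite mulmx_sum_row mulrDl mul1r.
have : enorm (\sum_i x 0 i *: row i A) <= \sum_i enorm (row i A) * enorm x.
  elim/big_ind2: _ => [|u1 u2 v1 v2 h1 h2|i _].
  - by rewrite enorm0.
  - by apply: le_trans (enormD _ _) _; lra.
  rewrite enormZ mulrC ler_wpM2l ?enorm_ge0//.
  by apply: le_trans (norm_le_enorm x); exact: coord_le.
by rewrite -mulr_suml; have := enorm_ge0 x; lra.
Qed.

(** For negative factors the one-sided definition is not enough, and the defining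
    function is used. *)
Lemma normal_scale S q n (a : R) : hypersurface S -> S q -> normal_at S q n ->
  normal_at S q (a *: n).
Proof.
move=> hS Sq nn; have [f [k [nu0 [r c]]]] := hypersurface_chart hS Sq.
rewrite (chart_normal_parallel Sq c nn) scalerA; set b := a * _ => e e0.
have b0 : 0 < `|b| + 1 by rewrite ltr_wpDl.
have [r1 /andP[r10 _] h] := chart_strict c (divr_gt0 (mulr_gt0 e0 (chart_k c)) b0).
exists (Num.min r r1); first by rewrite lt_min (chart_r c).
move=> x Sx; rewrite lt_min => /andP[xr xr1].
have := h x q xr1 (ltac:(by rewrite subrr enorm0)).
rewrite ((chart_zero c xr).1 Sx) ((chart_zero c (chart_center c)).1 Sq) subrr sub0r normrN.
rewrite normrM (gtr0_norm (chart_k c)) => H.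
apply: le_trans (ler_norm _) _; rewrite dotZr normrM.
rewrite -(ler_pM2l (chart_k c)) mulrCA.
apply: le_trans (ler_wpM2l (normr_ge0 b) H) _.
have -> : `|b| * (e * k / (`|b| + 1) * enorm (x - q)) =
  k * (e * enorm (x - q)) * (`|b| / (`|b| + 1)) by ring.
rewrite ler_piMr ?mulr_ge0 ?enorm_ge0 ?(ltW e0) ?(ltW (chart_k c))//.
by rewrite ler_pdivrMr// mul1r lerDl.
Qed.

Lemma unit_normalN S q n : hypersurface S -> S q -> unit_normal S q n -> unit_normal S q (- n).
Proof.
move=> hS Sq [nn n1]; split; last by rewrite dotNl dotNr opprK.
by rewrite -scaleN1r; exact: normal_scale.
Qed.

(** First-order expansion of the normalization of a vector close to [k nu]. *)
Lemma normalize_expansion (nu n del : V) (k b : R) : dot nu nu = 1 -> dot n n = 1 ->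
  enorm (n - nu) < 1 -> n = b *: (k *: nu + del) -> k != 0 -> enorm del <= `|k| / 2 ->
  enorm (n - nu - k^-1 *: (del - dot del nu *: nu)) <= 8 / `|k| ^+ 2 * enorm del ^+ 2.
Proof.
move=> nu1 n1 nn nE k0 dk; pose K := `|k|; have K0 : 0 < K by rewrite normr_gt0.
pose t := dot n nu; pose p := del - dot del nu *: nu; pose w := b *: p.
have pnu : dot p nu = 0 by rewrite /p dotDl dotNl dotZl nu1 mulr1 subrr.
have tb : t = b * (k + dot del nu) by rewrite /t nE dotZl dotDl dotZl nu1 mulr1.
have nw : n = t *: nu + w.
  by rewrite tb {1}nE /w /p; apply/rowP => i; rewrite !mxE; ring.
have wnu : dot w nu = 0 by rewrite /w dotZl pnu mulr0.
have t2 : t ^+ 2 + dot w w = 1.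
  rewrite -n1 [in RHS]nw; move: (w) wnu => v vnu.
  by rewrite !dotDl !dotDr !dotZl !dotZr (dotC nu v) vnu nu1; ring.
have w2 := dot_ge0 w.
have t12 : 1 / 2 <= t.
  have : dot (n - nu) (n - nu) < 1 by rewrite -sqr_enorm expr_lt1// enorm_ge0.
  by rewrite dotDl !dotDr !dotNl !dotNr (dotC nu n) n1 nu1 -/t opprK; clear -t; lra.
have t1 : t <= 1 by move: t2 w2 t12; clear; nra.
have ot : 1 - t <= enorm w ^+ 2 by rewrite sqr_enorm; move: t2 t1 t12; clear; nra.
have ple : enorm p <= enorm del.
  rewrite -(ler_pXn2r (_ : (0 < 2)%N)) ?nnegrE ?enorm_ge0// !sqr_enorm.
  rewrite {2}/p dotDr dotNr dotZr pnu mulr0 subr0 /p dotDl dotNl dotZl (dotC nu).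
  by rewrite lerBlDr lerDl -expr2 sqr_ge0.
have dnu : `|dot del nu| <= enorm del.
  by apply: le_trans (cauchy_schwarz _ _) _; rewrite (enorm1 nu1) mulr1.
have d0 := enorm_ge0 del.
have kd : K / 2 <= `|k + dot del nu|.
  have := ler_normB (k + dot del nu) (dot del nu); rewrite addrK -/K.
  by move: dnu dk; rewrite -/K; clear; move: `|_| `|_| (enorm del) => X Y Z; lra.
have bK : `|b| * K <= 2.
  have h1 : `|b| * `|k + dot del nu| <= 1 by rewrite -normrM -tb ger0_norm//; apply: le_trans t12.
  have h2 : `|b| * (K / 2) <= `|b| * `|k + dot del nu| by rewrite ler_wpM2l.
  by move: (le_trans h2 h1); clear; move: `|b| => X; lra.
pose x := enorm del / K.
have xK : enorm del = x * K by rewrite /x divfK// gt_eqF.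
have x0 : 0 <= x by rewrite divr_ge0// ltW.
have x12 : x <= 1 / 2 by rewrite ler_pdivrMr//; move: dk; rewrite -/K; clear; lra.
have bx : `|b| * enorm del <= 2 * x.
  by rewrite xK mulrCA [2 * x]mulrC ler_wpM2l.
have wx : enorm w <= 2 * x.
  by apply: le_trans bx; rewrite /w enormZ ler_wpM2l.
have ot2 : 1 - t <= 4 * x ^+ 2.
  apply: le_trans ot _; have := enorm_ge0 w; move: (enorm w) wx => W; move: x0; clear; nra.
have bk : `|b - k^-1| * enorm del <= 4 * x ^+ 2.
  have E : (b - k^-1) * k = t - 1 - b * dot del nu.
    by rewrite mulrBl mulVf// tb; ring.
  have h : `|b - k^-1| * K <= 4 * x.
    rewrite -normrM E; apply: le_trans (ler_normB _ _) _.
    rewrite distrC (ger0_norm (_ : 0 <= 1 - t)) ?subr_ge0// normrM.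
    have : `|b| * `|dot del nu| <= `|b| * enorm del by rewrite ler_wpM2l.
    move: (`|b| * _) (`|b| * _) bx => X Y; move: ot2 x0 x12; clear; nra.
  by rewrite xK mulrCA (_ : 4 * x ^+ 2 = x * (4 * x)); [rewrite ler_wpM2l|ring].
have -> : n - nu - k^-1 *: p = (t - 1) *: nu + (b - k^-1) *: p.
  by rewrite {1}nw /w; apply/rowP => i; rewrite !mxE; ring.
apply: le_trans (enormD _ _) _; rewrite !enormZ (enorm1 nu1) mulr1 distrC ger0_norm ?subr_ge0//.
have : `|b - k^-1| * enorm p <= `|b - k^-1| * enorm del by rewrite ler_wpM2l.
have -> : 8 / K ^+ 2 * enorm del ^+ 2 = 8 * x ^+ 2.
  by rewrite xK; field; rewrite gt_eqF.
move: (`|b - k^-1| * _) (`|b - k^-1| * _) bk ot2 => X Y; clear; lra.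
Qed.

(** The Hessian of a defining function, divided by the length of the gradient
    and compressed to the tangent space. *)
Lemma shape_exists S q nu : hypersurface S -> S q -> unit_normal S q nu ->
  exists A, shape_at S q nu A.
Proof.
move=> hS Sq [nn n1]; have [f [k [nu0 [r1 c]]]] := hypersurface_chart hS Sq.
have nuE := chart_normal_parallel Sq c nn.
have sg2 : dot nu nu0 ^+ 2 = 1 by move: n1; rewrite {1 2}nuE !dotE (chart_nu c) mulr1 expr2.
pose sg := dot nu nu0.
have qr := chart_center c.
pose kk := sg * k.
have gq : grad f q = kk *: nu.
  by rewrite (chart_grad c) [in RHS]nuE scalerA /kk mulrAC -/sg -expr2 sg2 mul1r.
have k0 := chart_k c.
have sg0 : sg != 0.
  apply/eqP => h; move: sg2; rewrite -/sg h expr0n => /esym/eqP.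
  by rewrite oner_eq0.
have kk0 : kk != 0 by rewrite mulf_neq0// gt_eqF.
pose H : 'M[R]_d := \matrix_(i, j) 'D_(e_ i) ('D_(e_ j) f) q.
have HT : H^T = H.
  apply/matrixP => i j; rewrite !mxE.
  apply: (schwarz _ (chart_diff2 c qr (e_ j)) (chart_diff2 c qr (e_ i))).
  by apply/nbhs_enormP; exists r1; [exact: chart_r c | exact: chart_diff c].
pose P : 'M[R]_d := 1%:M - nu^T *m nu.
have PT : P^T = P by rewrite /P linearB/= trmx1 trmx_mul trmxK.
have xP x : x *m P = x - dot x nu *: nu.
  rewrite /P mulmxBr mulmx1 mulmxA; congr (_ - _).
  have -> : x *m nu^T = (dot x nu)%:M.
    by apply/matrixP => i j; rewrite !ord1 !mxE mulr1n; apply: eq_bigr => l _; rewrite mxE.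
  by rewrite mul_scalar_mx.
exists (kk^-1 *: (P *m H *m P)); split.
- by rewrite linearZ/= !trmx_mul PT HT mulmxA.
- by rewrite -scalemxAr !mulmxA (xP nu) n1 scale1r subrr !mul0mx scaler0.
move=> e e0.
have Ple x : enorm (x *m P) <= enorm x.
  rewrite -(ler_pXn2r (_ : (0 < 2)%N)) ?nnegrE ?enorm_ge0// !sqr_enorm xP.
  by rewrite !dotE (dotC nu x) n1; have := sqr_ge0 (dot x nu); rewrite expr2; lra.
pose K := `|kk|; have K0 : 0 < K by rewrite normr_gt0.
have [C0 C00 HC] := mulmx_bounded H; pose C := C0 + 1.
have C1 : 0 < C by rewrite addr_gt0.
pose h0 := enorm (nu *m H); have h00 : 0 <= h0 := enorm_ge0 _.
pose eta := Num.min 1 (e * K / (2 * (1 + h0))).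
have eta0 : 0 < eta by rewrite lt_min ltr01 divr_gt0 ?mulr_gt0// ltr_wpDr.
have eta1 : eta <= 1 by rewrite ge_min lexx.
have etaE : eta * (1 + h0) / K <= e / 2.
  rewrite ler_pdivrMr//.
  have h1 : eta <= e * K / (2 * (1 + h0)) by rewrite ge_min lexx orbT.
  apply: le_trans (ler_wpM2r (_ : 0 <= 1 + h0) h1) _; first by rewrite addr_ge0.
  by rewrite le_eqVlt; apply/orP; left; apply/eqP; field; rewrite gt_eqF// ltr_wpDr.
have [ra ra0 hg] : exists2 r : R, 0 < r & forall x, enorm (x - q) < r ->
    enorm (grad f x - kk *: nu - (x - q) *m H) <= eta * enorm (x - q).
  pose eta' := eta / (d%:R + 1).
  have eta'0 : 0 < eta' by rewrite divr_gt0// ltr_wpDl.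
  have /nbhs_enormP[r r0 h] : \forall x \near q, forall j : 'I_d,
      `|'D_(e_ j) f x - 'D_(e_ j) f q - 'D_(x - q) ('D_(e_ j) f) q| <= eta' * enorm (x - q).
    apply: (@filter_forall V 'I_d (fun j x => `|'D_(e_ j) f x - 'D_(e_ j) f q - 'D_(x - q) ('D_(e_ j) f) q|
       <= eta' * enorm (x - q)) (nbhs q)) => j.
    apply/nbhs_enormP; have [r r0 h] := diff_eps (chart_diff2 c qr (e_ j)) eta'0.
    by exists r => // x xr; have := h _ xr; rewrite [q + _]addrC subrK.
  exists r => // x xr; apply: le_trans (enorm_le_norm _) _.
  rewrite mulrC -ler_pdivlMr ?ltr_wpDl// mulrAC -/eta'; apply: norm_le_coord => [|j].
    by rewrite mulr_ge0 ?enorm_ge0// ltW.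
  have := h x xr j; rewrite -gq.
  have -> : (grad f x - grad f q - (x - q) *m H) 0 j =
     'D_(e_ j) f x - 'D_(e_ j) f q - ((x - q) *m H) 0 j by rewrite !mxE.
  suff -> : ((x - q) *m H) 0 j = 'D_(x - q) ('D_(e_ j) f) q by [].
  rewrite (derive_dot _ (chart_diff2 c qr (e_ j))) mxE; apply: eq_bigr => i _.
  by rewrite !mxE.
have [rb rb0 hb] := nn eta eta0.
have [rc rc0 hc] := (unit_normalN hS Sq (conj nn n1)).1 eta eta0.
pose D := 8 / K ^+ 2 * C ^+ 2.
have D0 : 0 < D by rewrite mulr_gt0 ?divr_gt0 ?exprn_gt0.
pose m := Num.min (Num.min (Num.min r1 ra) (Num.min rb rc)) (Num.min (K / (2 * C)) (e / (2 * D))).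
exists m; first by rewrite !lt_min (chart_r c) ra0 rb0 rc0 !divr_gt0// mulr_gt0.
move=> x n Sx; rewrite !lt_min => /andP[/andP[/andP[xr1 xra] /andP[xrb xrc]] /andP[xK xD]].
move=> [nx nx1] nnu.
pose z := x - q; pose zz := enorm z.
have zz0 : 0 <= zz := enorm_ge0 _.
have xK' : C * zz <= K / 2.
  have -> : K / 2 = C * (K / (2 * C)) by field; rewrite gt_eqF.
  by rewrite ler_pM2l// ltW.
have xD' : D * zz <= e / 2.
  have -> : e / 2 = D * (e / (2 * D)) by field; rewrite gt_eqF.
  by rewrite ler_pM2l// ltW.
have tz : `|dot z nu| <= eta * zz.
  have := hb x Sx xrb; have := hc x Sx xrc; rewrite dotNr -/z -/zz => h1 h2.
  by rewrite ler_norml -lerNl h1.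
pose del := grad f x - kk *: nu.
have delH : enorm (del - z *m H) <= eta * zz by exact: hg.
have dele : enorm del <= C * zz.
  have := enormD (del - z *m H) (z *m H); rewrite subrK; have := HC z; rewrite -/zz /C.
  have : eta * zz <= 1 * zz by rewrite ler_wpM2r.
  by have := delH; lra.
have [b nE] : exists b, n = b *: (kk *: nu + del).
  have := chart_normal_parallel Sx (chart_recenter c xr1) nx; rewrite scalerA /del addrC subrK => h.
  by eexists; exact: h.
have := normalize_expansion n1 nx1 nnu nE kk0 (le_trans dele xK').
rewrite -(xP del) => main.
have -> : n - nu - z *m (kk^-1 *: (P *m H *m P)) = (n - nu - kk^-1 *: (del *m P)) +
    kk^-1 *: ((del - z *m H) *m P + dot z nu *: (nu *m H *m P)).
  rewrite -scalemxAr !mulmxA (xP z) !mulmxBl -!scalemxAl.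
  move: (del *m P) (z *m H *m P) (nu *m H *m P) => X Y Z.
  by clear; apply/rowP => i; rewrite !mxE; ring.
have e1 : enorm (n - nu - kk^-1 *: (del *m P)) <= e / 2 * zz.
  apply: le_trans main _; apply: (@le_trans _ _ (D * zz * zz)); last by rewrite ler_wpM2r.
  have -> : D * zz * zz = 8 / K ^+ 2 * (C * zz) ^+ 2 by rewrite /D; ring.
  apply: ler_wpM2l; first by rewrite divr_ge0 ?exprn_ge0// ltW.
  by rewrite ler_pXn2r ?nnegrE ?enorm_ge0// mulr_ge0// ltW.
have e3 : enorm (kk^-1 *: ((del - z *m H) *m P + dot z nu *: (nu *m H *m P))) <= e / 2 * zz.
  rewrite enormZ normfV -/K.
  have h1 : enorm ((del - z *m H) *m P + dot z nu *: (nu *m H *m P)) <= eta * (1 + h0) * zz.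
    apply: le_trans (enormD _ _) _; rewrite enormZ.
    have -> : eta * (1 + h0) * zz = eta * zz + eta * zz * h0 by ring.
    apply: lerD; first exact: le_trans (Ple _) delH.
    exact: ler_pM (normr_ge0 _) (enorm_ge0 _) tz (Ple (nu *m H)).
  apply: le_trans (ler_wpM2l _ h1) _; first by rewrite invr_ge0 ltW.
  have -> : K^-1 * (eta * (1 + h0) * zz) = eta * (1 + h0) / K * zz by ring.
  by rewrite ler_wpM2r.
apply: le_trans (enormD _ _) _; apply: le_trans (lerD e1 e3) _.
by rewrite -mulrDl -splitr.
Qed.
End ShapeOperator.

(** * Orbits of groups of isometries *)

(** Connectedness as an induction principle. *)
Lemma connected_induction (T : topologicalType) (E : set T) (P : T -> Prop) (x0 : T) :
  connected E -> E x0 -> P x0 ->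
  (forall x, E x -> P x -> \forall y \near x, E y -> P y) ->
  (forall x, E x -> ~ P x -> \forall y \near x, E y -> ~ P y) ->
  forall x, E x -> P x.
Proof.
move=> cE Ex0 Px0 oP cP.
suff EP : E `&` [set x | P x] = E by move=> x; rewrite -{1}EP => -[].
pose near_in (Q : T -> Prop) : set T := [set x : T | \forall y \near x, E y -> Q y].
have near_open Q : open (near_in Q).
  by rewrite openE => x; exact: nbhs_interior.
apply: cE; first by exists x0.
- exists (near_in P); first exact: near_open.
  apply/seteqP; split => x [Ex h]; split => //; first exact: oP.
  exact: (nbhs_singleton h).
exists (~` near_in (fun y => ~ P y)); first by rewrite closedC; exact: near_open.
apply/seteqP; split => x [Ex h]; split => //.
  by move=> /nbhs_singleton; apply.
by apply: contrapT => nP; apply: h; exact: cP.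
Qed.

Lemma segment_connected_rV (R : realType) (d : nat) (a b : 'rV[R]_d) :
  connected ((fun t : R => a + t *: (b - a)) @` `[0, 1]%classic).
Proof.
apply: connected_continuous_connected; first exact: segment_connected.
apply: continuous_subspaceT => t.
apply: cvgD; [exact: cvg_cst|apply: cvgZr_tmp; exact: cvg_id].
Qed.

Section Isometries.
Context {R : realType} {d : nat}.
Local Notation V := 'rV[R]_d.
Local Notation e_ := (@basis_vec R d).

Definition lin (g : V -> V) : 'M[R]_d := \matrix_(i, j) (g (e_ i) - g 0) 0 j.

Definition is_isometry (g : V -> V) := forall x y, Defs.edist (g x) (g y) = Defs.edist x y.

Lemma isometry_dot g x y z : is_isometry g ->
  dot (g x - g z) (g y - g z) = dot (x - z) (y - z).
Proof.
move=> ig.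
have nrm a b : dot (g a - g b) (g a - g b) = dot (a - b) (a - b).
  by have := ig a b; rewrite !edistE -!sqr_enorm => ->.
have := nrm x y; have := nrm x z; have := nrm y z.
have -> : g x - g y = (g x - g z) - (g y - g z) by rewrite opprB addrA subrK.
have -> : x - y = (x - z) - (y - z) by rewrite opprB addrA subrK.
move: (g x - g z) (g y - g z) (x - z) (y - z) => a b a' b'.
rewrite !dotDl !dotDr !dotNl !dotNr (dotC b a) (dotC b' a'); lra.
Qed.

(** Isometries preserve inner products, so the vectors [g z - g 0] and
    [z *m lin g] have the same products with each other as with themselves. *)
Lemma isometry_affine g x y : is_isometry g -> g x - g y = (x - y) *m lin g.
Proof.
move=> ig.
have D a b : dot (g a - g 0) (g b - g 0) = dot a b.
  by rewrite isometry_dot// !subr0.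
have rowE i : row i (lin g) = g (e_ i) - g 0 by apply/rowP => j; rewrite !mxE.
have key z : g z - g 0 = z *m lin g.
  rewrite mulmx_sum_row; under eq_bigr do rewrite rowE.
  apply/eqP; rewrite -subr_eq0 -dot_eq0; set s := \sum_i _; apply/eqP.
  have ds w : dot s w = \sum_i z 0 i * dot (g (e_ i) - g 0) w.
    rewrite /s; elim/big_ind2: _ => [|a b a' b' h1 h2|i _]; first by rewrite dot0l.
      by rewrite dotDl h1 h2.
    by rewrite dotZl.
  have sz a : dot s (g a - g 0) = dot z a.
    rewrite ds; under eq_bigr do rewrite D dot_basis.
    by [].
  have ss : dot s s = dot z z.
    rewrite ds -[RHS]/(\sum_i _); apply: eq_bigr => i _; congr (_ * _).
    by rewrite dotC sz dotC dot_basis.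
  have := D z z; have := sz z; move: (g z - g 0) s ss {ds sz} => a s ss sa aa.
  by rewrite !dotDl !dotDr !dotNl !dotNr (dotC a s) aa sa ss; ring.
by rewrite mulmxBl -!key opprB addrA subrK.
Qed.

Lemma lin_orthogonal g : is_isometry g -> lin g *m (lin g)^T = 1%:M.
Proof.
move=> ig; apply/matrixP => i j; rewrite !mxE.
have -> : (i == j)%:R = dot (e_ i) (e_ j) by rewrite dot_basis basis_vecE eq_sym.
have := isometry_dot (e_ i) (e_ j) 0 ig; rewrite !subr0 => <-.
by apply: eq_bigr => k _; rewrite !mxE.
Qed.

Lemma lin_orthogonal' g : is_isometry g -> (lin g)^T *m lin g = 1%:M.
Proof. by move=> /lin_orthogonal/mulmx1C. Qed.

Lemma dot_lin g x y : is_isometry g -> dot (x *m lin g) (y *m lin g) = dot x y.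
Proof. by move=> ig; rewrite dot_mxr -mulmxA lin_orthogonal// mulmx1. Qed.

Lemma enorm_lin g x : is_isometry g -> enorm (x *m lin g) = enorm x.
Proof. by move=> ig; rewrite /enorm dot_lin. Qed.

Lemma isometry_enorm g x y : is_isometry g -> enorm (g x - g y) = enorm (x - y).
Proof. by move=> ig; rewrite isometry_affine// enorm_lin. Qed.

Lemma isometry_add g x v : is_isometry g -> g (x + v) = g x + v *m lin g.
Proof.
move=> ig; have := isometry_affine (x + v) x ig.
by rewrite (addrAC x v) subrr add0r => <-; rewrite addrCA subrr addr0.
Qed.

End Isometries.

Section Orbits.
Context {R : realType} {d : nat} (G : set ('rV[R]_d -> 'rV[R]_d)) (p0 : 'rV[R]_d).
Context (hG : isometry_group G).
Local Notation V := 'rV[R]_d.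
Local Notation O := (isom_orbit G p0).
Context (hO : hypersurface O).

Lemma G_isometry g : G g -> is_isometry g.
Proof. by move=> Gg; have [_ _ _ h] := hG; exact: h. Qed.

Lemma G_inverse g : G g -> exists h, [/\ G h, cancel g h, cancel h g & lin h = (lin g)^T].
Proof.
move=> Gg; have [_ _ /(_ g Gg)[h [Gh gh hg]] _] := hG; exists h; split => //.
have E (x : V) : x *m lin g *m lin h = x.
  have := isometry_affine (g x) (g 0) (G_isometry Gh); rewrite !gh subr0.
  by rewrite isometry_affine ?subr0//; exact: G_isometry.
have E1 : lin g *m lin h = 1%:M.
  by apply/row_matrixP => i; rewrite !rowE mulmxA E mulmx1.
by rewrite -[LHS]mul1mx -(lin_orthogonal' (G_isometry Gg)) -mulmxA E1 mulmx1.
Qed.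

Lemma orbit_refl : O p0.
Proof. by have [G1 _ _ _] := hG; exists id. Qed.

Lemma orbit_G g x : G g -> O x -> O (g x).
Proof. by move=> Gg [h Gh ->]; have [_ Gc _ _] := hG; exists (g \o h) => //; exact: Gc. Qed.

Lemma orbit_trans x y : O x -> O y -> exists2 g, G g & g x = y.
Proof.
move=> [g Gg ->] [h Gh ->]; have [g' [Gg' gg' g'g _]] := G_inverse Gg.
have [_ Gc _ _] := hG; exists (h \o g'); first exact: Gc.
by rewrite /= gg'.
Qed.

Lemma normal_transport g q n : G g -> normal_at O q n -> normal_at O (g q) (n *m lin g).
Proof.
move=> Gg nn e e0; have [r r0 h] := nn e e0; exists r => // x Ox xr.
have ig := G_isometry Gg.
have [k [Gk gk kg _]] := G_inverse Gg.
have xE : x = g (k x) by rewrite kg.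
move: xr; rewrite xE isometry_enorm// => xr.
by rewrite isometry_affine// dot_lin//; apply: h => //; exact: orbit_G.
Qed.

Lemma unit_normal_transport g q n : G g -> unit_normal O q n -> unit_normal O (g q) (n *m lin g).
Proof.
move=> Gg [nn n1]; split; first exact: normal_transport.
by rewrite dot_lin//; exact: G_isometry.
Qed.

Lemma shape_transport g q nu A : G g -> shape_at O q nu A ->
  shape_at O (g q) (nu *m lin g) ((lin g)^T *m A *m lin g).
Proof.
move=> Gg [AT nA h]; have ig := G_isometry Gg.
have [k [Gk gk kg kE]] := G_inverse Gg.
have ik := G_isometry Gk.
split.
- by rewrite !trmx_mul trmxK AT mulmxA.
- by rewrite !mulmxA -[nu *m _ *m _]mulmxA lin_orthogonal// mulmx1 nA mul0mx.
move=> e e0; have [r r0 hr] := h e e0; exists r => // x n Ox xr un nn.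
have xE : x = g (k x) by rewrite kg.
have nE : n = n *m lin k *m lin g by rewrite kE -mulmxA lin_orthogonal'// mulmx1.
have uk := unit_normal_transport Gk un.
rewrite xE isometry_enorm// in xr *.
have := hr (k x) (n *m lin k) (orbit_G Gk Ox) xr uk.
have E1 : n - nu *m lin g = (n *m lin k - nu) *m lin g by rewrite mulmxBl -nE.
rewrite E1 enorm_lin// in nn *; move=> /(_ nn).
rewrite isometry_affine// !mulmxA -[_ *m lin g *m (lin g)^T]mulmxA lin_orthogonal// mulmx1.
by rewrite -mulmxBl enorm_lin.
Qed.

(** The size of the ball on which a hypersurface is closed can be chosen uniformly
    along an orbit. *)
Lemma orbit_closed x : (forall e : R, 0 < e -> exists2 y, O y & enorm (y - x) < e) -> O x.
Proof.
move=> cl; have [r r0 h] := hypersurface_locally_closed hO orbit_refl.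
have [y Oy yx] := cl r r0.
have [g Gg gy] := orbit_trans Oy orbit_refl.
have ig := G_isometry Gg.
have [k [Gk gk kg _]] := G_inverse Gg.
rewrite -(gk x); apply: orbit_G => //; apply: h.
  by rewrite -gy isometry_enorm// enormB.
move=> e /cl[z Oz zx]; exists (g z); first exact: orbit_G.
by rewrite isometry_enorm.
Qed.

Definition foot y q := O q /\ forall x, O x -> enorm (y - q) <= enorm (y - x).

Lemma foot_exists y : exists q, foot y q.
Proof.
pose r := enorm (y - p0).
pose B : set V := [set x | O x /\ enorm (y - x) <= r].
have enc z : {for z, continuous (fun x : V => enorm (y - x))}.
  apply/(@continuous_enormP R d R^o) => e e0; exists e => // x xz.
  apply: le_lt_trans (ler_enorm_sub _ _) _.
  by rewrite opprB addrC addrA subrK enormB.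
have cB : compact B.
  apply: bounded_closed_compact.
    exists (enorm y + r); split; first exact: num_real.
    move=> M hM x [_ xr] /=; apply: ltW; apply: le_lt_trans hM.
    apply: le_trans (norm_le_enorm x) _.
    by have := enormD (x - y) y; rewrite subrK (enormB x y); lra.
  move=> x clx.
  have apx (e : R) : 0 < e -> exists2 z, B z & enorm (z - x) < e.
    move=> e0; have [z [Bz zx]] := clx _ (iffRL (nbhs_enormP x [set z | enorm (z - x) < e])
      (ex_intro2 _ _ e e0 (fun _ => id))).
    by exists z.
  split.
    by apply: orbit_closed => e /apx[z [Oz _] zx]; exists z.
  rewrite leNgt; apply/negP => xr.
  have [|z [Oz zr] zx] := apx (enorm (y - x) - r); first by rewrite subr_gt0.
  by have := enorm_dist y z x; lra.
have B0 : B !=set0 by exists p0; split => //; exact: orbit_refl.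
have [|q] := EVT_min_rV B0 cB (f := fun x => enorm (y - x)).
  by apply: continuous_in_subspaceT => x _; exact: enc.
rewrite inE => -[Oq qr] qmin; exists q; split => // x Ox.
have [xr|xr] := leP (enorm (y - x)) r; first by apply: qmin; rewrite inE.
exact: le_trans qr (ltW xr).
Qed.

Lemma foot_normal y q : foot y q -> normal_at O q (y - q).
Proof.
move=> [Oq h] e e0; exists (2 * e); first by rewrite mulr_gt0.
move=> x Ox xr; have := h x Ox.
rewrite -(ler_pXn2r (_ : (0 < 2)%N)) ?nnegrE ?enorm_ge0// !sqr_enorm.
have -> : y - x = (y - q) - (x - q) by rewrite opprB addrA subrK.
move: xr (y - q); move: (x - q) => b br a.
rewrite dotDl !dotDr !dotNl !dotNr (dotC b a) -(sqr_enorm b).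
have : enorm b * enorm b <= enorm b * (2 * e) by rewrite ler_wpM2l ?enorm_ge0// ltW.
rewrite expr2; lra.
Qed.

Lemma unit_normals_apart (a b : V) : dot b b = 1 -> enorm (a + b) < 1 ->
  enorm (a - b) < 1 / 2 -> False.
Proof.
move=> b1 ab ab'.
have := enormD (a + b) (b - a).
have -> : a + b + (b - a) = (2 : R) *: b by rewrite scaler_nat mulr2n addrC addrA subrK.
by rewrite enormZ (enorm1 b1) mulr1 (enormB b) ger0_norm//; lra.
Qed.

(** The group moves [q] to each nearby point of the orbit, but it may carry [nu]
    to the opposite of the nearby normal. If a closed condition fails at some
    nearby point for the normal close to [nu], it fails around that point, where
    it holds for the opposite normals then; moving back to [q], it holds around
    [(q, nu)] after all. *)
Lemma normal_propagation (E : V -> V -> Prop) q nu :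
  (forall x n, ~ E x n -> exists2 r : R, 0 < r & forall x' n',
     enorm (x' - x) < r -> enorm (n' - n) < r -> ~ E x' n') ->
  (forall g x n, G g -> E x n -> E (g x) (n *m lin g)) ->
  O q -> unit_normal O q nu -> E q nu ->
  exists2 r : R, 0 < r & forall x n, O x -> enorm (x - q) < r -> unit_normal O x n ->
    enorm (n - nu) < 1 -> E x n.
Proof.
move=> clE GE Oq un Eq; have [N [r r0 [Nq hN]]] := normal_field hO Oq un.
have n2 : enorm (nu + nu) = 2.
  by rewrite -mulr2n -scaler_nat enormZ (enorm1 un.2) mulr1 ger0_norm.
have near_eq x n : O x -> enorm (x - q) < r -> unit_normal O x n -> enorm (n - nu) < 1 -> n = N x.
  move=> Ox xr ux nn; have [uN Nnu _ _] := hN x Ox xr.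
  have [//|nE] := unit_normal_pm hO Ox uN ux.
  have := enormD (n - nu) (N x - nu); rewrite nE addrACA [- N x + _]addrC subrr add0r.
  rewrite -opprD enormN n2 -nE => h.
  by exfalso; lra.
have [[s s0 hs]|far] := pselect (exists2 s : R, 0 < s & forall x, O x ->
    enorm (x - q) < s -> enorm (x - q) < r -> E x (N x)).
  exists (Num.min r s); first by rewrite lt_min r0.
  move=> x n Ox; rewrite lt_min => /andP[xr xs] ux nn.
  by rewrite (near_eq x n)//; exact: hs.
have [x0 [Ox0 x0r nE0]] : exists x0, [/\ O x0, enorm (x0 - q) < r & ~ E x0 (N x0)].
  apply: contrapT => no; apply: far; exists r => // x Ox xr _; apply: contrapT => nE.
  by apply: no; exists x.
have [t t0 ht] := clE _ _ nE0.
have [uN0 _ _ cN0] := hN x0 Ox0 x0r.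
have [t' t'0 ht'] := cN0 (Num.min t (1 / 2)) (ltac:(rewrite lt_min t0; lra)).
have [g0 Gg0 g0q] := orbit_trans Oq Ox0.
have i0 := G_isometry Gg0.
have flipped g : G g -> E (g q) (nu *m lin g) by move=> Gg; exact: GE.
have nuE : nu *m lin g0 = - N x0.
  have := unit_normal_transport Gg0 un; rewrite g0q => u0.
  have [h|//] := unit_normal_pm hO Ox0 uN0 u0.
  by case: nE0; have := flipped _ Gg0; rewrite h g0q.
exists (Num.min t (Num.min t' (r - enorm (x0 - q)))).
  by rewrite !lt_min t0 t'0 subr_gt0.
move=> x n Ox; rewrite !lt_min => /andP[xt /andP[xt' xr]] ux nn.
have Ogx := orbit_G Gg0 Ox.
have gx : enorm (g0 x - x0) = enorm (x - q) by rewrite -g0q isometry_enorm.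
have gxr : enorm (g0 x - q) < r by have := enorm_dist (g0 x) x0 q; lra.
have [uNg _ _ _] := hN (g0 x) Ogx gxr.
have /andP[Ngt Ngh] : (enorm (N (g0 x) - N x0) < t) && (enorm (N (g0 x) - N x0) < 1 / 2).
  by have := ht' (g0 x); rewrite gx lt_min => /(_ xt').
have nEg : ~ E (g0 x) (N (g0 x)) by apply: ht; rewrite ?gx.
have Em : E (g0 x) (- N (g0 x)).
  have [g Gg gq] := orbit_trans Oq Ogx.
  have := unit_normal_transport Gg un; rewrite gq => ug.
  have Eg := flipped g Gg; rewrite gq in Eg.
  by have [h|<-//] := unit_normal_pm hO Ogx uNg ug; rewrite h in Eg.
have ung := unit_normal_transport Gg0 ux.
have nE : n *m lin g0 = - N (g0 x).
  have [h|//] := unit_normal_pm hO Ogx uNg ung.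
  have : enorm (n *m lin g0 - nu *m lin g0) < 1 by rewrite -mulmxBl enorm_lin.
  rewrite h nuE opprK => h1.
  by case: (unit_normals_apart uN0.2 h1 Ngh).
have [k [Gk gk kg kE]] := G_inverse Gg0.
by have := GE k _ _ Gk Em; rewrite gk -nE kE -mulmxA lin_orthogonal ?mulmx1.
Qed.
End Orbits.

(** * Orbits on one side of their tangent hyperplanes *)

Section FirstOrder.
Context {R : realType} {d : nat}.
Local Notation V := 'rV[R]_d.
Local Notation e_ := (@basis_vec R d).
Implicit Types (S : set V) (q n x : V).

Lemma le0_eps (x K : R) : 0 <= K -> (forall e, 0 < e -> e <= 1 -> x <= e * K) -> x <= 0.
Proof.
move=> K0 h; rewrite leNgt; apply/negP => x0.
have K1 : 0 < 2 * (K + 1 + x) by lra.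
have := h (x / (2 * (K + 1 + x))) (divr_gt0 x0 K1).
rewrite ler_pdivrMr// mul1r mulrAC ler_pdivlMr//.
have h1 : x * K <= x * (K + 1 + x) by rewrite ler_pM2l//; lra.
have : 0 < x * (K + 1 + x) by rewrite mulr_gt0//; lra.
move=> h2 /(_ ltac:(lra)) h3; nra.
Qed.

(** A symmetric matrix is injective on its row space, so it is bounded below there. *)
Lemma symmetric_bounded_below (A : 'M[R]_d) : A^T = A ->
  exists2 C : R, 0 < C & forall w : V, enorm (w *m A) <= C * enorm (w *m A *m A).
Proof.
move=> AT.
have cap0 : (A :&: kermx A)%MS = 0.
  apply/eqP/rowV0P => v; rewrite sub_capmx => /andP[/submxP[w ->] /sub_kermxP wAA].
  by apply/eqP; rewrite -dot_eq0 dot_mxr AT wAA dot0r.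
have : (A <= A *m A)%MS.
  have := mxrank_mul_ker A A; rewrite cap0 mxrank0 addn0 => rk.
  by rewrite -(mxrank_leqif_sup (submxMl A A)).2 rk.
move=> /submxP[D AE]; have [C C0 hC] := mulmx_bounded D^T; exists C => // w.
have AE' : A = A *m A *m D^T by rewrite -[LHS]AT {1}AE !trmx_mul AT.
have wE : w *m A *m A *m D^T = w *m A by rewrite [in RHS]AE' !mulmxA.
by have := hC (w *m A *m A); rewrite wE.
Qed.

Lemma shapeN S q nu (A : 'M[R]_d) : hypersurface S -> shape_at S q nu A ->
  shape_at S q (- nu) (- A).
Proof.
move=> hS [AT nA h]; split.
- by rewrite linearN /= AT.
- by rewrite mulNmx mulmxN opprK.
move=> e /h[r r0 hr]; exists r => // x n Sx xr un; rewrite opprK => nn.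
have := hr x (- n) Sx xr (unit_normalN hS Sx un).
have -> : - n - nu = - (n + nu) by rewrite opprD.
rewrite enormN mulmxN opprK => /(_ nn).
have -> : - (n + nu) - (x - q) *m A = - (n + nu + (x - q) *m A) by rewrite [RHS]opprD.
by rewrite enormN.
Qed.

Lemma normal_curve S q nu (A : 'M[R]_d) a : hypersurface S -> S q -> unit_normal S q nu ->
  shape_at S q nu A -> dot a nu = 0 -> forall e rho : R, 0 < e -> 0 < rho ->
  exists2 r : R, 0 < r & forall s : R, 0 < s < r -> exists x n,
    [/\ S x, unit_normal S x n, enorm (x - q) < rho, enorm (n - nu) < 1 &
        enorm (x - q - s *: a) <= e * s /\ enorm (n - nu - s *: (a *m A)) <= e * s].
Proof.
move=> hS Sq un [AT nA hA] an e rho e0 rho0.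
have [K K0 hK] := mulmx_bounded A.
have [N [r1 r10 [_ hN]]] := normal_field hS Sq un.
have a0 := enorm_ge0 a.
have [|r2 r20 h2] := hA (e / (2 * (enorm a + 1))); first by rewrite divr_gt0//; lra.
pose e2 := Num.min 1 (Num.min e (e / (2 * K))).
have e20 : 0 < e2 by rewrite !lt_min ltr01 e0 divr_gt0//; lra.
have [/andP[e21 e2e] e2K] : (e2 <= 1) && (e2 <= e) /\ e2 <= e / (2 * K).
  by rewrite /e2 !ge_min !lexx /= ?orbT.
have [r3 r30 h3] := tangent_approx hS Sq un an e20.
exists (Num.min r3 (Num.min rho (Num.min r1 r2) / (enorm a + 1))).
  by rewrite lt_min r30 divr_gt0 ?lt_min ?rho0 ?r10//; lra.
move=> s /andP[s0]; rewrite lt_min => /andP[s3].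
rewrite ltr_pdivlMr ?ltr_wpDl// => s4.
have [|x Sx xs] := h3 s; first by rewrite s0.
have xq : enorm (x - q) <= s * (enorm a + 1).
  have := enormD (x - q - s *: a) (s *: a); rewrite subrK enormZ (gtr0_norm s0).
  have : e2 * s <= 1 * s by rewrite ler_pM2r.
  lra.
move: (le_lt_trans xq s4); rewrite !lt_min => /andP[xrho /andP[x1 x2]].
have [uN Nn _ _] := hN x Sx x1.
have Nn1 : enorm (N x - nu) < 1 by lra.
exists x, (N x); split => //; split.
  by apply: le_trans xs _; rewrite ler_pM2r.
have := h2 x (N x) Sx x2 uN Nn1.
have := hK (x - q - s *: a); rewrite mulmxBl -scalemxAl.
have := enormD (N x - nu - (x - q) *m A) ((x - q) *m A - s *: (a *m A)).
rewrite addrA subrK.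
move: (enorm (N x - nu - s *: (a *m A))) (enorm (N x - nu - (x - q) *m A)) (enorm ((x - q) *m A - s *: (a *m A))) => X Y Z.
have h4 : K * enorm (x - q - s *: a) <= e / 2 * s.
  apply: le_trans (ler_wpM2l (ltW K0) xs) _; rewrite mulrA ler_pM2r//.
  move: e2K; rewrite ler_pdivlMr ?mulr_gt0//; lra.
have h5 : e / (2 * (enorm a + 1)) * enorm (x - q) <= e / 2 * s.
  apply: le_trans (ler_wpM2l _ xq) _; first by rewrite ltW// divr_gt0//; lra.
  by rewrite le_eqVlt; apply/orP; left; apply/eqP; field; rewrite gt_eqF//; lra.
move: h4 h5; clear; lra.
Qed.

Lemma parallel_curve S q nu (A : 'M[R]_d) a (t : R) : hypersurface S -> S q ->
  unit_normal S q nu -> shape_at S q nu A -> dot a nu = 0 -> 0 < t ->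
  forall e rho : R, 0 < e -> e <= 1 -> 0 < rho ->
  exists (s : R) x n, let b := a + t *: (a *m A) in let z := x + t *: n - (q + t *: nu) in
    [/\ 0 < s, [/\ S x, unit_normal S x n, enorm (x - q) < rho & enorm (n - nu) < 1],
        enorm (n - nu - s *: (a *m A)) <= e * s, enorm z < rho &
        enorm (z - s *: b) <= e * (1 + t) * s /\ enorm z <= s * (enorm b + (1 + t))].
Proof.
move=> hS Sq un sA an t0 e rho e0 e1 rho0; set b := a + _.
have [r1 r10 h1] := normal_curve hS Sq un sA an e0 rho0.
have b0 : 0 < enorm b + (1 + t) by have := enorm_ge0 b; lra.
pose s := Num.min (r1 / 2) (rho / (2 * (enorm b + (1 + t)))).
have s0 : 0 < s by rewrite lt_min !divr_gt0// mulr_gt0.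
have [s1 s2] : s <= r1 / 2 /\ s <= rho / (2 * (enorm b + (1 + t))).
  by rewrite /s !ge_min !lexx orbT.
have [|x [n [Sx ux xrho nn [xa na]]]] := h1 s; first by rewrite s0; lra.
exists s, x, n; rewrite -/b; set z := x + _ - _.
have zb : enorm (z - s *: b) <= e * (1 + t) * s.
  have -> : z - s *: b = (x - q - s *: a) + t *: (n - nu - s *: (a *m A)).
    by rewrite /z /b; move: (a *m A) => aA; apply/rowP => i; rewrite !mxE; ring.
  apply: le_trans (enormD _ _) _; rewrite enormZ (gtr0_norm t0).
  have : t * enorm (n - nu - s *: (a *m A)) <= t * (e * s) by rewrite ler_pM2l.
  lra.
have zle : enorm z <= s * (enorm b + (1 + t)).
  have := enormD (z - s *: b) (s *: b); rewrite subrK enormZ (gtr0_norm s0).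
  have : e * ((1 + t) * s) <= 1 * ((1 + t) * s) by rewrite ler_wpM2r// mulr_ge0//; lra.
  lra.
split => //; apply: le_lt_trans zle _; move: s2; rewrite ler_pdivlMr ?mulr_gt0//; lra.
Qed.

(** For large [t] the map [x + t n(x)] is immersive at [q] modulo its shape operator,
    so that a vector which is normal to its image is normal to [S]. *)
Lemma normal_of_parallel S q nu (A : 'M[R]_d) (C t : R) (u : V) :
  hypersurface S -> S q -> unit_normal S q nu -> shape_at S q nu A ->
  (forall w : V, enorm (w *m A) <= C * enorm (w *m A *m A)) -> 0 < C -> C < t ->
  (exists2 rho : R, 0 < rho & forall e : R, 0 < e -> exists2 r : R, 0 < r &
    forall x n, S x -> unit_normal S x n -> enorm (x - q) < rho -> enorm (n - nu) < 1 ->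
      enorm (x + t *: n - (q + t *: nu)) < r ->
      dot (x + t *: n - (q + t *: nu)) u <= e * enorm (x + t *: n - (q + t *: nu))) ->
  u = dot u nu *: nu.
Proof.
move=> hS Sq un sA hC C0 Ct [rho rho0 hu]; have [AT nA _] := sA.
have t0 : 0 < t by lra.
have le0 a : dot a nu = 0 -> dot (a + t *: (a *m A)) u <= 0.
  move=> an; set b := a + _.
  apply: (@le0_eps _ (enorm b + (1 + t) + (1 + t) * enorm u)).
    by rewrite !addr_ge0 ?mulr_ge0 ?enorm_ge0//; lra.
  move=> e e0 e1.
  have [r r0 hr] := hu e e0.
  have [|s [x [n [s0 [Sx ux xr nn] _ zr [zb zle]]]]] :=
    parallel_curve hS Sq un sA an t0 e0 e1 (rho := Num.min rho r); first by rewrite lt_min rho0.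
  move: zr zb zle xr; rewrite -/b !lt_min; set z := x + _ - _ => /andP[_ zr] zb zle /andP[xrho _].
  have := hr x n Sx ux xrho nn zr; rewrite -/z => hz.
  have cs := ler_norm (- dot (z - s *: b) u); rewrite normrN in cs.
  have cs2 := le_trans cs (cauchy_schwarz (z - s *: b) u).
  rewrite dotDl dotNl dotZl in cs2.
  have h3 : e * enorm z <= e * (s * (enorm b + (1 + t))) by rewrite ler_pM2l.
  have h4 : enorm (z - s *: b) * enorm u <= e * (1 + t) * s * enorm u.
    by rewrite ler_wpM2r ?enorm_ge0.
  rewrite -(ler_pM2l s0); move: cs2 h3 h4 hz; clear; lra.
pose w := u + t *: (u *m A).
have wE : w = dot w nu *: nu.
  pose a := w - dot w nu *: nu.
  have an : dot a nu = 0 by rewrite dotDl dotNl dotZl un.2 mulr1 subrr.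
  apply/eqP; rewrite -subr_eq0 -/a -dot_eq0 eq_le dot_ge0 andbT.
  have := le0 a an.
  have -> : dot (a + t *: (a *m A)) u = dot a w.
    by rewrite dotDl dotZl dot_mxr AT /w dotDr dotZr.
  suff -> : dot a a = dot a w by [].
  by transitivity (dot a (w - dot w nu *: nu)) => //; rewrite dotDr dotNr dotZr an mulr0 subr0.
have : w *m A = 0 by rewrite wE -scalemxAl nA scaler0.
rewrite /w mulmxDl -scalemxAl => /eqP; rewrite addr_eq0 => /eqP uA.
have uAA0 : enorm (u *m A *m A) = 0.
  have := hC u; rewrite {1}uA enormN enormZ (gtr0_norm t0) -subr_ge0 -mulrBl.
  have := enorm_ge0 (u *m A *m A); move: (enorm _) => X; clear -Ct; nra.
have uA0 : u *m A = 0.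
  apply/eqP; rewrite -enorm_eq0 eq_le enorm_ge0 andbT.
  by have := hC u; rewrite uAA0 mulr0.
by move: wE; rewrite /w uA0 scaler0 addr0.
Qed.

End FirstOrder.

Section Halfspace.
Context {R : realType} {d : nat} (G : set ('rV[R]_d -> 'rV[R]_d)) (p0 : 'rV[R]_d).
Context (hG : isometry_group G).
Local Notation V := 'rV[R]_d.
Local Notation e_ := (@basis_vec R d).
Local Notation O := (isom_orbit G p0).
Context (hO : hypersurface O).

Lemma dot_split (y x z n : V) : dot (x - z) n = dot (x - y) n + dot (y - z) n.
Proof. by rewrite -dotDl addrA subrK. Qed.

Lemma frobenius (A : 'M[R]_d) : \tr (A *m A^T) = \sum_i enorm (e_ i *m A) ^+ 2.
Proof.
apply: eq_bigr => i _; rewrite sqr_enorm dot_mxr -mulmxA -rowE -[RHS]/(\sum_k _).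
rewrite (bigD1 i)//= big1 ?addr0 => [|k ki].
  by rewrite basis_vecE eqxx mul1r !mxE.
by rewrite basis_vecE eq_sym (negbTE ki) mul0r.
Qed.

(** All shape operators of the orbit are conjugate up to the sign that depends on
    the choice of the normals. *)
Lemma shape_move q n q' n' (A : 'M[R]_d) : O q -> O q' -> unit_normal O q n ->
  unit_normal O q' n' -> shape_at O q n A ->
  exists (L : 'M[R]_d) (s : R), [/\ L *m L^T = 1%:M, L^T *m L = 1%:M, s ^+ 2 = 1 &
    shape_at O q' n' (s *: (L^T *m A *m L))].
Proof.
move=> Oq Oq' un un' sA; have [g Gg gq] := orbit_trans hG Oq Oq'.
have ig := G_isometry hG Gg.
have sg := shape_transport hG Gg sA; rewrite gq in sg.
have ug := unit_normal_transport hG Gg un; rewrite gq in ug.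
have [h|h] := unit_normal_pm hO Oq' ug un'.
  exists (lin g), 1; rewrite scale1r h expr1n; split => //; first exact: lin_orthogonal.
  exact: lin_orthogonal'.
exists (lin g), (-1); rewrite scaleN1r h sqrrN expr1n; split; last exact: shapeN.
- exact: lin_orthogonal.
- exact: lin_orthogonal'.
- by [].
Qed.

Lemma bounded_below_move (A L : 'M[R]_d) (s C : R) :
  (forall w : V, enorm (w *m A) <= C * enorm (w *m A *m A)) -> L *m L^T = 1%:M ->
  s ^+ 2 = 1 -> let B := s *: (L^T *m A *m L) in
  forall w : V, enorm (w *m B) <= C * enorm (w *m B *m B).
Proof.
move=> hA LL s2 B w.
have nL (x : V) : enorm (x *m L) = enorm x by rewrite /enorm dot_mxr -mulmxA LL mulmx1.
have -> : w *m B *m B = w *m L^T *m A *m A *m L.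
  rewrite /B -!scalemxAr -scalemxAl scalerA -expr2 s2 scale1r.
  by rewrite !mulmxA -[w *m _ *m _ *m L *m L^T]mulmxA LL mulmx1.
have s1 : `|s| = 1 by apply/eqP; rewrite -sqrp_eq1// real_normK ?num_real// s2.
by rewrite /B -scalemxAr enormZ s1 mul1r !mulmxA !nL.
Qed.

Lemma displacement_close (x x' m m' : V) (t r : R) : 0 < t ->
  enorm (x' - x) < r / (1 + t) -> enorm (m' - m) < r / (1 + t) ->
  enorm (x' + t *: m' - (x + t *: m)) < r.
Proof.
move=> t0; have t1 : 0 < 1 + t by lra.
rewrite !ltr_pdivlMr// => xr mr.
have -> : x' + t *: m' - (x + t *: m) = (x' - x) + t *: (m' - m).
  by apply/rowP => i; rewrite !mxE; ring.
apply: le_lt_trans (enormD _ _) _; rewrite enormZ (gtr0_norm t0) -(ltr_pM2r t1).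
have : t * (enorm (m' - m) * (1 + t)) < t * r by rewrite ltr_pM2l.
lra.
Qed.

(** If a point on the normal at [q] is on the orbit, so are the corresponding
    points on the nearby normals, because the orbit is closed. *)
Lemma parallel_orbit_near q n (t : R) : 0 < t -> O q -> unit_normal O q n -> O (q + t *: n) ->
  exists2 r : R, 0 < r & forall x m, O x -> enorm (x - q) < r -> unit_normal O x m ->
    enorm (m - n) < 1 -> O (x + t *: m).
Proof.
move=> t0 Oq un Oqt.
apply: (@normal_propagation R d G p0 hG hO (fun x n => O (x + t *: n)) q n _ _ Oq un Oqt).
- move=> x m nx.
  have [r r0 hr] : exists2 r : R, 0 < r & forall y, enorm (y - (x + t *: m)) < r -> ~ O y.
    apply: contrapT => no; apply: nx; apply: (orbit_closed hG hO) => e e0.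
    apply: contrapT => no'; apply: no; exists e => // y ye Oy; apply: no'; by exists y.
  exists (r / (1 + t)); first by rewrite divr_gt0//; lra.
  by move=> x' m' xr mr; apply: hr; exact: displacement_close.
- move=> g x m Gg; have ig := G_isometry hG Gg.
  by move=> /(orbit_G hG Gg); rewrite isometry_add// -scalemxAl.
Qed.

Lemma parallel_orbit_normal p nu (A : 'M[R]_d) (C t : R) q n :
  O p -> unit_normal O p nu -> shape_at O p nu A ->
  (forall w : V, enorm (w *m A) <= C * enorm (w *m A *m A)) -> 0 < C -> C < t ->
  O q -> unit_normal O q n -> O (q + t *: n) -> unit_normal O (q + t *: n) n.
Proof.
move=> Op unp sA hC C0 Ct Oq un Oqt.
have t0 : 0 < t := lt_trans C0 Ct.
have [L [s [LL _ s2 sB]]] := shape_move Op Oq unp un sA.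
have hB := bounded_below_move hC LL s2; move: (s *: _) sB hB => B sB hB {L s LL s2}.
have [n' un'] := normal_exists hO Oqt.
have [rho rho0 h] := parallel_orbit_near t0 Oq un Oqt.
have nE : n' = dot n' n *: n.
  apply: (normal_of_parallel hO Oq un sB hB C0 Ct); exists rho => // e e0.
  have [r r0 hr] := un'.1 e e0; exists r => // x m Ox um xrho mn zr.
  by apply: hr => //; exact: h.
have c2 : dot n' n ^+ 2 = 1.
  have : dot (dot n' n *: n) (dot n' n *: n) = 1 by rewrite -nE un'.2.
  by rewrite dotZl dotZr un.2 mulr1 expr2.
split; last exact: un.2.
have nE2 : n = (dot n' n) *: n' by rewrite {2}nE scalerA -expr2 c2 scale1r.
by rewrite [X in normal_at _ _ X]nE2; apply: normal_scale => //; exact: un'.1.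
Qed.

(** Far out on the normal line through [p], at [y], the nearest point [p'] of the
    orbit lies on that line again: the ball around [y] that misses the orbit can
    be moved along with [p], so [p'] is a nearest point to first order for the
    whole parallel hypersurface. Thus [p' = p + t' nu] with [t'] large, and near
    [p'] the orbit is the parallel hypersurface of itself at distance [t']. Its
    shape operator [A1] satisfies [A = A1 + t' A A1], which makes it smaller than
    [A]; but it is also conjugate to [A] up to sign. *)
Lemma cobounded_flat p nu (A : 'M[R]_d) (D : R) :
  O p -> unit_normal O p nu -> shape_at O p nu A ->
  (forall y : V, exists2 q, O q & enorm (y - q) <= D) -> A = 0.
Proof.
move=> Op un sA cob; have [AT nA hA] := sA.
have [C C0 hC] := symmetric_bounded_below AT.
have D0 : 0 <= D by have [q _] := cob 0; apply: le_trans; exact: enorm_ge0.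
pose t := 3 * C + D; have Ct : C < t by rewrite /t; lra.
have t0 : 0 < t by lra.
pose y := p + t *: nu; have [p' fp'] := foot_exists hG hO y; have [Op' minp'] := fp'.
pose s := enorm (y - p').
have sD : s <= D by have [q Oq qD] := cob y; apply: le_trans qD; exact: minp'.
have [||rho rho0 h] := @normal_propagation R d G p0 hG hO
    (fun x n => forall z, O z -> s <= enorm (x + t *: n - z)) p nu _ _ Op un minp'.
- move=> x n /existsNP[z /not_implyP[Oz /negP]]; rewrite -ltNge => zs.
  exists ((s - enorm (x + t *: n - z)) / (1 + t)); first by rewrite divr_gt0 ?subr_gt0//; lra.
  move=> x' n' xr nr /(_ z Oz); have := displacement_close t0 xr nr.
  by have := enorm_dist (x' + t *: n') (x + t *: n) z; lra.
- move=> g x n Gg h z Oz; have ig := G_isometry hG Gg.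
  have [k [Gk gk kg _]] := G_inverse hG Gg.
  rewrite scalemxAl -isometry_add// -(kg z) isometry_enorm//.
  by apply: h; exact: orbit_G.
have uE : p' - y = dot (p' - y) nu *: nu.
  apply: (normal_of_parallel hO Op un sA hC C0 Ct); exists rho => // e e0.
  exists (2 * e) => [|x n Ox ux xrho nn]; first by rewrite mulr_gt0.
  rewrite -/y; move: (h x n Ox xrho ux nn p' Op'); rewrite /s.
  move: (x + _) => z; have -> : z - p' = (z - y) - (p' - y) by rewrite opprB addrA subrK.
  have -> : y - p' = - (p' - y) by rewrite opprB.
  rewrite enormN; move: (z - y) (p' - y) => v u.
  rewrite -(ler_pXn2r (_ : (0 < 2)%N)) ?nnegrE ?enorm_ge0// !sqr_enorm.
  rewrite !dotDl !dotDr !dotNl !dotNr (dotC u v) -(sqr_enorm v) => h1 h2.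
  have : enorm v * enorm v <= enorm v * (2 * e) by rewrite ler_wpM2l ?enorm_ge0// ltW.
  by move: h1; rewrite expr2; lra.
pose t' := t + dot (p' - y) nu.
have p'E : p' = p + t' *: nu.
  by rewrite scalerDl -uE addrA -/y addrCA subrr addr0.
have t'C : 3 * C <= t'.
  have : `|dot (p' - y) nu| <= D.
    by apply: le_trans sD; rewrite /s -enormB uE enormZ (enorm1 un.2) mulr1 dotZl un.2 mulr1.
  by rewrite ler_norml /t' /t; lra.
have Ct' : C < t' by lra.
have t'0 : 0 < t' by lra.
have un' : unit_normal O p' nu.
  by rewrite p'E; apply: (parallel_orbit_normal Op un sA hC C0 Ct' Op un); rewrite -p'E.
have [L [sg [LL LL' s2 sA1]]] := shape_move Op Op' un un' sA.
have [A1 A1E] : exists A1, A1 = sg *: (L^T *m A *m L) by exists (sg *: (L^T *m A *m L)).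
rewrite -A1E in sA1; have [A1T nA1 hA1] := sA1.
have key a : dot a nu = 0 -> a *m A = (a + t' *: (a *m A)) *m A1.
  move=> an; set b := a + _; apply/eqP; rewrite -subr_eq0 -enorm_eq0 eq_le enorm_ge0 andbT.
  have [K K0 hK] := mulmx_bounded A1.
  apply: (@le0_eps _ _ (1 + K * (1 + t') + (enorm b + (1 + t')))).
    have : 0 <= K * (1 + t') by rewrite mulr_ge0//; lra.
    by have := enorm_ge0 b; lra.
  move=> e e0 e1.
  have [rho1 rho10 h1] := parallel_orbit_near t'0 Op un (ltac:(by rewrite -p'E)).
  have [r r0 hr] := hA1 e e0.
  have [|sg' [x [n [sg0 [Ox ux xr nn] na zr [zb zle]]]]] :=
    parallel_curve hO Op un sA an t'0 e0 e1 (rho := Num.min rho1 r); first by rewrite lt_min rho10.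
  move: zr zb zle xr; rewrite -/b -p'E !lt_min; set z := x + _ - _ => /andP[_ zr] zb zle /andP[xr _].
  have Oz : O (x + t' *: n) by exact: h1.
  have uz := parallel_orbit_normal Op un sA hC C0 Ct' Ox ux Oz.
  have := hr _ n Oz zr uz nn; rewrite -/z => hz.
  rewrite -(ler_pM2l sg0) -{1}(gtr0_norm sg0) -enormZ.
  have -> : sg' *: (a *m A - b *m A1) =
    - (n - nu - sg' *: (a *m A)) + ((n - nu - z *m A1) + (z - sg' *: b) *m A1).
    rewrite (mulmxBl z (sg' *: b) A1) -scalemxAl; move: (z *m A1) (b *m A1) (a *m A) => u1 u2 u3.
    by apply/rowP => i; rewrite !mxE; ring.
  apply: le_trans (enormD _ _) _; rewrite enormN.
  have := enormD (n - nu - z *m A1) ((z - sg' *: b) *m A1).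
  have := hK (z - sg' *: b).
  have : K * enorm (z - sg' *: b) <= K * (e * (1 + t') * sg') by rewrite ler_pM2l.
  have : e * enorm z <= e * (sg' * (enorm b + (1 + t'))) by rewrite ler_pM2l.
  move: na hz; clear.
  move: (enorm (n - nu - _ *: _)) (enorm (n - nu - z *m A1)) (enorm ((z - _) *m A1)) (enorm (_ + _ *m A1)) (enorm (z - _)) (enorm z) (enorm b) => X1 X2 X3 X4 X5 X6 X7.
  lra.
have AE : A = A1 + t' *: (A *m A1).
  apply/row_matrixP => i; rewrite !rowE.
  pose a := e_ i - dot (e_ i) nu *: nu.
  have aA (B : 'M[R]_d) : nu *m B = 0 -> a *m B = e_ i *m B by move=> nB; rewrite mulmxBl -scalemxAl nB scaler0 subr0.
  have an : dot a nu = 0 by rewrite dotDl dotNl dotZl un.2 mulr1 subrr.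
  have := key a an; rewrite (mulmxDl a) -scalemxAl (aA _ nA) (aA _ nA1) => ->.
  by rewrite -[delta_mx 0 i]/(e_ i) (mulmxDr (e_ i)) -scalemxAr [in RHS]mulmxA.
have AE' : A = A1 + t' *: (A1 *m A).
  by have := congr1 trmx AE; rewrite linearD linearZ /= trmx_mul AT A1T.
have small (w : V) : 2 * enorm (w *m A1) <= enorm (w *m A).
  pose x := w - t' *: (w *m A1).
  have wA1 : w *m A1 = x *m A.
    rewrite mulmxBl -scalemxAl {1}AE' mulmxDr -scalemxAr mulmxA addrK//.
  have := hC x; rewrite -wA1 => h1.
  have h2 : t' * enorm (w *m A1 *m A) <= enorm (w *m A) + enorm (w *m A1).
    rewrite -[t'](gtr0_norm t'0) -enormZ.
    have -> : t' *: (w *m A1 *m A) = w *m A - w *m A1.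
      by rewrite [in X in _ = X - _]AE' mulmxDr addrAC subrr add0r -scalemxAr mulmxA.
    by apply: le_trans (enormD _ _) _; rewrite enormN.
  have h3 : t' * enorm (w *m A1) <= C * (t' * enorm (w *m A1 *m A)).
    by rewrite mulrCA ler_pM2l.
  have h4 : C * (t' * enorm (w *m A1 *m A)) <= C * (enorm (w *m A) + enorm (w *m A1)).
    by rewrite ler_pM2l.
  have h5 : 3 * C * enorm (w *m A1) <= t' * enorm (w *m A1) by rewrite ler_wpM2r ?enorm_ge0.
  by rewrite -(ler_pM2l C0); lra.
have tr1 : \tr (A1 *m A1^T) = \tr (A *m A^T).
  rewrite A1T AT A1E -scalemxAl -scalemxAr scalerA -expr2 s2 scale1r.
  by rewrite !mulmxA -[_ *m L *m L^T]mulmxA LL mulmx1 mxtrace_mulC !mulmxA LL mul1mx.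
have le1 : 4 * \tr (A1 *m A1^T) <= \tr (A *m A^T).
  rewrite !frobenius mulr_sumr; apply: ler_sum => i _.
  have := small (e_ i); have := enorm_ge0 (e_ i *m A1).
  by move: (enorm _) (enorm _) => X Y; nra.
have : \tr (A *m A^T) <= 0 by lra.
rewrite frobenius => tr0.
have /eqP : \sum_i enorm (e_ i *m A) ^+ 2 == 0.
  by rewrite eq_le tr0/= sumr_ge0// => i _; exact: sqr_ge0.
move=> /eqP; rewrite psumr_eq0 => [/allP z|i _]; last exact: sqr_ge0.
apply/row_matrixP => i; rewrite row0 rowE; apply/eqP.
by have := z i (mem_index_enum i); rewrite /= expf_eq0 enorm_eq0.
Qed.

(** Zero shape operators make the normal locally constant, and then the height
    over the tangent hyperplane as well. *)
Lemma flat_orbit_in_plane p nu : connected O -> O p -> unit_normal O p nu ->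
  shape_at O p nu 0 -> forall x, O x -> dot (x - p) nu = 0.
Proof.
move=> cO Op un s0.
have s0' q n : O q -> unit_normal O q n -> shape_at O q n 0.
  move=> Oq uq; have [L [s [_ _ _]]] := shape_move Op Oq un uq s0.
  by rewrite mulmx0 mul0mx scaler0.
have loc q n : O q -> unit_normal O q n -> exists2 r : R, 0 < r &
    forall x, O x -> enorm (x - q) < r -> unit_normal O x n /\ dot (x - q) n = 0.
  move=> Oq uq; have [N [r r0 [Nq hN]]] := normal_field hO Oq uq.
  have [r1 r10 h1] := flat_locally_constant hO Oq r0.
  have Nn x : O x -> enorm (x - q) < Num.min r r1 -> N x = n.
    move=> Ox; rewrite lt_min => /andP[xr xr1]; apply/rowP => i; rewrite -Nq.
    apply: (h1 (fun x => N x 0 i)) => // y Oy yr e e0.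
    have [uy Ny _ cy] := hN y Oy yr.
    have [_ _ hy] := s0' y (N y) Oy uy.
    have [r2 r20 h2] := hy e e0; have [r3 r30 h3] := cy 1 ltr01.
    exists (Num.min (Num.min r2 r3) (r - enorm (y - q))); first by rewrite !lt_min r20 r30 subr_gt0.
    move=> z Oz; rewrite !lt_min => /andP[/andP[z2 z3] zr].
    have zq : enorm (z - q) < r by have := enorm_dist z y q; lra.
    have [uz _ _ _] := hN z Oz zq.
    have := h2 z (N z) Oz z2 uz (h3 z z3); rewrite mulmx0 subr0; apply: le_trans.
    apply: le_trans (norm_le_enorm _); apply: le_trans (coord_le _ i).
    by rewrite !mxE.
  have r2 : 0 < Num.min r r1 by rewrite lt_min r0.
  have un' x : O x -> enorm (x - q) < Num.min r r1 -> unit_normal O x n.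
    move=> Ox xr; rewrite -(Nn x Ox xr).
    by move: xr; rewrite lt_min => /andP[xr _]; have [] := hN x Ox xr.
  have [r3 r30 h3] := flat_locally_constant hO Oq r2.
  exists (Num.min (Num.min r r1) r3); first by rewrite lt_min r2.
  move=> x Ox; rewrite lt_min => /andP[xr xr3]; split; first exact: un'.
  rewrite (h3 (fun x => dot (x - q) n))// ?subrr ?dot0l// => y Oy yr e e0.
  have [r4 r40 h4] := (un' y Oy yr).1 e e0.
  have [r5 r50 h5] := (unit_normalN hO Oy (un' y Oy yr)).1 e e0.
  exists (Num.min r4 r5); first by rewrite lt_min r40.
  move=> z Oz; rewrite lt_min => /andP[z4 z5].
  have -> : dot (z - q) n - dot (y - q) n = dot (z - y) n by rewrite !dotDl !dotNl; ring.
  rewrite ler_norml.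
  have := h4 z Oz z4; have := h5 z Oz z5; rewrite dotNr; lra.
suff H x : O x -> unit_normal O x nu /\ dot (x - p) nu = 0 by move=> x /H[].
move: x; apply: (@connected_induction _ _ _ p) => //.
- by rewrite subrr dot0l.
- move=> x Ox [ux xp]; have [r r0 hr] := loc x nu Ox ux.
  apply/nbhs_enormP; exists r => // y yr Oy; have [uy yx] := hr y Oy yr; split => //.
  by rewrite (dot_split x) yx xp addr0.
move=> x Ox nx; have [n ux] := normal_exists hO Ox; have [r r0 hr] := loc x n Ox ux.
apply/nbhs_enormP; exists r => // y yr Oy [uy yp]; apply: nx.
have [uy' yx] := hr y Oy yr.
have [nE|nE] := unit_normal_pm hO Oy uy' uy; rewrite nE in yp *.
  by split => //; move: yp; rewrite (dot_split x) yx add0r.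
split; first exact: unit_normalN.
by move: yp; rewrite (dot_split x) dotNr yx oppr0 add0r.
Qed.

(** Unless the orbit is planar, some points are arbitrarily far from it, and
    moving their feet to [p] yields arbitrarily large balls that touch the orbit
    at [p]. Points of the orbit strictly on either side of the tangent hyperplane
    would bound the size of the balls on both sides. *)
Lemma orbit_halfspace p : connected O -> O p ->
  exists n, unit_normal O p n /\ forall x, O x -> dot (x - p) n <= 0.
Proof.
move=> cO Op; have [nu un] := normal_exists hO Op.
have [A sA] := shape_exists hO Op un.
have [A0|A0] := pselect (A = 0).
  rewrite A0 in sA; exists nu; split => // x Ox.
  by rewrite (flat_orbit_in_plane cO Op un sA Ox).
have far (D : R) : 0 < D -> exists n, unit_normal O p n /\
    exists2 s, D < s & forall x, O x -> 2 * s * dot (x - p) n <= dot (x - p) (x - p).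
  move=> D0.
  have [y ny] : exists y : V, forall q, O q -> D < enorm (y - q).
    apply: contrapT => no; apply: A0; apply: (@cobounded_flat p nu A D) => // y.
    apply: contrapT => no'; apply: no; exists y => q Oq.
    by rewrite ltNge; apply/negP => yq; apply: no'; exists q.
  have [q fq] := foot_exists hG hO y; have [Oq qm] := fq.
  pose s := enorm (y - q); have Ds : D < s by exact: ny.
  have s0 : 0 < s by lra.
  have uq : unit_normal O q (s^-1 *: (y - q)).
    split; first exact/normal_scale/foot_normal.
    by rewrite dotZl dotZr -sqr_enorm -/s; field; rewrite gt_eqF.
  have [g Gg gq] := orbit_trans hG Oq Op; have ig := G_isometry hG Gg.
  have ug := unit_normal_transport hG Gg uq; rewrite gq in ug.
  exists (s^-1 *: (y - q) *m lin g); split => //; exists s => // x Ox.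
  have [h [Gh gh hg _]] := G_inverse hG Gg.
  have := qm _ (orbit_G hG Gh Ox); rewrite -/s.
  have -> : enorm (y - h x) = enorm (s *: (s^-1 *: (y - q) *m lin g) - (x - p)).
    rewrite -scalemxAl scalerA divff ?gt_eqF// scale1r -isometry_affine// gq.
    by rewrite opprB addrA subrK -{2}(hg x) isometry_enorm.
  move=> sle; have := ler_pM (ltW s0) (ltW s0) sle sle; rewrite -[X in _ <= X]expr2 sqr_enorm.
  move: (ug.2); move: (_ *m lin g) (x - p) => n v n1.
  rewrite !dotDl !dotDr !dotNl !dotNr !dotZl !dotZr n1 (dotC n v); lra.
apply: contrapT => no.
have bad n : unit_normal O p n -> exists2 x, O x & 0 < dot (x - p) n.
  move=> unn; apply: contrapT => nx; apply: no; exists n; split => // x Ox.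
  by rewrite leNgt; apply/negP => h; apply: nx; exists x.
have [x1 Ox1 h1] := bad nu un; have [x2 Ox2 h2] := bad (- nu) (unit_normalN hO Op un).
pose D1 := dot (x1 - p) (x1 - p) / dot (x1 - p) nu.
pose D2 := dot (x2 - p) (x2 - p) / dot (x2 - p) (- nu).
have D10 : 0 <= D1 by rewrite divr_ge0 ?dot_ge0 ?ltW.
have D20 : 0 <= D2 by rewrite divr_ge0 ?dot_ge0 ?ltW.
have E1 : dot (x1 - p) (x1 - p) = D1 * dot (x1 - p) nu by rewrite /D1 divfK// gt_eqF.
have E2 : dot (x2 - p) (x2 - p) = D2 * dot (x2 - p) (- nu) by rewrite /D2 divfK// gt_eqF.
have [|n [unn [s Ds hs]]] := far (D1 + D2 + 1); first lra.
have [nE|nE] := unit_normal_pm hO Op un unn; rewrite nE in hs.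
  have := hs x1 Ox1; rewrite E1 ler_pM2r//; lra.
have := hs x2 Ox2; rewrite E2 ler_pM2r//; lra.
Qed.

End Halfspace.

(** * Curved orbits *)

Section Convex.
Context {R : realType} {d : nat} (G : set ('rV[R]_d -> 'rV[R]_d)) (p : 'rV[R]_d).
Context (hG : isometry_group G).
Local Notation V := 'rV[R]_d.
Local Notation e_ := (@basis_vec R d).
Local Notation O := (isom_orbit G p).
Context (hO : hypersurface O).

(** Normals that point away from the half-space containing the orbit. *)
Definition outward (q n : V) := [/\ O q, unit_normal O q n & forall x, O x -> dot (x - q) n <= 0].

Context (nu : V) (Knu : outward p nu) (NP : ~ forall x, O x -> dot (x - p) nu = 0).

Lemma outward_G g q n : G g -> outward q n -> outward (g q) (n *m lin g).
Proof.
move=> Gg [Oq un h]; have ig := G_isometry hG Gg.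
split; [exact: orbit_G|exact: unit_normal_transport|move=> x Ox].
have [k [Gk gk kg _]] := G_inverse hG Gg.
by rewrite -(kg x) isometry_affine// dot_lin//; apply: h; exact: orbit_G.
Qed.

(** The other normal at [q] is not outward, since the orbit is not planar. *)
Lemma outward_move q n : outward q n -> exists g, [/\ G g, g p = q & n = nu *m lin g].
Proof.
move=> Kq; have [Oq un hq] := Kq; have [Op unp hp] := Knu.
have [g Gg gp] := orbit_trans hG Op Oq; have ig := G_isometry hG Gg.
have [_ ug hg] := outward_G Gg Knu; rewrite gp in ug hg.
exists g; split => //; have [//|nE] := unit_normal_pm hO Oq ug un.
exfalso; apply: NP => x Ox; apply/eqP; rewrite eq_le hp//=.
have := hq (g x) (orbit_G hG Gg Ox).
by rewrite nE dotNr -{1}gp isometry_affine// dot_lin// oppr_le0.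
Qed.

Lemma outward_exists q : O q -> exists n, outward q n.
Proof.
move=> Oq; have [Op _ _] := Knu; have [g Gg gp] := orbit_trans hG Op Oq.
by exists (nu *m lin g); rewrite -gp; exact: outward_G.
Qed.

Definition outer y := exists q n (s : R), [/\ outward q n, 0 < s & y = q + s *: n].

(** The last condition says that [q] is a nearest point; for outer points this is
    automatic because the orbit lies in a half-space. *)
Definition inner y := exists q n (s : R),
  [/\ outward q n, 0 < s, y = q - s *: n & forall x, O x -> s <= enorm (y - x)].

Lemma side y : ~ O y -> inner y \/ outer y.
Proof.
move=> nOy; have [q fq] := foot_exists hG hO y; have [Oq qm] := fq.
have [n Kq] := outward_exists Oq; have [_ un _] := Kq.
have := normal_parallel hO Oq un (foot_normal fq); set c := dot _ n => yE.
have yE' : y = q + c *: n by rewrite -yE addrCA subrr addr0.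
have yc : enorm (y - q) = `|c| by rewrite yE enormZ (enorm1 un.2) mulr1.
have [c0|c0|c0] := ltgtP c 0.
- left; exists q, n, (- c); split => //; first lra.
    by rewrite scaleNr opprK.
  by move=> x Ox; rewrite -(ltr0_norm c0) -yc; exact: qm.
- by right; exists q, n, c.
- by exfalso; apply: nOy; rewrite yE' c0 scale0r addr0.
Qed.

Lemma outer_far q n (s : R) x : outward q n -> 0 <= s -> O x ->
  enorm (x - q) ^+ 2 + s ^+ 2 <= enorm (q + s *: n - x) ^+ 2.
Proof.
move=> [_ un h] s0 Ox; have := h x Ox.
have -> : q + s *: n - x = s *: n - (x - q) by apply/rowP => i; rewrite !mxE; ring.
move: (x - q) (un.2) => v n1 vn; rewrite !sqr_enorm.
rewrite !dotDl !dotDr !dotNl !dotNr !dotZl !dotZr n1 (dotC n v).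
have : s * dot v n <= 0 by rewrite mulr_ge0_le0.
by rewrite expr2; lra.
Qed.

(** Points on opposite sides of the orbit that are close to each other but not to
    the orbit have almost the same foot and almost opposite outward normals, so
    that the orbit is squeezed into a thin slab. *)
Lemma sides_apart y : ~ O y -> exists2 r : R, 0 < r & forall y1 y2,
  enorm (y1 - y) < r -> enorm (y2 - y) < r -> inner y1 -> outer y2 -> False.
Proof.
move=> nOy; apply: contrapT => no; apply: NP => x Ox.
have [_ _ hp] := Knu; apply/eqP; rewrite eq_le hp//= -oppr_le0.
have [q0 [Oq0 qm]] := foot_exists hG hO y.
pose S := enorm (y - q0).
have S0 : 0 < S.
  rewrite enorm_gt0 subr_eq0; apply/eqP => yq; apply: nOy; by rewrite yq.
pose rho := enorm (x - p); have rho0 : 0 <= rho by exact: enorm_ge0.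
apply: (@le0_eps _ _ ((2 / S) * (2 * rho + (2 * S + 1)))).
  by rewrite mulr_ge0 ?divr_ge0//; lra.
move=> e e0 e1.
have e2 : 0 < e ^+ 2 by rewrite exprn_gt0.
have e2e : e ^+ 2 <= e by rewrite expr2 ler_piMr// ltW.
pose r := Num.min (S / 2) (e ^+ 2 / (8 * (2 * S + 1))).
have r0 : 0 < r by rewrite lt_min !divr_gt0//; lra.
have [rS re] : r <= S / 2 /\ r <= e ^+ 2 / (8 * (2 * S + 1)) by rewrite /r !ge_min !lexx orbT.
have re' : 8 * (r * (2 * S + 1)) <= e ^+ 2.
  by move: re; rewrite ler_pdivlMr; [lra|rewrite mulr_gt0//; lra].
have [y1 [y2 [y1r y2r [q' [n' [s' [K' s'0 y1E y1m]]]] [q [n [s [Kq s0 y2E]]]]]]] :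
    exists y1 y2, [/\ enorm (y1 - y) < r, enorm (y2 - y) < r, inner y1 & outer y2].
  apply: contrapT => no'; apply: no; exists r => // y1 y2 h1 h2 h3 h4.
  by apply: no'; exists y1, y2.
have [Oq un hq] := Kq; have [Oq' un' hq'] := K'.
have y12 : enorm (y2 - y1) <= 2 * r by have := enorm_dist y2 y y1; rewrite (enormB y y1); lra.
have y2q : enorm (y2 - q) = s by rewrite y2E addrAC subrr add0r enormZ (enorm1 un.2) mulr1 gtr0_norm.
have y1q' : enorm (y1 - q') = s'.
  by rewrite y1E addrAC subrr add0r enormN enormZ (enorm1 un'.2) mulr1 gtr0_norm.
have sS : S / 2 <= s.
  have := qm q Oq; rewrite -/S; have := enorm_dist y y2 q; rewrite (enormB y y2) y2q; lra.
have s's : s' <= s + 2 * r.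
  have := y1m q Oq; have := enorm_dist y1 y2 q; rewrite (enormB y1 y2) y2q; lra.
have sS2 : s <= 2 * S.
  have : s <= enorm (y2 - q0).
    rewrite -(ler_pXn2r (_ : (0 < 2)%N)) ?nnegrE ?enorm_ge0 ?(ltW s0)//.
    by have := outer_far Kq (ltW s0) Oq0; rewrite -y2E; have := sqr_ge0 (enorm (q0 - q)); lra.
  by have := enorm_dist y2 y q0; rewrite -/S; lra.
have y2q' : enorm (y2 - q') <= s + 4 * r.
  by have := enorm_dist y2 y1 q'; rewrite y1q'; lra.
have rS0 : 0 <= r * S by rewrite mulr_ge0// ltW.
have r8 : 8 * r <= e by lra.
(* The foot [q] of [y2] is nearer than [q'], by Pythagoras and convexity, but
   hardly so. *)
have del : enorm (q' - q) <= e.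
  rewrite -(ler_pXn2r (_ : (0 < 2)%N)) ?nnegrE ?enorm_ge0 ?(ltW e0)//.
  have := outer_far Kq (ltW s0) Oq'; rewrite -y2E.
  have : enorm (y2 - q') ^+ 2 <= (s + 4 * r) ^+ 2.
    by rewrite ler_pXn2r ?nnegrE ?enorm_ge0//; lra.
  have rr : r * (2 * r) <= r * 1 by rewrite ler_pM2l//; lra.
  have rs : r * s <= r * (2 * S) by rewrite ler_pM2l.
  move: (enorm (y2 - q') ^+ 2) (enorm (q' - q) ^+ 2) => X Y h1 h2.
  apply: le_trans re'; move: h1; rewrite sqrrD; lra.
have nn : enorm (s *: n + s' *: n') <= 2 * r + e.
  have -> : s *: n + s' *: n' = (y2 - y1) + (q' - q).
    by rewrite y2E y1E; apply/rowP => i; rewrite !mxE; ring.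
  by apply: le_trans (enormD _ _) _; lra.
have [g [Gg gp nE]] := outward_move Kq; have ig := G_isometry hG Gg.
have Ogx := orbit_G hG Gg Ox.
have xE : dot (x - p) nu = dot (g x - q) n by rewrite nE -gp isometry_affine// dot_lin.
have rhoE : enorm (g x - q) = rho by rewrite -gp isometry_enorm.
have b1 : dot (g x - q) n' <= e.
  rewrite (dot_split q'); have := hq' _ Ogx.
  have := le_trans (ler_norm _) (cauchy_schwarz (q' - q) n'); rewrite (enorm1 un'.2); lra.
have b2 : - (rho * (2 * r + e)) <= dot (g x - q) (s *: n + s' *: n').
  have := le_trans (ler_norm _) (cauchy_schwarz (- (g x - q)) (s *: n + s' *: n')).
  rewrite dotNl enormN rhoE.
  have : rho * enorm (s *: n + s' *: n') <= rho * (2 * r + e) by rewrite ler_wpM2l.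
  lra.
rewrite dotDr !dotZr in b2.
have s'3 : s' * dot (g x - q) n' <= (2 * S + 1) * e.
  apply: (@le_trans _ _ (s' * e)); first by rewrite ler_pM2l.
  by rewrite ler_pM2r//; lra.
rewrite xE; have -> : e * (2 / S * (2 * rho + (2 * S + 1))) = e * (2 * rho + (2 * S + 1)) * 2 / S.
  by field; rewrite gt_eqF.
rewrite ler_pdivlMr//; have := hq _ Ogx; move: (dot _ n) (dot _ n') b2 s'3 => D D' b2 s'3 D0.
have b3 : S / 2 * - D <= s * - D by rewrite ler_wpM2r// oppr_ge0.
have b4 : rho * (2 * r + e) <= rho * (2 * e) by rewrite ler_wpM2l//; lra.
lra.
Qed.

Lemma inner_not_outer y : ~ O y -> inner y -> outer y -> False.
Proof.
move=> nOy iy oy; have [r r0 h] := sides_apart nOy.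
by apply: (h y y); rewrite ?subrr ?enorm0.
Qed.

Lemma segment_inner (a b : V) : (forall t : R, 0 <= t <= 1 -> ~ O (a + t *: (b - a))) ->
  inner a -> inner b.
Proof.
move=> hab ia.
pose E := (fun t : R => a + t *: (b - a)) @` `[0, 1]%classic.
have cE : connected E by exact: segment_connected_rV.
have nE y : E y -> ~ O y.
  by move=> [t /=]; rewrite in_itv /= => t01 <-; exact: hab.
have Ea : E a by exists 0; rewrite /= ?in_itv /= ?lexx ?ler01// scale0r addr0.
have Eb : E b by exists 1; rewrite /= ?in_itv /= ?lexx ?ler01// scale1r addrCA subrr addr0.
apply: (connected_induction cE Ea ia) Eb => y Ey.
  move=> iy; have [r r0 h] := sides_apart (nE y Ey).
  apply/nbhs_enormP; exists r => // z zr Ez; have [//|oz] := side (nE z Ez).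
  by case: (h y z); rewrite ?subrr ?enorm0.
move=> niy; have [//|oy] := side (nE y Ey); have [r r0 h] := sides_apart (nE y Ey).
apply/nbhs_enormP; exists r => // z zr Ez iz.
by apply: (h z y); rewrite ?subrr ?enorm0.
Qed.

(** The open half-space beyond a tangent hyperplane does not meet the orbit and
    contains outer points, so it contains no inner ones. *)
Lemma inner_below w q n : inner w -> outward q n -> dot (w - q) n <= 0.
Proof.
move=> iw Kq; have [Oq un hq] := Kq; rewrite leNgt; apply/negP => wq.
have nO x : 0 < dot (x - q) n -> ~ O x by move=> xq /hq; rewrite leNgt xq.
have : inner (q + n).
  apply: segment_inner iw => t /andP[t0 t1]; apply: nO.
  have -> : w + t *: (q + n - w) - q = (1 - t) *: (w - q) + t *: n.
    by apply/rowP => i; rewrite !mxE; ring.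
  rewrite dotDl !dotZl un.2 mulr1.
  have [t1'|t1'] := ltP t 1; last by have := mulr_ge0 (_ : 0 <= 1 - t) (ltW wq); nra.
  by rewrite ltr_wpDr// mulr_gt0//; lra.
move=> iq; apply: (inner_not_outer _ iq).
  by apply: nO; rewrite addrAC subrr add0r un.2.
by exists q, n, 1; rewrite scale1r.
Qed.

(** A ball that touches the orbit from inside consists of inner points, hence lies
    below all tangent hyperplanes. *)
Lemma depth (s : R) : 0 <= s -> (forall x, O x -> s <= enorm (p - s *: nu - x)) ->
  forall q n, outward q n -> s <= dot (q - (p - s *: nu)) n.
Proof.
move=> s0 hs q n Kq; have [Oq un hq] := Kq; have [Op _ _] := Knu.
have [s1|s1] := ltP 0 s; last first.
  have -> : s = 0 by lra.
  by rewrite scale0r subr0 -opprB dotNl oppr_ge0; exact: hq.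
set y := p - s *: nu; rewrite leNgt; apply/negP => Ds.
have iy : inner y by exists p, nu, s.
have iv v : enorm v < s -> inner (y + v).
  move=> vs; apply: segment_inner iy => t /andP[t0 t1] /hs.
  rewrite -/y opprD addrA subrr sub0r enormN addrAC subrr add0r enormZ ger0_norm// leNgt => /negP; apply.
  by apply: le_lt_trans vs; rewrite ler_piMl// enorm_ge0.
have below (t : R) : 0 <= t < s -> t <= dot (q - y) n.
  move=> /andP[t0 ts]; have := inner_below (iv (t *: n) _) Kq.
  rewrite enormZ (enorm1 un.2) mulr1 ger0_norm// => /(_ ts).
  by rewrite (dot_split y) (addrAC y) subrr add0r dotZl un.2 mulr1 -(opprB q y) dotNl; lra.
have := below 0; rewrite lexx s1 => /(_ isT) D0.
have := below ((dot (q - y) n + s) / 2); lra.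
Qed.

Lemma depth_cond (s : R) x : 0 <= s ->
  (s <= enorm (p - s *: nu - x)) = (0 <= dot (x - p) (x - p) + 2 * s * dot (x - p) nu).
Proof.
move=> s0; have [_ un _] := Knu.
rewrite -(ler_pXn2r (_ : (0 < 2)%N)) ?nnegrE ?enorm_ge0// sqr_enorm.
have -> : p - s *: nu - x = - ((x - p) + s *: nu) by apply/rowP => i; rewrite !mxE; ring.
move: (x - p) (un.2) => v n1.
rewrite dotNl dotNr !dotDl !dotDr !dotZl !dotZr n1 (dotC nu v) opprK expr2 -subr_ge0.
congr (0 <= _); ring.
Qed.

Lemma depth_max : exists2 r : R, 0 <= r & (forall x, O x -> r <= enorm (p - r *: nu - x)) /\
  forall s : R, 0 <= s -> (forall x, O x -> s <= enorm (p - s *: nu - x)) -> s <= r.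
Proof.
have [Op un hp] := Knu.
have [x0 Ox0 x0p] : exists2 x, O x & dot (x - p) nu < 0.
  apply: contrapT => no; apply: NP => x Ox; apply/eqP; rewrite eq_le hp//= leNgt.
  by apply/negP => h; apply: no; exists x.
pose D : set R := [set s | 0 <= s /\ forall x, O x -> s <= enorm (p - s *: nu - x)].
have D0 : D 0 by split => // x _; exact: enorm_ge0.
have ubD : ubound D (dot (x0 - p) (x0 - p) / (- 2 * dot (x0 - p) nu)).
  move=> s [s0 /(_ x0 Ox0)]; rewrite depth_cond// => h; rewrite ler_pdivlMr; lra.
have sD : has_sup D by split; [exists 0|eexists; exact: ubD].
have supge s : D s -> s <= sup D by exact: sup_upper_bound.
have sup0 : 0 <= sup D by exact: supge.
exists (sup D) => //; split => [x Ox|s s0 hs]; last exact: supge.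
rewrite depth_cond//.
have [m0|m0] := eqVneq (dot (x - p) nu) 0; first by rewrite m0 mulr0 addr0 dot_ge0.
have m1 : dot (x - p) nu < 0 by rewrite lt_neqAle m0 hp.
have : sup D <= dot (x - p) (x - p) / (- 2 * dot (x - p) nu).
  apply: sup_le_ub; first by exists 0.
  move=> s [s0 /(_ x Ox)]; rewrite depth_cond// => h; rewrite ler_pdivlMr; lra.
rewrite ler_pdivlMr; lra.
Qed.

End Convex.

Section LinearSpan.
Context {R : realType} {d : nat}.
Local Notation V := 'rV[R]_d.

Lemma span_matrix (D : set V) : exists k (M : 'M[R]_(k, d)),
  (forall i, D (row i M)) /\ forall v, D v -> (v <= M)%MS.
Proof.
pose Q r := `[< exists k (M : 'M[R]_(k, d)), (forall i, D (row i M)) /\ \rank M = r >].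
have Q0 : exists r, Q r.
  exists 0%N; apply/asboolP; exists 0%N, 0; split; first by case.
  by rewrite mxrank0.
have Qd r : Q r -> (r <= d)%N by move=> /asboolP[k [M [_ <-]]]; exact: rank_leq_col.
case: (ex_maxnP Q0 Qd) => r /asboolP[k [M [DM rM]]] rmax.
exists k, M; split => // v Dv.
have DM' i : D (row i (col_mx M v)).
  case: (split_ordP i) => j ->; first by rewrite rowKu.
  by rewrite rowKd (_ : row j v = v)//; apply/rowP => l; rewrite !mxE (ord1 j).
have := rmax (\rank (col_mx M v)); rewrite -rM => h.
have le : (\rank (col_mx M v) <= \rank M)%N by apply: h; apply/asboolP; exists (k + 1)%N, (col_mx M v).
have sub : (M <= col_mx M v)%MS by rewrite -addsmxE addsmxSl.
have := mxrank_leqif_sup sub; move=> [_ eqs].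
have : (\rank M == \rank (col_mx M v)) by rewrite eqn_leq le (mxrankS sub).
by rewrite eqs -addsmxE addsmx_sub => /andP[].
Qed.

Lemma dotE_mx (v w : V) : v *m w^T = (dot v w)%:M.
Proof. by apply/matrixP => i j; rewrite !mxE !ord1 eqxx mulr1n; apply: eq_bigr => k _; rewrite !mxE. Qed.

(** [P = 1 - B^T (B B^T)^-1 B] for a basis [B] of the row space of [M]. *)
Lemma orthogonal_projection k (M : 'M[R]_(k, d)) : exists P : 'M[R]_d,
  [/\ P^T = P, P *m P = P, M *m P = 0 & forall v : V, v *m P = 0 -> (v <= M)%MS].
Proof.
pose B := row_base M; have fB : row_free B := row_base_free M.
have uB : B *m B^T \in unitmx.
  rewrite -row_free_unit -kermx_eq0; apply/rowV0P => v /sub_kermxP vB.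
  have : (v *m B) *m (v *m B)^T = 0 by rewrite trmx_mul mulmxA -(mulmxA v) vB mul0mx.
  rewrite dotE_mx => /matrixP/(_ 0 0); rewrite !mxE mulr1n => /eqP.
  by rewrite dot_eq0 => /eqP vB0; apply/eqP; rewrite -(mulmx_free_eq0 v fB) vB0.
pose Q := B^T *m invmx (B *m B^T) *m B.
have QT : Q^T = Q by rewrite /Q !trmx_mul trmx_inv !trmx_mul !trmxK mulmxA.
have BQ : B *m Q = B by rewrite /Q !mulmxA mulmxV// mul1mx.
have QQ : Q *m Q = Q by rewrite {1}/Q -mulmxA BQ.
exists (1%:M - Q); split.
- by rewrite linearB /= trmx1 QT.
- by rewrite mulmxBr mulmx1 mulmxBl mul1mx QQ subrr subr0.
- have : (M <= B)%MS by rewrite eq_row_base.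
  by move=> /submxP[X ->]; rewrite mulmxBr mulmx1 -mulmxA BQ subrr.
move=> v; rewrite mulmxBr mulmx1 => /eqP; rewrite subr_eq0 => /eqP ->.
apply: submx_trans (_ : (B <= M)%MS); last by rewrite eq_row_base.
by rewrite /Q mulmxA submxMl.
Qed.

End LinearSpan.

Section Tube.
Context {R : realType} {d : nat} (G : set ('rV[R]_d -> 'rV[R]_d)) (p : 'rV[R]_d).
Context (hG : isometry_group G).
Local Notation V := 'rV[R]_d.
Local Notation O := (isom_orbit G p).
Context (hO : hypersurface O) (cO : connected O).

(** The centres of the largest balls that touch the orbit from inside form an
    orbit [Z]. As the set of all points at depth at least [r] below the tangent
    hyperplanes, [Z] is convex, and its elements have depth exactly [r] below one
    of these hyperplanes. For the barycentre of points that span the affine hull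
    of [Z], the hyperplane must be parallel to the hull; by homogeneity all
    normals of the orbit are orthogonal to the hull. *)
Lemma orbit_tube nu : @outward R d G p p nu -> ~ (forall x, O x -> dot (x - p) nu = 0) ->
  exists (x0 : V) (P : 'M[R]_d) (r : R) (b0 : V),
    [/\ 0 < r, P^T = P /\ P *m P = P,
        forall g x, G g -> enorm ((g x - x0) *m P) = enorm ((x - x0) *m P),
        (p - x0) *m P = p - x0 /\ enorm (p - x0) = r &
        [/\ b0 != 0, b0 *m P = b0 & dot b0 (p - x0) = 0]].
Proof.
move=> Knu NP; have [r r0 [hr rmax]] := depth_max Knu NP.
have [Op un hp] := Knu.
have [x0 x0E] : exists x0, x0 = p - r *: nu by exists (p - r *: nu).
have px0 : p - x0 = r *: nu by rewrite x0E opprB addrCA subrr addr0.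
pose Z z := forall q n, outward G p q n -> r <= dot (q - z) n.
have Zx0 : Z x0 by rewrite x0E; exact: (depth hG hO Knu NP r0 hr).
have ZG g z : G g -> Z z -> Z (g z).
  move=> Gg hz q n Kq; have [k [Gk gk kg kE]] := G_inverse hG Gg.
  have := hz _ _ (outward_G hG Gk Kq).
  by rewrite -{1}(gk z) isometry_affine ?dot_lin//; exact: G_isometry Gk.
have Zorb z : Z z -> exists2 g, G g & z = g x0.
  move=> hz; have [q fq] := foot_exists hG hO z; have [Oq qm] := fq.
  have [n Kq] := outward_exists hG Knu Oq; have [_ uq _] := Kq.
  have := normal_parallel hO Oq uq (foot_normal fq); set c := dot _ n => zE.
  have := hz q n Kq; rewrite -opprB dotNl -/c => rc.
  have [g [Gg gp nE]] := outward_move hG hO Knu NP Kq; have ig := G_isometry hG Gg.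
  have zE' : z = g (p - (- c) *: nu).
    by rewrite scaleNr opprK isometry_add// gp -scalemxAl -nE -zE addrCA subrr addr0.
  have cr : - c <= r.
    apply: rmax; first lra.
    move=> x Ox; rewrite -(isometry_enorm _ _ ig) -zE'.
    have := qm _ (orbit_G hG Gg Ox); apply: le_trans.
    by rewrite zE enormZ (enorm1 uq.2) mulr1 -normrN; exact: ler_norm.
  have cE : - c = r by lra.
  by exists g => //; rewrite zE' cE -x0E.
pose D : set V := [set v | Z (x0 + v)].
have [k [M [DM spM]]] := span_matrix D.
pose k1 : R := k.+1%:R; have k10 : 0 < k1 by rewrite ltr0n.
pose c := x0 + k1^-1 *: \sum_i row i M.
have avg q n : k1 * (dot (q - c) n - r) =
    (dot (q - x0) n - r) + \sum_i (dot (q - (x0 + row i M)) n - r).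
  have dsum (w : V) : dot (\sum_i row i M) w = \sum_i dot (row i M) w.
    by elim/big_ind2: _ => [|a b a' b' h1 h2|//]; rewrite ?dot0l ?dotDl ?h1 ?h2.
  have -> : \sum_i (dot (q - (x0 + row i M)) n - r) =
     \sum_(i < k) (dot (q - x0) n - r) - \sum_i dot (row i M) n.
    rewrite -sumrB; apply: eq_bigr => i _.
    by rewrite (dot_split x0) opprD addrA subrr sub0r dotNl; ring.
  rewrite sumr_const card_ord -mulr_natl -dsum (dot_split x0).
  have -> : x0 - c = - (k1^-1 *: \sum_i row i M) by rewrite opprD addrA subrr sub0r.
  rewrite dotNl dotZl /k1 -natr1; field; rewrite natr1 gt_eqF//.
have Zc : Z c.
  move=> q n Kq; rewrite -subr_ge0 -(pmulr_rge0 _ k10) avg addr_ge0 ?subr_ge0//; first exact: Zx0.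
  by apply: sumr_ge0 => i _; rewrite subr_ge0; exact: DM.
have [g Gg cE] := Zorb c Zc; have ig := G_isometry hG Gg.
pose n := nu *m lin g.
have Kgp : outward G p (g p) n by exact: outward_G.
have Mn : M *m n^T = 0.
  have E := avg (g p) n.
  rewrite {1}cE isometry_affine// dot_lin// px0 dotZl un.2 mulr1 subrr mulr0 in E.
  have a0 : 0 <= dot (g p - x0) n - r by rewrite subr_ge0; exact: Zx0.
  have ai i : 0 <= dot (g p - (x0 + row i M)) n - r by rewrite subr_ge0; exact: DM.
  have s0 : 0 <= \sum_i (dot (g p - (x0 + row i M)) n - r) by apply: sumr_ge0.
  have a00 : dot (g p - x0) n = r by lra.
  have /eqP : \sum_i (dot (g p - (x0 + row i M)) n - r) = 0 by lra.
  rewrite psumr_eq0// => /allP z.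
  apply/row_matrixP => i; rewrite row_mul dotE_mx row0.
  have := z i (mem_index_enum i); rewrite /= (dot_split x0) opprD addrA subrr sub0r dotNl a00.
  move=> /eqP h; have -> : dot (row i M) n = 0 by lra.
  by rewrite raddf0.
have Dn v : D v -> dot v nu = 0.
  move=> Dv; rewrite -(dot_lin _ _ ig).
  have h z : Z z -> (z - x0 <= M)%MS by move=> hz; apply: spM; rewrite /D /= addrCA subrr addr0.
  have : (v *m lin g <= M)%MS.
    have -> : v *m lin g = (g (x0 + v) - x0) - (g x0 - x0).
      by rewrite opprB addrA subrK isometry_affine// addrAC subrr add0r.
    by rewrite addmx_sub ?eqmx_opp// h//; apply: ZG.
  move=> /submxP[X XE]; have : v *m lin g *m n^T = 0 by rewrite XE -mulmxA Mn mulmx0.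
  by rewrite dotE_mx => /matrixP/(_ 0 0); rewrite !mxE mulr1n.
(* For [r = 0] the orbit would coincide with [Z] and be planar. *)
have r1 : 0 < r.
  rewrite lt_neqAle r0 andbT eq_sym; apply/eqP => rE; apply: NP => x [h Gh ->].
  have x0p : x0 = p by rewrite x0E rE scale0r subr0.
  by apply: Dn; rewrite /D /= x0p addrCA subrr addr0; apply: ZG => //; rewrite -x0p.
have [P [PT PP MP spP]] := orthogonal_projection M.
have DP v : D v -> v *m P = 0 by move=> /spM/submxP[X ->]; rewrite -mulmxA MP mulmx0.
have MPg h : G h -> lin h *m P = P *m lin h *m P.
  move=> Gh; have ih := G_isometry hG Gh.
  have Mh : M *m lin h *m P = 0.
    apply/row_matrixP => i; rewrite row0 !row_mul.
    have -> : row i M *m lin h = (h (x0 + row i M) - x0) - (h x0 - x0).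
      by rewrite opprB addrA subrK isometry_affine// addrAC subrr add0r.
    have hD z : Z z -> (z - x0) *m P = 0 by move=> hz; apply: DP; rewrite /D /= addrCA subrr addr0.
    by rewrite mulmxBl !hD ?subrr//; apply: ZG => //; exact: DM.
  apply/eqP; rewrite -subr_eq0 -!mulmxA -{1}[lin h *m P]mul1mx -mulmxBl.
  apply/eqP/row_matrixP => i; rewrite row0 row_mul.
  have : (row i (1%:M - P) <= M)%MS.
    by apply: spP; rewrite -row_mul mulmxBl mul1mx PP subrr row0.
  by move=> /submxP[X ->]; rewrite -!mulmxA [M *m _]mulmxA Mh mulmx0.
have commP h : G h -> lin h *m P = P *m lin h.
  move=> Gh; have [h' [Gh' _ _ h'E]] := G_inverse hG Gh.
  have := congr1 trmx (MPg h' Gh'); rewrite h'E !trmx_mul trmxK PT => E2.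
  by rewrite (MPg h Gh) -mulmxA -E2.
have nuP : nu *m P = nu.
  apply/eqP; rewrite eq_sym -subr_eq0 -dot_eq0; set v := nu - _.
  have vP : v *m P = 0 by rewrite mulmxBl -mulmxA PP subrr.
  have /submxP[X XE] := spP v vP.
  have vnu : dot v nu = 0.
    have Mnu : M *m nu^T = 0.
      apply/row_matrixP => i; rewrite row_mul dotE_mx row0 Dn ?raddf0//.
    have : v *m nu^T = 0 by rewrite XE -mulmxA Mnu mulmx0.
    by rewrite dotE_mx => /matrixP/(_ 0 0); rewrite !mxE mulr1n.
  have -> : dot v v = dot v nu - dot v (nu *m P) by rewrite -dotNr -dotDr.
  by rewrite vnu -{1}PT -dot_mxr vP dot0l subrr.
have inv h x : G h -> enorm ((h x - x0) *m P) = enorm ((x - x0) *m P).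
  move=> Gh; have ih := G_isometry hG Gh.
  have -> : h x - x0 = (h x - h x0) + (h x0 - x0) by rewrite addrA subrK.
  have z0 : (h x0 - x0) *m P = 0.
    by apply: DP; rewrite /D /= addrCA subrr addr0; exact: ZG.
  by rewrite mulmxDl z0 addr0 isometry_affine// -mulmxA commP// mulmxA enorm_lin.
have px0P : (p - x0) *m P = p - x0 by rewrite px0 -scalemxAl nuP.
have px0r : enorm (p - x0) = r by rewrite px0 enormZ (enorm1 un.2) mulr1 gtr0_norm.
(* If the axis had codimension one, the orbit would lie in two parallel
   hyperplanes, hence in one by connectedness. *)
have [[b0 [b1 b2 b3]]|nob] := pselect (exists b0 : V, [/\ b0 != 0, b0 *m P = b0 & dot b0 nu = 0]).
  by exists x0, P, r, b0; split => //; split => //; rewrite px0 dotZr b3 mulr0.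
exfalso; apply: NP.
have two x : O x -> dot (x - p) nu = 0 \/ dot (x - p) nu = - (2 * r).
  move=> [h Gh xE]; pose w := (x - x0) *m P.
  have wr : enorm w = r by rewrite /w xE inv// px0P.
  have wE : w = dot w nu *: nu.
    apply/eqP; rewrite -subr_eq0; apply: contrapT => /negP b1; apply: nob.
    exists (w - dot w nu *: nu); split => //.
      by rewrite mulmxBl -scalemxAl nuP -mulmxA PP.
    by rewrite dotDl dotNl dotZl un.2 mulr1 subrr.
  have xw : dot (x - x0) nu = dot w nu by rewrite /w dot_mxr PT nuP.
  have : `|dot w nu| = r by rewrite -wr [in RHS]wE enormZ (enorm1 un.2) mulr1.
  rewrite (dot_split x0) xw -opprB dotNl px0 dotZl un.2 mulr1.
  by case: ler0P => _ h2; [right|left]; lra.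
have cl x y : `|dot (y - p) nu - dot (x - p) nu| <= enorm (y - x).
  rewrite (dot_split x) addrK; apply: le_trans (cauchy_schwarz _ _) _.
  by rewrite (enorm1 un.2) mulr1.
apply: (@connected_induction _ _ _ p) => //; first by rewrite subrr dot0l.
  move=> x Ox x1; apply/nbhs_enormP; exists r => // y yr Oy.
  have [//|y1] := two y Oy; have := cl x y; rewrite x1 y1 ler_norml; lra.
move=> x Ox x1; apply/nbhs_enormP; exists r => // y yr Oy y1.
have [//|x2] := two x Ox; have := cl x y; rewrite x2 y1 ler_norml; lra.
Qed.

End Tube.

(** * Planar orbits *)

Lemma hypersurface_restrict (R : realType) (d : nat) (S U : set 'rV[R]_d) q :
  hypersurface S -> open U -> S q -> U q -> hypersurface (S `&` U).
Proof.
move=> [_ hS] oU Sq Uq; split; first by exists q.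
move=> x [Sx Ux]; have [W [f [oW Wx sm g0 E]]] := hS x Sx.
exists (W `&` U), f; split => //.
- exact: openI.
- move=> k; have := sm k; elim: k f {sm g0 E} => [|k IH] f; first by move=> h y [Wy _]; exact: h.
  by move=> [h1 h2]; split => [y [Wy _]|v]; [exact: h1|exact/IH/h2].
- by move=> y [Wy _]; exact: g0.
rewrite setIACA setIid (_ : [set x0 | _] = [set x | W x /\ f x = 0] `&` U).
  by rewrite -E -setIA.
by apply/seteqP; split => y /= [[h1 h2] h3].
Qed.

Section Planar.
Context {R : realType} {d : nat} (G : set ('rV[R]_d -> 'rV[R]_d)) (p : 'rV[R]_d).
Context (hG : isometry_group G).
Local Notation V := 'rV[R]_d.
Local Notation O := (isom_orbit G p).
Context (hO : hypersurface O) (cO : connected O).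
Context (prp : principal G p) (cod : codimension_one G).

(** If the orbit is planar, the points close to [p] on the normal line are
    principal as well, with orbits on which the elements that preserve the
    sides act openly; connectedness excludes that the sides are exchanged. *)
Lemma planar_invariant nu : unit_normal O p nu -> (forall x, O x -> dot (x - p) nu = 0) ->
  forall g x, G g -> dot (g x - p) nu = dot (x - p) nu.
Proof.
move=> un pl; have Op : O p := orbit_refl p hG.
have nuO x : O x -> unit_normal O x nu.
  move=> Ox; split; last exact: un.2.
  move=> e e0; exists 1 => // y Oy _; rewrite (dot_split p) pl// -opprB dotNl pl// subrr.
  by rewrite mulr_ge0 ?enorm_ge0// ltW.
have sgn g : G g -> exists2 eps : R, eps = 1 \/ eps = -1 &
    nu *m lin g = eps *: nu /\ forall x, dot (g x - p) nu = eps * dot (x - p) nu.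
  move=> Gg; have ig := G_isometry hG Gg; have Ogp := orbit_G hG Gg Op.
  have [eps e1 E] : exists2 eps : R, eps = 1 \/ eps = -1 & nu *m lin g = eps *: nu.
    have [h|h] := unit_normal_pm hO Ogp (nuO _ Ogp) (unit_normal_transport hG Gg un).
      by exists 1; [left|rewrite scale1r].
    by exists (-1); [right|rewrite scaleN1r].
  exists eps => //; split => // x.
  rewrite (dot_split (g p)) (pl _ Ogp) addr0 isometry_affine// -(dot_lin (x - p) nu ig).
  by rewrite E dotZr mulrA; case: e1 => ->; rewrite ?mulrNN ?mulr1 mul1r.
have [dl dl0 hd] := iffLR (nbhs_enormP _ _) prp.
(* The isotropy group of [p] fixes a point off the hyperplane, so
   it preserves the sides. *)
have stab1 h : G h -> h p = p -> nu *m lin h = nu /\ forall x, dot (h x - p) nu = dot (x - p) nu.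
  move=> Gh hp; have [eps e1 [E1 E2]] := sgn h Gh.
  have [|g Gg st] := hd (p + (dl / 2) *: nu).
    by rewrite addrAC subrr add0r enormZ (enorm1 un.2) mulr1 gtr0_norm; lra.
  have [_ hg] := st h (conj Gh hp).
  have [eg eg1 [_ Eg]] := sgn g Gg.
  have := E2 (g (p + (dl / 2) *: nu)); rewrite hg Eg addrAC subrr add0r dotZl un.2 mulr1 => E3.
  have eps1 : eps = 1 by case: e1 => // ee; case: eg1 => gg; move: E3; rewrite ee gg; lra.
  by split; [rewrite E1 eps1 scale1r|move=> x; rewrite E2 eps1 mul1r].
pose keeps (g : V -> V) := forall x, dot (g x - p) nu = dot (x - p) nu.
pose t := dl / 4; have t0 : 0 < t by rewrite divr_gt0.
pose q := p + t *: nu.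
have qp x : dot (x - q) nu = dot (x - p) nu - t.
  by rewrite (dot_split p) /q opprD addrA subrr sub0r dotNl dotZl un.2 mulr1.
have qE : q - p = t *: nu by rewrite /q addrAC subrr add0r.
have hq : hypersurface (isom_orbit G q).
  apply: cod.2; apply/nbhs_enormP; exists (dl / 4) => // q' q'q.
  have [|g Gg st] := hd q'.
    have := enorm_dist q' q p; rewrite qE enormZ (enorm1 un.2).
    by rewrite mulr1 gtr0_norm// /t; lra.
  exists g => // h [Gh hq]; apply: st; split => //.
  have [eps e1 [E1 E2]] := sgn h Gh; have ih := G_isometry hG Gh.
  have := E2 q; rewrite hq /q addrAC subrr add0r dotZl un.2 mulr1 => E3.
  have eps1 : eps = 1 by case: e1 => // ee; move: E3; rewrite ee; lra.
  have := hq; rewrite /q isometry_add// -scalemxAl E1 eps1 scale1r.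
  exact: addIr.
pose U : set V := [set x | 0 < dot (x - p) nu].
have oU : open U.
  rewrite openE => x Ux; apply/nbhs_enormP; exists (dot (x - p) nu) => // y yx.
  rewrite /U /= (dot_split x).
  have := le_trans (ler_norm _) (cauchy_schwarz (- (y - x)) nu); rewrite dotNl enormN (enorm1 un.2); lra.
have Gq : isom_orbit G q q by exact: orbit_refl.
have Uq : U q by rewrite /U /= /q addrAC subrr add0r dotZl un.2 mulr1.
have hS := hypersurface_restrict hq oU Gq Uq.
have Splane x : (isom_orbit G q `&` U) x -> dot (x - q) nu = 0.
  move=> [[g Gg ->]]; have [eps e1 [_ E2]] := sgn g Gg.
  rewrite /U /= qp E2 /q addrAC subrr add0r dotZl un.2 mulr1.
  by case: e1 => ->; lra.
have [r r0 hr] := hypersurface_in_plane hS (conj Gq Uq) un.2 Splane.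
have near1 x : O x -> enorm (x - p) < r -> exists g, [/\ G g, keeps g & g p = x].
  move=> Ox xr; have E : x + t *: nu - q = x - p by rewrite /q opprD addrACA subrr addr0.
  have [||[g Gg gE] Ux] := hr (x + t *: nu); rewrite ?E//; first exact: pl.
  have [eps e1 [E1 E2]] := sgn g Gg; have ig := G_isometry hG Gg.
  have eps1 : eps = 1.
    case: e1 => // ee; move: Ux; rewrite /U /= gE E2 /q addrAC subrr add0r dotZl un.2 ee; lra.
  exists g; split => //; first by move=> y; rewrite E2 eps1 mul1r.
  by move: gE; rewrite /q isometry_add// -scalemxAl E1 eps1 scale1r => /addIr.
have near2 x0 x : O x0 -> O x -> enorm (x - x0) < r ->
    exists g, [/\ G g, keeps g & g x0 = x].
  move=> O0 Ox xr; have [h Gh hE] := orbit_trans hG Op O0; have ih := G_isometry hG Gh.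
  have [k [Gk gk kg kE]] := G_inverse hG Gh; have ik := G_isometry hG Gk.
  have [g [Gg kg1 gp]] : exists g, [/\ G g, keeps g & g p = k x].
    apply: near1; first exact: orbit_G.
    by rewrite -(gk p) hE isometry_enorm.
  have [_ Gc _ _] := hG.
  exists (h \o g \o k); split; [by do 2![apply: (Gc) => //]| |by rewrite /= -hE gk gp kg].
  move=> y /=; have [eps _ [_ E2]] := sgn h Gh.
  by rewrite E2 kg1 -E2 kg.
have all1 x : O x -> exists g, [/\ G g, keeps g & g p = x].
  apply: (@connected_induction _ O (fun x => exists g, [/\ G g, keeps g & g p = x]) p cO Op).
  - by have [G1 _ _ _] := hG; exists id.
  - move=> y Oy [g [Gg kg gp]]; apply/nbhs_enormP; exists r => // z zr Oz.
    have [g' [Gg' kg' gp']] := near2 y z Oy Oz zr.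
    have [_ Gc _ _] := hG; exists (g' \o g); split; [exact: Gc| |by rewrite /= gp].
    by move=> w /=; rewrite kg' kg.
  - move=> y Oy ny; apply/nbhs_enormP; exists r => // z zr Oz [g [Gg kg gp]]; apply: ny.
    rewrite enormB in zr.
    have [g' [Gg' kg' gp']] := near2 z y Oz Oy zr.
    have [_ Gc _ _] := hG; exists (g' \o g); split; [exact: Gc| |by rewrite /= gp].
    by move=> w /=; rewrite kg' kg.
move=> g x Gg; have [h [Gh kh hE]] := all1 (g p) (orbit_G hG Gg Op).
have [k [Gk hk kh' kE]] := G_inverse hG Gh.
have [_ Gc _ _] := hG.
have [_ E2] := stab1 (k \o g) (Gc _ _ Gk Gg) (ltac:(by rewrite /= -hE hk)).
by rewrite -(E2 x) /= -(kh (k (g x))) kh'.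
Qed.

End Planar.

(** * Second-order expansions and the Cauchy problem *)

Section Jets.
Context {R : realType} {d : nat}.
Local Notation V := 'rV[R]_d.
Local Notation e_ := (@basis_vec R d).
Implicit Types (w : V -> R) (x b : V) (H : 'M[R]_d).

(** [H] is one half of the Hessian. *)
Definition jet2 w x b H := forall e : R, 0 < e -> exists2 r : R, 0 < r &
  forall h : V, enorm h < r -> `|w (x + h) - w x - dot h b - dot (h *m H) h| <= e * dot h h.

Definition taylor2 (Y : R -> R) (q y1 y2 : R) := forall e : R, 0 < e -> exists2 r : R, 0 < r &
  forall t : R, `|t| < r -> `|Y (q + t) - Y q - t * y1 - t ^+ 2 / 2 * y2| <= e * t ^+ 2.

Lemma quadratic_bounded H : exists2 C : R, 0 < C & forall h : V, `|dot (h *m H) h| <= C * dot h h.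
Proof.
have [C C0 hC] := mulmx_bounded H; exists C => // h.
apply: le_trans (cauchy_schwarz _ _) _; rewrite -sqr_enorm expr2 mulrA.
by rewrite ler_wpM2r ?enorm_ge0.
Qed.

Lemma jet2_lipschitz w x b H : jet2 w x b H -> exists2 K : R, 0 < K & exists2 r : R, 0 < r &
  forall h : V, enorm h < r -> `|w (x + h) - w x| <= K * enorm h.
Proof.
move=> j; have [C C0 hC] := quadratic_bounded H; have [r r0 hr] := j 1 ltr01.
exists (1 + C + enorm b); first by rewrite ltr_wpDr ?enorm_ge0//; lra.
exists (Num.min r 1); first by rewrite lt_min r0 ltr01.
move=> h; rewrite lt_min => /andP[/hr h1 h2]; have := hC h; have := cauchy_schwarz h b.
move: h1; rewrite -!sqr_enorm.
have : enorm h ^+ 2 <= enorm h by rewrite expr2 ler_piMl ?enorm_ge0// ltW.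
move: (enorm_ge0 h) (enorm b); move: (enorm h) (w (x + h) - w x) (dot h b) (dot _ h) => a T bh Q a0 B aa.
have : C * a ^+ 2 <= C * a by rewrite ler_pM2l.
rewrite !ler_norml; lra.
Qed.

Lemma jet2_continuous w x b H : jet2 w x b H -> {for x, continuous w}.
Proof.
move=> /jet2_lipschitz[K K0 [r r0 hr]]; apply/(@continuous_enormP R d R^o) => e e0.
exists (Num.min r (e / K)); first by rewrite lt_min r0 divr_gt0.
move=> y; rewrite lt_min ltr_pdivlMr// => /andP[yr ye].
by have := hr _ yr; rewrite [x + _]addrC subrK => h; apply: le_lt_trans h _; rewrite mulrC.
Qed.

Lemma jet2_glaplacian w x b H : jet2 w x b H -> glaplacian w x (2 * \tr H).
Proof.
move=> j e e0; pose e1 := e / (2 * (d%:R + 1)).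
have d1 : 0 < 2 * (d%:R + 1 : R) by rewrite mulr_gt0// ltr_wpDl.
have [r r0 hr] := j e1 (divr_gt0 e0 d1); exists r => // t /andP[t0 tr].
have ee i : dot (t *: e_ i) (t *: e_ i) = t ^+ 2.
  by rewrite dotZl dotZr dot_basis basis_vecE eqxx mulr1 expr2.
have te i : enorm (t *: e_ i) < r.
  by rewrite /enorm ee sqrtr_sqr gtr0_norm.
have HE i : dot (t *: e_ i *m H) (t *: e_ i) = t ^+ 2 * H i i.
  by rewrite -scalemxAl dotZl dotZr dotC dot_basis -rowE mxE mulrA expr2.
have bound i : `|sdiff w x (t *: e_ i) - 2 * H i i * t ^+ 2| <= 2 * e1 * t ^+ 2.
  have h1 := hr _ (te i); have := hr (- (t *: e_ i)); rewrite enormN => /(_ (te i)).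
  rewrite dotNl mulNmx !dotNl !dotNr !opprK HE ee; rewrite HE ee in h1 => h2.
  rewrite /sdiff; move: h1 h2; rewrite !ler_norml; lra.
rewrite /mxtrace mulr_sumr mulr_suml -sumrB.
apply: le_trans (ler_norm_sum _ _ _) _.
apply: le_trans (ler_sum _ (fun i _ => bound i)) _.
rewrite sumr_const card_ord -mulr_natl.
have -> : e * t ^+ 2 = 2 * (d%:R + 1) * (e1 * t ^+ 2).
  by rewrite /e1; field; rewrite gt_eqF// ltr_wpDl.
have : 0 < e1 * t ^+ 2 by rewrite mulr_gt0 ?divr_gt0// exprn_gt0.
lra.
Qed.

Lemma jet2_comp w x b H (Y : R -> R) (y1 y2 : R) : jet2 w x b H -> taylor2 Y (w x) y1 y2 ->
  jet2 (fun y => Y (w y)) x (y1 *: b) (y1 *: H + (y2 / 2) *: (b^T *m b)).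
Proof.
move=> jw tY e e0.
have [C C0 hC] := quadratic_bounded H.
have [K K0 [r1 r10 h1]] := jet2_lipschitz jw.
have [r2 r20 h2] := tY (e / (3 * K ^+ 2)) (ltac:(by rewrite divr_gt0// mulr_gt0// exprn_gt0)).
have y10 : 0 < 3 * (`|y1| + 1) by rewrite mulr_gt0// ltr_wpDl.
pose e2 := Num.min 1 (e / (3 * (`|y1| + 1))).
have e20 : 0 < e2 by rewrite lt_min ltr01 divr_gt0.
have [e21 e2e] : e2 <= 1 /\ e2 <= e / (3 * (`|y1| + 1)) by rewrite /e2 !ge_min !lexx orbT.
have [r3 r30 h3] := jw e2 e20.
pose L := 3 * ((C + 1) * (K + enorm b) * (`|y2| + 1)).
have L0 : 0 < L.
  have KB : 0 < K + enorm b by rewrite ltr_wpDr ?enorm_ge0.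
  have y20 : 0 < `|y2| + 1 by rewrite ltr_wpDl.
  by rewrite /L !mulr_gt0//; lra.
exists (Num.min (Num.min r1 r3) (Num.min (r2 / K) (e / L))).
  by rewrite !lt_min r10 r30 !divr_gt0.
move=> h; rewrite !lt_min => /andP[/andP[hr1 hr3] /andP[]].
rewrite !ltr_pdivlMr// => hr2 heL.
have := h1 h hr1; have := h3 h hr3; have := hC h; have := cauchy_schwarz h b.
have : dot (h *m (y1 *: H + (y2 / 2) *: (b^T *m b))) h = y1 * dot (h *m H) h + y2 / 2 * dot h b ^+ 2.
  rewrite mulmxDr -!scalemxAr dotDl !dotZl mulmxA dotE_mx mul_scalar_mx dotZl (dotC b) expr2.
  by rewrite mulrA.
move=> ->; rewrite dotZr.
pose tau := w (x + h) - w x; rewrite -/tau.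
have tauE : w (x + h) = w x + tau by rewrite /tau [RHS]addrC subrK.
rewrite -sqr_enorm => csb hQ hj htau.
have hr2' : K * enorm h < r2 by rewrite mulrC.
have := h2 tau (le_lt_trans htau hr2'); rewrite -tauE => hY.
have LE : L = 3 * ((C + 1) * (K + enorm b) * (`|y2| + 1)) by [].
clearbody L.
move: (enorm h) (enorm_ge0 h) (dot h b) (dot (h *m H) h) (enorm b) (enorm_ge0 b) LE csb hQ hj htau hY heL hr1 hr2 hr2' hr3 => a a0 bh Q B B0 LE csb hQ hj htau hY heL hr1 hr2 hr2' hr3.
clear jw tY h1 h2 h3 hr1 hr3 hr2 hr2' hC tauE.
move: (Y (w (x + h)) - Y (w x)) hY => DY hY.
have a20 : 0 <= a ^+ 2 := sqr_ge0 a.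
have X1 : `|DY - tau * y1 - tau ^+ 2 / 2 * y2| <= e / 3 * a ^+ 2.
  apply: le_trans hY _.
  have -> : e / 3 * a ^+ 2 = e / (3 * K ^+ 2) * (K * a) ^+ 2 by field; rewrite gt_eqF.
  rewrite ler_wpM2l//; first by rewrite ltW// divr_gt0// mulr_gt0// exprn_gt0.
  by rewrite -[tau ^+ 2]real_normK ?num_real// ler_pXn2r ?nnegrE// mulr_ge0// ltW.
have X2 : `|y1 * (tau - bh - Q)| <= e / 3 * a ^+ 2.
  rewrite normrM; apply: le_trans (ler_wpM2l (normr_ge0 y1) hj) _.
  rewrite mulrA ler_wpM2r//.
  have : e2 * (`|y1| + 1) <= e / 3.
    by move: e2e; rewrite !ler_pdivlMr ?ltr_wpDl//; lra.
  lra.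
have X3 : `|y2 / 2 * (tau ^+ 2 - bh ^+ 2)| <= e / 3 * a ^+ 2.
  have h1 : `|tau - bh| <= (C + 1) * a ^+ 2.
    have : e2 * a ^+ 2 <= 1 * a ^+ 2 by rewrite ler_wpM2r.
    by move: hj hQ; rewrite !ler_norml; lra.
  have h2 : `|tau + bh| <= (K + B) * a.
    by move: htau csb; rewrite !ler_norml; lra.
  rewrite subr_sqr !normrM.
  have h3 : `|tau - bh| * `|tau + bh| <= (C + 1) * a ^+ 2 * ((K + B) * a) by rewrite ler_pM.
  have h4 : `|y2 / 2| <= `|y2| + 1.
    by rewrite normrM (ger0_norm (_ : 0 <= (2^-1 : R))) ?invr_ge0//; have := normr_ge0 y2; lra.
  apply: (@le_trans _ _ ((`|y2| + 1) * ((C + 1) * a ^+ 2 * ((K + B) * a)))).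
    by rewrite -(normrM y2) ler_pM// mulr_ge0.
  have : L * a * a ^+ 2 <= e * a ^+ 2 by rewrite ler_wpM2r// mulrC ltW.
  rewrite LE; lra.
have -> : DY - y1 * bh - (y1 * Q + y2 / 2 * bh ^+ 2) =
  (DY - tau * y1 - tau ^+ 2 / 2 * y2) + y1 * (tau - bh - Q) + y2 / 2 * (tau ^+ 2 - bh ^+ 2) by ring.
apply: le_trans (ler_normD _ _) _; have := ler_normD (DY - tau * y1 - tau ^+ 2 / 2 * y2) (y1 * (tau - bh - Q)).
move: X1 X2 X3; move: `|_| `|_| `|_| `|_| => A1 A2 A3 A4; lra.
Qed.

(** The mean value inequality on the segment from [x] to [x + h]. *)
Lemma Ck2_jet (U : set V) (u : V -> R) x : open U -> U x -> Ck 2 U u ->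
  jet2 u x (grad u x) (2^-1 *: \matrix_(i, j) 'D_(e_ i) ('D_(e_ j) u) x).
Proof.
move=> oU Ux [du d2] e e0; set H := \matrix_(i, j) _.
have dd v y : U y -> differentiable ('D_v u) y by move=> Uy; have [h _] := d2 v; exact: h.
have [r0 r00 hr0] := open_enormP oU Ux.
pose e1 := e / (d%:R + 1); have d1 : 0 < d%:R + 1 :> R by rewrite ltr_wpDl.
have e10 : 0 < e1 by rewrite divr_gt0.
have [r1 r10 hr1] : exists2 r : R, 0 < r & forall h : V, enorm (h - 0) < r -> forall i,
    `|'D_(e_ i) u (x + h) - 'D_(e_ i) u x - 'D_h ('D_(e_ i) u) x| <= e1 * enorm h.
  apply/(nbhs_enormP (0 : V) (fun h => forall i,
    `|'D_(e_ i) u (x + h) - 'D_(e_ i) u x - 'D_h ('D_(e_ i) u) x| <= e1 * enorm h)).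
  apply: (@filter_forall V 'I_d (fun i h => `|'D_(e_ i) u (x + h) - 'D_(e_ i) u x - 'D_h ('D_(e_ i) u) x| <= e1 * enorm h) (nbhs (0 : V))) => i.
  have [r r1 hr] := diff_eps (dd (e_ i) x Ux) e10.
  by apply/nbhs_enormP; exists r => // h; rewrite subr0; exact: hr.
exists (Num.min r0 r1); first by rewrite lt_min r00.
move=> h; rewrite lt_min => /andP[h0 h1].
have inU (t : R) : 0 <= t <= 1 -> enorm (t *: h) <= enorm h.
  by move=> /andP[t0 t1]; rewrite enormZ ger0_norm// ler_piMl ?enorm_ge0.
have Ut (t : R) : 0 <= t <= 1 -> U (x + t *: h).
  by move=> /inU th; apply: hr0; rewrite addrAC subrr add0r; exact: le_lt_trans h0.
pose Hq := dot (h *m H) h.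
pose phi (t : R) : R := u (x + t *: h) - t * dot h (grad u x) - t ^+ 2 / 2 * Hq.
pose dphi (t : R) : R := 'D_h u (x + t *: h) - dot h (grad u x) - t * Hq.
have dphiP (t : R) : 0 <= t <= 1 -> is_derive t 1 phi (dphi t).
  move=> /Ut/du/is_derive_line dl; rewrite /phi /dphi.
  apply: is_deriveB.
    apply: is_deriveB => //.
    by apply: is_derive_eq (is_deriveM (is_derive_id t (1 : R)) (is_derive_cst (dot h (grad u x)) t 1)) _;
      rewrite scaler0 add0r /GRing.scale /= mulr1.
  have -> : (fun s : R => s ^+ 2 / 2 * Hq) = (fun s => (Hq / 2) *: (s * s)).
    by apply/funext => s; rewrite /GRing.scale /=; ring.
  have ss := is_deriveM (is_derive_id t (1 : R)) (is_derive_id t (1 : R)).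
  by apply: is_derive_eq (is_deriveZ (Hq / 2) ss) _; rewrite /GRing.scale /=; field.
have bd (t : R) : 0 <= t <= 1 -> `|dphi t| <= e * dot h h.
  move=> t01; have th := inU t t01; have Uxt := Ut t t01.
  have E : dphi t = \sum_i h 0 i * ('D_(e_ i) u (x + t *: h) - 'D_(e_ i) u x - 'D_(t *: h) ('D_(e_ i) u) x).
    rewrite /dphi derive_dot; last exact: du.
    have -> : t * Hq = \sum_i h 0 i * 'D_(t *: h) ('D_(e_ i) u) x.
      rewrite /Hq mulr_sumr; apply: eq_bigr => i _.
      rewrite derive_dot; last exact: dd.
      have -> : dot (t *: h) (grad ('D_(e_ i) u) x) = t * (h *m H) 0 i.
        by rewrite dotZl [(h *m H) 0 i]mxE; congr (_ * _); apply: eq_bigr => j _; rewrite !mxE.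
      ring.
    rewrite -!sumrB; apply: eq_bigr => i _; rewrite !mxE; ring.
  rewrite E; apply: le_trans (ler_norm_sum _ _ _) _.
  have tb i : `|h 0 i * ('D_(e_ i) u (x + t *: h) - 'D_(e_ i) u x - 'D_(t *: h) ('D_(e_ i) u) x)|
     <= e1 * dot h h.
    rewrite normrM -sqr_enorm expr2 mulrCA.
    have := hr1 (t *: h); rewrite subr0 => /(_ _ i) hh.
    apply: ler_pM => //.
      by apply: le_trans (coord_le _ i) _; exact: norm_le_enorm.
    apply: le_trans (hh _) _; last by rewrite ler_pM2l.
    by apply: le_lt_trans th _.
  apply: le_trans (ler_sum _ (fun i _ => tb i)) _.
  rewrite sumr_const card_ord -mulr_natl.
  have -> : e * dot h h = (d%:R + 1) * (e1 * dot h h) by rewrite /e1; field; rewrite gt_eqF.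
  by rewrite ler_wpM2r ?lerDl// mulr_ge0 ?dot_ge0// ltW.
have := MVT_bound ler01 dphiP bd; rewrite subr0 mulr1; congr (`|_| <= _).
rewrite /phi scale0r addr0 scale1r -scalemxAr dotZl -/Hq; by field.
Qed.

End Jets.

Section Cauchy.
Context {R : realType} {d : nat}.
Local Notation V := 'rV[R]_d.
Local Notation e_ := (@basis_vec R d).
Implicit Types (w : V -> R) (x b : V) (H : 'M[R]_d).

Lemma star_connected (E : set V) m :
  (forall y (t : R), E y -> 0 <= t <= 1 -> E (m + t *: (y - m))) -> connected E.
Proof.
move=> st.
have -> : E = \bigcup_(y in E) ((fun t : R => m + t *: (y - m)) @` `[0, 1]%classic).
  apply/seteqP; split => [y Ey|y [z Ez [t /= t01 <-]]].
    exists y => //; exists 1; first by rewrite /= in_itv /= lexx ler01.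
    by rewrite scale1r addrCA subrr addr0.
  by apply: st => //; move: t01; rewrite in_itv.
apply: bigcup_connected => [|y Ey]; last exact: segment_connected_rV.
exists m => y Ey; exists 0; first by rewrite /= in_itv /= lexx ler01.
by rewrite scale0r addr0.
Qed.

Lemma ball_connected m (r : R) : connected [set y : V | enorm (y - m) < r].
Proof.
apply: (@star_connected _ m) => y t /= yr /andP[t0 t1].
rewrite addrAC subrr add0r enormZ ger0_norm//; apply: le_lt_trans yr.
by rewrite ler_piMl ?enorm_ge0.
Qed.

Lemma ball_open m (r : R) : open [set y : V | enorm (y - m) < r].
Proof.
rewrite openE => x /= xr; apply/nbhs_enormP; exists (r - enorm (x - m)); first by rewrite subr_gt0.
by move=> y yx; have /= := enorm_dist y x m; lra.
Qed.

Lemma helmholtz_near (lambda : R) w1 w2 x : (\forall y \near x, w1 y = w2 y) ->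
  {for x, continuous w1} /\ glaplacian w1 x (lambda * w1 x) ->
  {for x, continuous w2} /\ glaplacian w2 x (lambda * w2 x).
Proof.
move=> nr; have E := nbhs_singleton nr; move: nr => /nbhs_distP[r r0 h] [c g].
split; first exact: (continuous_near r0 h c).
by rewrite -E; exact: (glaplacian_near r0 h g).
Qed.

Lemma jet2_helmholtz (lambda : R) w x b H : jet2 w x b H -> 2 * \tr H = lambda * w x ->
  {for x, continuous w} /\ glaplacian w x (lambda * w x).
Proof. by move=> j <-; split; [exact: jet2_continuous j|exact: jet2_glaplacian j]. Qed.

Lemma jet2_lin w1 w2 x b1 b2 H1 H2 (a : R) : jet2 w1 x b1 H1 -> jet2 w2 x b2 H2 ->
  jet2 (fun y => w1 y + a * w2 y) x (b1 + a *: b2) (H1 + a *: H2).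
Proof.
move=> j1 j2 e e0; have a0 : 0 < 2 * (`|a| + 1) by rewrite mulr_gt0// ltr_wpDl.
have [r1 r10 h1] := j1 (e / 2) (ltac:(lra)).
have [r2 r20 h2] := j2 (e / (2 * (`|a| + 1))) (divr_gt0 e0 a0).
exists (Num.min r1 r2); first by rewrite lt_min r10.
move=> h; rewrite lt_min => /andP[/h1 k1 /h2 k2].
have -> : w1 (x + h) + a * w2 (x + h) - (w1 x + a * w2 x) - dot h (b1 + a *: b2) -
    dot (h *m (H1 + a *: H2)) h =
  (w1 (x + h) - w1 x - dot h b1 - dot (h *m H1) h) +
  a * (w2 (x + h) - w2 x - dot h b2 - dot (h *m H2) h).
  by rewrite mulmxDr -scalemxAr dotDr dotZr dotDl dotZl; ring.
apply: le_trans (ler_normD _ _) _; rewrite normrM.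
have : `|a| * `|w2 (x + h) - w2 x - dot h b2 - dot (h *m H2) h| <= e / 2 * dot h h.
  apply: le_trans (ler_wpM2l (normr_ge0 a) k2) _.
  have -> : e / 2 * dot h h = (`|a| + 1) * (e / (2 * (`|a| + 1)) * dot h h).
    by field; rewrite gt_eqF// ltr_wpDl.
  by rewrite ler_wpM2r ?lerDl// mulr_ge0 ?dot_ge0// ltW// divr_gt0.
lra.
Qed.

(** A solution that vanishes to second order along a hypersurface remains a
    solution when it is replaced by zero on one side, hence vanishes on the other. *)
Lemma one_sided_vanishing (lambda : R) (E : set V) (f D : V -> R) x0 :
  open E -> connected E -> helmholtz lambda E D ->
  (forall y, E y -> {for y, continuous f}) ->
  (forall y, E y -> f y = 0 -> D y = 0 /\ jet2 D y 0 0) ->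
  E x0 -> f x0 < 0 -> forall y, E y -> 0 < f y -> D y = 0.
Proof.
move=> oE cE hD cf D0 Ex0 fx0.
pose w y := if 0 < f y then D y else 0.
have w0 y : E y -> f y < 0 -> \forall z \near y, w z = 0.
  move=> Ey fy; have [r r0 hr] := iffLR (@continuous_enormP R d R^o _ _) (cf y Ey) (- f y) (ltac:(lra)).
  apply/nbhs_enormP; exists r => // z /hr; rewrite ltr_norml => /andP[_ h].
  by rewrite /w ifF//; apply/negbTE; rewrite -leNgt; lra.
have hw : helmholtz lambda E w.
  move=> y Ey; have [fy|fy|fy] := ltgtP (f y) 0.
  - apply: (@helmholtz_near _ (fun=> 0)).
      by near=> z; apply/esym; near: z; exact: w0.
    apply: (@jet2_helmholtz _ _ _ 0 0); last by rewrite mxtrace0 !mulr0.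
    move=> e e0; exists 1 => // h _.
    by rewrite mulmx0 dot0r dot0l !subr0 normr0 mulr_ge0 ?dot_ge0// ltW.
  - apply: (@helmholtz_near _ D) (hD y Ey).
    have [r r0 hr] := iffLR (@continuous_enormP R d R^o _ _) (cf y Ey) (f y) fy.
    apply/nbhs_enormP; exists r => // z /hr; rewrite ltr_norml => /andP[h _].
    by rewrite /w ifT//; lra.
  have [Dy jD] := D0 y Ey fy.
  have wy : w y = 0 by rewrite /w fy ltxx.
  apply: (@jet2_helmholtz _ _ _ 0 0); last by rewrite mxtrace0 wy !mulr0.
  move=> e /jD[r r0 hr]; exists r => // h /hr.
  rewrite mulmx0 dot0r dot0l !subr0 Dy wy !subr0; rewrite /w.
  by case: ifP => // _; rewrite normr0; apply: le_trans.
move=> y Ey fy.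
have := unique_continuation oE (fun _ => id) cE hw Ex0 (w0 _ Ex0 fx0) Ey.
by move=> /nbhs_singleton; rewrite /w fy.
Unshelve. all: by end_near.
Qed.

(** Each side of [S] is reached by a continuation of zero from the other one. *)
Lemma cauchy_uniqueness (lambda : R) (U S : set V) (D : V -> R) m :
  open U -> U m -> helmholtz lambda U D -> hypersurface S -> S m ->
  (forall x, S x -> U x -> D x = 0 /\ jet2 D x 0 0) -> \forall y \near m, D y = 0.
Proof.
move=> oU Um hD hS Sm D0.
have [f [k [nu [r c]]]] := hypersurface_chart hS Sm.
have k0 := chart_k c; have r0 := chart_r c.
have [r1 r10 hr1] := open_enormP oU Um.
pose r2 := Num.min r r1; have r20 : 0 < r2 by rewrite lt_min r0.
pose E : set V := [set y | enorm (y - m) < r2].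
have Er y : E y -> enorm (y - m) < r by rewrite /E /= lt_min => /andP[].
have EU y : E y -> U y by rewrite /E /= lt_min => /andP[_ /hr1].
have cf y : E y -> {for y, continuous f}.
  by move=> /Er/(chart_diff c)/differentiable_continuous.
have f0 : f m = 0 by exact/(chart_zero c (chart_center c)).
have nu1 := enorm1 (chart_nu c).
have [r3 r30 h3] := grad_eps (chart_diff c (chart_center c)) (divr_gt0 k0 (ltr0n R 2)).
pose t := Num.min r2 r3 / 2; have m0 : 0 < Num.min r2 r3 by rewrite lt_min r20.
have t0 : 0 < t by rewrite divr_gt0.
have [t2 t3] : t < r2 /\ t < r3.
  have [h1 h2] : Num.min r2 r3 <= r2 /\ Num.min r2 r3 <= r3 by split; rewrite ge_min lexx ?orbT.
  by rewrite /t; split; lra.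
have pt (s : R) : `|s| = 1 -> enorm (m + (s * t) *: nu - m) = t.
  by move=> s1; rewrite addrAC subrr add0r enormZ nu1 mulr1 normrM s1 mul1r gtr0_norm.
have fpt (s : R) : `|s| = 1 -> `|f (m + (s * t) *: nu) - s * t * k| <= k / 2 * t.
  move=> s1; have := h3 (m + (s * t) *: nu); rewrite pt// => /(_ t3).
  rewrite f0 subr0 [m + _ - m]addrAC subrr add0r (chart_grad c) dotZl dotZr (chart_nu c) mulr1.
  by [].
have kt : 0 < k * t by rewrite mulr_gt0.
have Ept (s : R) : `|s| = 1 -> E (m + (s * t) *: nu) by move=> s1; rewrite /E /= pt.
have hE : helmholtz lambda E D by move=> y /EU; exact: hD.
have oE : open E by exact: ball_open.
have cE : connected E by exact: ball_connected.
have SE y : E y -> f y = 0 -> D y = 0 /\ jet2 D y 0 0.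
  by move=> Ey fy; apply: D0; [exact/(chart_zero c (Er _ Ey))|exact: EU].
apply/nbhs_enormP; exists r2 => // y Ey.
have [fy|fy|fy] := ltgtP (f y) 0; last by have [] := SE y Ey fy.
- apply: (@one_sided_vanishing lambda E (fun y => -1 * f y) D (m + (1 * t) *: nu) oE cE hE) => //.
  + by move=> z Ez; exact: continuous_scal (cf z Ez).
  + by move=> z Ez /eqP; rewrite mulN1r oppr_eq0 => /eqP; exact: SE.
  + by apply: Ept; rewrite normr1.
  + by have := fpt 1 (normr1 _); rewrite ler_norml mulN1r; lra.
  + by rewrite mulN1r oppr_gt0.
apply: (@one_sided_vanishing lambda E f D (m + (-1 * t) *: nu) oE cE hE) => //.
+ by apply: Ept; rewrite normrN1.
+ by have := fpt (-1) (normrN1 _); rewrite ler_norml; lra.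
Qed.

Lemma symmetric_rank1 H (n : V) : H^T = H -> dot n n = 1 ->
  (forall a : V, dot a n = 0 -> a *m H = 0) -> H = \tr H *: (n^T *m n).
Proof.
move=> HT n1 Hn; pose w := n *m H.
have HE i j : H i j = n 0 i * w 0 j.
  have /Hn : dot (e_ i - dot (e_ i) n *: n) n = 0 by rewrite dotDl dotNl dotZl n1 mulr1 subrr.
  rewrite mulmxBl -scalemxAl -/w dot_basis => /eqP; rewrite subr_eq0 => /eqP E.
  by have := congr1 (fun v : V => v 0 j) E; rewrite /basis_vec -rowE !mxE.
have sw i j : n 0 i * w 0 j = n 0 j * w 0 i by rewrite -!HE -{1}HT mxE.
have wE j : w 0 j = n 0 j * \tr H.
  rewrite /mxtrace; under eq_bigr do rewrite HE.
  have -> : w 0 j = dot n n * w 0 j by rewrite n1 mul1r.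
  by rewrite mulr_suml mulr_sumr; apply: eq_bigr => i _; rewrite -mulrA sw mulrCA.
apply/matrixP => i j; rewrite HE wE !mxE big_ord1 !mxE; ring.
Qed.

(** On a hypersurface of critical points a solution is locally constant, and its
    Hessian is concentrated in the normal direction, where the equation determines it. *)
Lemma critical_jet (Omega M : set V) (u : V -> R) (lambda : R) m :
  open Omega -> hypersurface M -> M `<=` Omega -> Ck 2 Omega u -> M `<=` crit Omega u ->
  (forall x, Omega x -> laplacian u x = lambda * u x) -> M m ->
  exists2 r : R, 0 < r & forall x n, M x -> enorm (x - m) < r -> unit_normal M x n ->
    u x = u m /\ jet2 u x 0 ((lambda * u m / 2) *: (n^T *m n)).
Proof.
move=> oO hM MO Cu Mc eq Mm.
have [du d2] := Cu.
have dd v y : Omega y -> differentiable ('D_v u) y by move=> Uy; have [h _] := d2 v; exact: h.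
have g0 x : M x -> grad u x = 0 by move=> /Mc[].
have [r r0 hr] := flat_locally_constant hM Mm ltr01.
exists r => // x n Mx xr un.
have ux : u x = u m.
  apply: hr => // y My _ e e0; have [s s0 hs] := grad_eps (du y (MO _ My)) e0.
  by exists s => // z _ /hs; rewrite (g0 y My) dot0r subr0.
split => //; have Ox := MO _ Mx.
have := Ck2_jet oO Ox Cu; rewrite g0//; set H := \matrix_(i, j) _.
suff -> : H = (lambda * u m) *: (n^T *m n) by rewrite scalerA mulrC.
have trH : \tr H = lambda * u m.
  by rewrite -ux -eq//; apply: eq_bigr => i _; rewrite mxE.
rewrite -trH; apply: symmetric_rank1; last move=> a an.
- apply/matrixP => i j; rewrite !mxE; apply: schwarz; try exact: dd.
  have [s s0 hs] := open_enormP oO Ox.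
  by apply/nbhs_enormP; exists s => // y /hs; exact: du.
- exact: un.2.
apply/rowP => i; rewrite [RHS]mxE.
have -> : (a *m H) 0 i = dot a (grad ('D_(e_ i) u) x).
  by rewrite mxE; apply: eq_bigr => j _; rewrite !mxE.
set g := grad _ x; apply/eqP; rewrite -normr_le0.
apply: (@le0_eps _ _ (enorm a + 1 + enorm g)); first by rewrite !addr_ge0 ?enorm_ge0.
move=> e e0 e1.
have [s1 s10 h1] := grad_eps (dd (e_ i) x Ox) e0.
have [s2 s20 h2] := tangent_approx hM Mx un an e0.
have a1 : 0 < enorm a + 1 by rewrite ltr_wpDl ?enorm_ge0.
pose s := Num.min (s2 / 2) (s1 / (2 * (enorm a + 1))).
have s0 : 0 < s by rewrite lt_min !divr_gt0// mulr_gt0.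
have [sl1 sl2] : s <= s2 / 2 /\ s <= s1 / (2 * (enorm a + 1)) by rewrite /s !ge_min !lexx orbT.
have [|z Mz zs] := h2 s; first by rewrite s0; lra.
have zx : enorm (z - x) <= s * (enorm a + 1).
  have := enormD (z - x - s *: a) (s *: a); rewrite subrK enormZ (gtr0_norm s0).
  have : e * s <= 1 * s by rewrite ler_wpM2r// ltW.
  lra.
have zs1 : enorm (z - x) < s1.
  by apply: le_lt_trans zx _; move: sl2; rewrite ler_pdivlMr ?mulr_gt0//; lra.
have Dz y : M y -> 'D_(e_ i) u y = 0.
  by move=> /g0/rowP/(_ i); rewrite !mxE.
have := h1 z zs1; rewrite !Dz// subrr sub0r normrN => hz.
have cs := cauchy_schwarz (z - x - s *: a) g; rewrite dotDl dotNl dotZl in cs.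
have cs2 : enorm (z - x - s *: a) * enorm g <= e * s * enorm g by rewrite ler_wpM2r ?enorm_ge0.
have hz2 : e * enorm (z - x) <= e * (s * (enorm a + 1)) by rewrite ler_pM2l.
rewrite -(ler_pM2l s0) -{1}(gtr0_norm s0) -normrM.
by move: hz cs cs2 hz2; rewrite !ler_norml; lra.
Qed.

(** A function of [rho] with the Cauchy data of [u] has the same Hessian along [M]
    as [u], since [rho] is constant on [M] and both solve the equation. *)
Lemma profile_coincidence (Omega M U : set V) (u rho : V -> R) (lambda rho0 : R) m
    (b : V -> V) (Hs : V -> 'M[R]_d) (Y Y1 Y2 : R -> R) :
  open Omega -> hypersurface M -> M `<=` Omega -> Ck 2 Omega u -> M `<=` crit Omega u ->
  (forall x, Omega x -> laplacian u x = lambda * u x) -> M m ->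
  open U -> U m -> (forall x, U x -> jet2 rho x (b x) (Hs x)) ->
  (forall x, U x -> taylor2 Y (rho x) (Y1 (rho x)) (Y2 (rho x))) ->
  (forall x, U x -> 2 * \tr (Hs x) * Y1 (rho x) + dot (b x) (b x) * Y2 (rho x) = lambda * Y (rho x)) ->
  (forall x, M x -> rho x = rho0) -> (forall x, M x -> U x -> b x != 0) ->
  Y rho0 = u m -> Y1 rho0 = 0 ->
  helmholtz lambda (U `&` Omega) (fun y => u y + (-1) * Y (rho y)) /\
  \forall y \near m, u y + (-1) * Y (rho y) = 0.
Proof.
move=> oO hM MO Cu Mc eq Mm oU Um jr tY ode rM b0 Yr Y1r.
have jF x : U x -> jet2 (fun y => Y (rho y)) x (Y1 (rho x) *: b x)
    (Y1 (rho x) *: Hs x + (Y2 (rho x) / 2) *: ((b x)^T *m b x)).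
  by move=> Ux; apply: jet2_comp; [exact: jr|exact: tY].
have trb (v : V) : \tr (v^T *m v) = dot v v.
  by rewrite mxtrace_mulC dotE_mx mxtrace_scalar.
have hF : helmholtz lambda (U `&` Omega) (fun y => Y (rho y)).
  move=> x [Ux _]; apply: jet2_helmholtz (jF x Ux) _.
  rewrite mxtraceD !mxtraceZ trb -ode//; by field.
have hu : helmholtz lambda (U `&` Omega) u.
  move=> x [_ Ox]; apply: jet2_helmholtz (Ck2_jet oO Ox Cu) _.
  rewrite mxtraceZ mulrA divff ?mul1r ?pnatr_eq0// -eq//.
  by apply: eq_bigr => i _; rewrite mxE.
have hD := helmholtz_lin (-1) hu hF; split => //.
have [r r0 hr] := critical_jet oO hM MO Cu Mc eq Mm.
have oU' : open (U `&` Omega `&` [set y : V | enorm (y - m) < r]).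
  by apply: openI; [exact: openI|exact: ball_open].
apply: (cauchy_uniqueness oU' _ _ hM Mm).
- by split; [split => //; exact: MO|rewrite /= subrr enorm0].
- by apply: helmholtz_sub hD => x [].
move=> x Mx [[Ux Ox] /= xr].
have bx := b0 x Mx Ux; have nb : 0 < enorm (b x) by rewrite enorm_gt0.
have nob : normal_at M x (b x).
  move=> e e0; have [C C0 hC] := quadratic_bounded (Hs x).
  have [s s0 hs] := jr x Ux 1 ltr01.
  exists (Num.min s (e / (1 + C))); first by rewrite lt_min s0 divr_gt0//; lra.
  move=> y My; rewrite lt_min ltr_pdivlMr; last lra.
  move=> /andP[ys ye]; have := hs _ ys; rewrite [x + _]addrC subrK !rM// subrr sub0r.
  have := hC (y - x); rewrite -sqr_enorm.
  have : enorm (y - x) * (enorm (y - x) * (1 + C)) <= enorm (y - x) * e.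
    by rewrite ler_wpM2l ?enorm_ge0// ltW.
  rewrite expr2 !ler_norml; lra.
pose n := (enorm (b x))^-1 *: b x.
have un : unit_normal M x n.
  split; first exact: normal_scale.
  by rewrite dotZl dotZr -sqr_enorm; field; rewrite gt_eqF.
have [ux ju] := hr x n Mx xr un.
split; first by rewrite ux (rM x Mx) Yr mulN1r subrr.
have := jet2_lin (-1) ju (jF x Ux).
have e1 := ode x Ux; rewrite (rM x Mx) Y1r mulr0 add0r Yr in e1.
rewrite (rM x Mx) Y1r !scale0r scaler0 add0r add0r.
suff -> : (lambda * u m / 2) *: (n^T *m n) + -1 *: ((Y2 rho0 / 2) *: ((b x)^T *m b x)) = 0 by [].
have -> : n^T *m n = (enorm (b x))^-1 ^+ 2 *: ((b x)^T *m b x).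
  have nT : n^T = (enorm (b x))^-1 *: (b x)^T by apply/matrixP => i j; rewrite !mxE.
  by rewrite nT /n -scalemxAl -scalemxAr scalerA expr2.
rewrite !scalerA -scalerDl -e1 -sqr_enorm.
rewrite (_ : _ + _ = 0) ?scale0r//; by field; rewrite gt_eqF.
Qed.

End Cauchy.

(** * Functions of the distance and invariance *)

Section Profiles.
Context {R : realType}.

Lemma taylor2_of_derivatives (Y Y1 : R -> R) (q y2 r : R) : 0 < r ->
  (forall t : R, `|t - q| < r -> is_derive t 1 Y (Y1 t)) -> is_derive q 1 Y1 y2 ->
  taylor2 Y q (Y1 q) y2.
Proof.
move=> r0 dY dY1.
have sh (f : R -> R) (l t : R) : is_derive (q + t) 1 f l -> is_derive t 1 (fun s : R => f (q + s)) l.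
  move=> df; have ds : is_derive t 1 (fun s : R => q + s) (0 + 1) := is_deriveD (is_derive_cst q t 1) (is_derive_id t (1 : R)).
  by apply: is_derive_eq (is_derive1_comp df ds) _; rewrite add0r mulr1.
have := @peano2 R (fun t => Y (q + t)) (fun t => Y1 (q + t)) y2 r r0.
rewrite !addr0; apply => [t tr|].
  by apply: sh; apply: dY; rewrite addrAC subrr add0r.
by apply: sh; rewrite addr0.
Qed.

(** The Cauchy problem for functions of the signed distance to a hyperplane. *)
Lemma planar_profile (lambda c : R) : exists Y Y1 Y2 : R -> R,
  [/\ Y 0 = c, Y1 0 = 0, forall s, taylor2 Y s (Y1 s) (Y2 s) & forall s, Y2 s = lambda * Y s].
Proof.
have [|| y [z [y0 z0 dyz]]] := @linear_system_solution R (fun=> 1) (fun=> lambda) c.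
- by move=> s; exact: cst_continuous.
- by move=> s; exact: cst_continuous.
exists y, z, (fun s => lambda * y s); split => // s.
apply: (taylor2_of_derivatives ltr01) => [t _|].
  by have [dy _] := dyz t; rewrite mul1r in dy.
by have [_ dz] := dyz s.
Qed.

(** Radial solutions around an affine subspace of codimension [k], in terms of
    the squared distance [q]. In the variable [ln q] the singularity of the
    radial equation at the axis moves to minus infinity. *)
Lemma radial_profile (lambda k q0 c : R) : 0 < q0 -> exists Y Y1 Y2 : R -> R,
  [/\ Y q0 = c, Y1 q0 = 0, forall q, 0 < q -> taylor2 Y q (Y1 q) (Y2 q) &
      forall q, 0 < q -> 2 * k * Y1 q + 4 * q * Y2 q = lambda * Y q].
Proof.
(* With this exponent the [z] terms cancel in the radial equation. *)
move=> q00; pose al : R := 1 - k / 2.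
pose a (s : R) := expR (al * s); pose b (s : R) := lambda * q0 / 4 * expR (k / 2 * s).
have da (m s : R) : is_derive s 1 (fun s => expR (m * s)) (m * expR (m * s)).
  have lin : is_derive s 1 (fun t => m * t) (m * 1) := is_deriveZ m (is_derive_id s (1 : R)).
  by apply: is_derive_eq (is_derive1_comp (is_derive_expR _) lin) _; rewrite mulr1 mulrC.
have ca : continuous a by move=> s; exact: is_derive_continuous (da al s).
have cb : continuous b.
  by move=> s; exact: is_derive_continuous (is_deriveZ (lambda * q0 / 4) (da (k / 2) s)).
have [y [z [y0 z0 dyz]]] := linear_system_solution c ca cb.
pose L (q : R) := ln q - ln q0.
have dL (q : R) : 0 < q -> is_derive q 1 L q^-1.
  move=> qp; apply: is_derive_eq (is_deriveB (is_derive1_ln qp) (is_derive_cst (ln q0) q 1)) _.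
  by rewrite subr0.
pose Y q := y (L q); pose Y1 q := q^-1 * (a (L q) * z (L q)).
pose Y2 q := q^-1 ^+ 2 * a (L q) * ((al - 1) * z (L q) + b (L q) * y (L q)).
have dY (q : R) : 0 < q -> is_derive q 1 Y (Y1 q).
  move=> qp; have [dy _] := dyz (L q).
  by apply: is_derive_eq (is_derive1_comp dy (dL q qp)) _; rewrite mulrC.
have dY1 (q : R) : 0 < q -> is_derive q 1 Y1 (Y2 q).
  move=> qp; have [_ dz] := dyz (L q); have qn : q != 0 by rewrite gt_eqF.
  have d1 := is_derive1_comp (is_deriveM (da al (L q)) dz) (dL q qp).
  have d2 : is_derive q 1 (fun t : R => t^-1) (- q ^- 2 *: 1).
    exact: (@is_deriveV _ (fun t : R => t) q 1 1 qn (is_derive_id q (1 : R))).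
  apply: is_derive_eq (is_deriveM d2 d1) _.
  have E0 : ((fun s : R => expR (al * s)) * z) (L q) = a (L q) * z (L q) by [].
  rewrite /Y2 /GRing.scale /= E0 -/(a _); move: (a _) (b _) (z _) (y _) => A B Z W.
  by field.
exists Y, Y1, Y2; split.
- by rewrite /Y /L subrr.
- by rewrite /Y1 /L subrr z0 !mulr0.
- move=> q qp; apply: (@taylor2_of_derivatives _ _ _ _ q qp); last exact: dY1.
  by move=> t; rewrite ltr_norml => /andP[h _]; apply: dY; lra.
move=> q qp; rewrite /Y2 /Y1 /Y.
have ab : a (L q) * b (L q) = lambda * q / 4.
  rewrite /a /b mulrCA -expRD -mulrDl (_ : al + k / 2 = 1); last by rewrite /al; ring.
  rewrite mul1r /L expRD expRN !lnK ?posrE//; field.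
  by rewrite gt_eqF.
have qn : q != 0 by rewrite gt_eqF.
have -> : lambda * y (L q) = 4 * q^-1 * (lambda * q / 4) * y (L q) by field.
rewrite -ab /al; move: (a _) (b _) (z _) (y _) => A B Z W; by field.
Qed.

End Profiles.

Section Tubes.
Context {R : realType} {d : nat}.
Local Notation V := 'rV[R]_d.
Context (x0 : V) (P : 'M[R]_d).
Context (PT : P^T = P) (PP : P *m P = P).

Definition off_axis (x : V) := (x - x0) *m P != 0.

Definition axis_dist2 (x : V) : R := dot ((x - x0) *m P) ((x - x0) *m P).

Lemma off_axis_gt0 x : off_axis x = (0 < axis_dist2 x).
Proof. by rewrite lt_neqAle dot_ge0 andbT eq_sym dot_eq0. Qed.

Lemma axis_dist2_jet x : jet2 axis_dist2 x ((2 : R) *: ((x - x0) *m P)) P.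
Proof.
move=> e e0; exists 1 => // h _.
have -> : axis_dist2 (x + h) - axis_dist2 x - dot h ((2 : R) *: ((x - x0) *m P)) - dot (h *m P) h = 0.
  have E : (x + h - x0) *m P = (x - x0) *m P + h *m P by rewrite addrAC mulmxDl.
  rewrite /axis_dist2 E.
  have hP (w : V) : w *m P = w -> dot (h *m P) w = dot h w by move=> wP; rewrite dot_mxr PT wP.
  have vP : (x - x0) *m P *m P = (x - x0) *m P by rewrite -mulmxA PP.
  have hh : dot (h *m P) (h *m P) = dot (h *m P) h by rewrite dot_mxr PT -mulmxA PP dotC.
  move: ((x - x0) *m P) vP => v vP.
  rewrite dotDl !dotDr dotZr hh (dotC v) (hP v vP); ring.
by rewrite normr0 mulr_ge0 ?dot_ge0// ltW.
Qed.

Lemma off_axis_open : open [set x | off_axis x].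
Proof.
rewrite openE => x; rewrite /= off_axis_gt0 => qx.
have [r r0 hr] := iffLR (@continuous_enormP R d R^o _ _) (jet2_continuous (axis_dist2_jet x)) _ qx.
apply/nbhs_enormP; exists r => // y /hr; rewrite /= off_axis_gt0 ltr_norml => /andP[h _]; lra.
Qed.

Context (a0 b0 : V).
Context (a0P : a0 *m P = a0) (b0P : b0 *m P = b0) (a00 : a0 != 0) (b00 : b0 != 0)
  (ab0 : dot b0 a0 = 0).

Lemma orthogonal_direction (a : V) : exists c : V, [/\ c != 0, c *m P = c & dot c a = 0].
Proof.
have [h|h] := eqVneq (dot a0 a) 0; first by exists a0.
exists (dot a0 a *: b0 - dot b0 a *: a0); split.
- apply: contra_neq b00 => E; have := congr1 (fun v => dot v b0) E.
  rewrite dotDl dotNl !dotZl (dotC a0 b0) ab0 mulr0 subr0 dot0l => /eqP.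
  by rewrite mulf_eq0 (negbTE h) dot_eq0 => /eqP.
- by rewrite mulmxBl -!scalemxAl a0P b0P.
by rewrite dotDl dotNl !dotZl mulrC subrr.
Qed.

(** The axis has codimension at least two: a segment that meets it can be replaced
    by a broken line, bent in a direction orthogonal to it. *)
Lemma off_axis_path (x y1 y2 : V) (r : R) : off_axis y1 -> off_axis y2 ->
  enorm (y1 - x) < r -> enorm (y2 - x) < r -> exists w : V, enorm (w - x) < r /\
  forall t : R, 0 <= t <= 1 -> off_axis (y1 + t *: (w - y1)) /\ off_axis (y2 + t *: (w - y2)).
Proof.
move=> o1 o2 r1 r2.
have seg (y w : V) (t : R) : (y + t *: (w - y) - x0) *m P =
    (1 - t) *: ((y - x0) *m P) + t *: ((w - x0) *m P).
  rewrite !scalemxAl -mulmxDl; congr (_ *m _); apply/rowP => i; rewrite !mxE; ring.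
have [dir|/existsNP[t0]] := pselect (forall t : R, 0 <= t <= 1 -> off_axis (y1 + t *: (y2 - y1))).
  exists y2; split => // t t01; split; first exact: dir.
  by rewrite subrr scaler0 addr0.
move=> /not_implyP[/andP[t00 t01]] /negP; rewrite negbK seg => /eqP.
rewrite /off_axis in o1 o2 *; move: o1 o2.
set a1 := (y1 - x0) *m P; set a2 := (y2 - x0) *m P => o1 o2 E.
have t0n : t0 != 0.
  by apply: contra_neq o1 => t0E; move: E; rewrite t0E subr0 scale1r scale0r addr0.
have [c [c0 cP ca1]] := orthogonal_direction a1.
have ca2 : dot c a2 = 0.
  have := congr1 (dot c) E; rewrite dotDr !dotZr ca1 mulr0 add0r dot0r => /eqP.
  by rewrite mulf_eq0 (negbTE t0n) => /eqP.
pose mid := y1 + (1 / 2) *: (y2 - y1).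
have midr : enorm (mid - x) < r by apply: enorm_segment => //; lra.
have cn : 0 < enorm c by rewrite enorm_gt0.
pose ep := (r - enorm (mid - x)) / (2 * enorm c).
have ep0 : 0 < ep by rewrite divr_gt0 ?subr_gt0// mulr_gt0.
pose w := mid + ep *: c.
have wP : (w - x0) *m P = (1 / 2) *: a1 + (1 / 2) *: a2 + ep *: c.
  rewrite /w addrAC mulmxDl seg -scalemxAl cP; congr (_ *: _ + _ + _); by field.
have cw : dot c ((w - x0) *m P) = ep * dot c c.
  by rewrite wP !dotDr !dotZr ca1 ca2 !mulr0 !add0r.
exists w; split.
  have -> : w - x = (mid - x) + ep *: c by rewrite /w addrAC.
  apply: le_lt_trans (enormD _ _) _; rewrite enormZ (gtr0_norm ep0).
  have -> : ep * enorm c = (r - enorm (mid - x)) / 2 by rewrite /ep; field; rewrite gt_eqF.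
  lra.
have cc : 0 < dot c c by rewrite lt_neqAle dot_ge0 andbT eq_sym dot_eq0.
have off (y : V) (t : R) : (y - x0) *m P != 0 -> dot c ((y - x0) *m P) = 0 ->
    (y + t *: (w - y) - x0) *m P != 0.
  move=> oy cy; apply/eqP => E2; have := congr1 (dot c) E2.
  rewrite seg dotDr !dotZr cy cw mulr0 add0r dot0r => /eqP.
  rewrite mulf_eq0 (gt_eqF (mulr_gt0 ep0 cc)) orbF => /eqP t0E.
  by move: E2 oy; rewrite t0E scale0r addr0 => ->; rewrite eqxx.
by move=> t _; split; apply: off.
Qed.

(** Balls remain connected when the axis is removed, so vanishing off the axis
    spreads through the domain. *)
Lemma tube_continuation (lambda : R) (Omega : set V) (D : V -> R) m :
  open Omega -> connected Omega -> helmholtz lambda ([set x | off_axis x] `&` Omega) D ->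
  Omega m -> (\forall y \near m, D y = 0) -> forall x, Omega x -> off_axis x -> D x = 0.
Proof.
move=> oO cO hD Om D0.
have oU : open ([set x | off_axis x] `&` Omega) by apply: openI => //; exact: off_axis_open.
pose Q (x : V) := exists2 r : R, 0 < r & forall y, enorm (y - x) < r -> off_axis y -> D y = 0.
have dense (y : V) (r : R) : 0 < r -> exists2 y0, enorm (y0 - y) < r & off_axis y0.
  move=> r0; have [oy|ny] := boolP (off_axis y); first by exists y; rewrite ?subrr ?enorm0.
  have bn : 0 < enorm b0 by rewrite enorm_gt0.
  pose t := r / (2 * enorm b0); have t0 : 0 < t by rewrite divr_gt0// mulr_gt0.
  exists (y + t *: b0).
    rewrite addrAC subrr add0r enormZ gtr0_norm//.
    have -> : t * enorm b0 = r / 2 by rewrite /t; field; rewrite gt_eqF.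
    lra.
  move: ny; rewrite /off_axis negbK => /eqP yP.
  by rewrite addrAC mulmxDl yP add0r -scalemxAl b0P scaler_eq0 negb_or b00 gt_eqF.
have spread (x y : V) (r : R) : (forall z, enorm (z - x) < r -> Omega z) -> 0 < r ->
    enorm (y - x) < r -> Q y -> Q x.
  move=> hO r0 yr [s s0 hs]; exists r => // y' y'r oy'.
  have [|y0] := dense y (Num.min s (r - enorm (y - x))); first by rewrite lt_min s0 subr_gt0.
  rewrite lt_min => /andP[y0s y0r] oy0.
  have y0x : enorm (y0 - x) < r by have := enorm_dist y0 y x; lra.
  have near0 : \forall z \near y0, D z = 0.
    have [s1 s10 h1] := open_enormP off_axis_open oy0.
    apply/nbhs_enormP; exists (Num.min s1 (s - enorm (y0 - y))); first by rewrite lt_min s10 subr_gt0.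
    move=> z; rewrite lt_min => /andP[zs1 zs]; apply: hs; last exact: h1.
    by have := enorm_dist z y0 y; lra.
  have [w [wr seg]] := off_axis_path oy0 oy' y0x y'r.
  have along (y1 y2 : V) : enorm (y1 - x) < r -> enorm (y2 - x) < r ->
      (forall t : R, 0 <= t <= 1 -> off_axis (y1 + t *: (y2 - y1))) ->
      (fun t : R => y1 + t *: (y2 - y1)) @` `[0, 1]%classic `<=` [set x | off_axis x] `&` Omega.
    move=> y1r y2r h z [t /=]; rewrite in_itv /= => t01 <-; split; first exact: h.
    by apply: hO; exact: enorm_segment.
  have s1 := along _ _ y0x wr (fun t h => (seg t h).1).
  have s2 := along _ _ y'r wr (fun t h => (seg t h).2).
  have I0 (u v : V) : ((fun t : R => u + t *: (v - u)) @` `[0, 1]%classic) u.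
    by exists 0; rewrite /= ?in_itv /= ?lexx ?ler01// scale0r addr0.
  have I1 (u v : V) : ((fun t : R => u + t *: (v - u)) @` `[0, 1]%classic) v.
    by exists 1; rewrite /= ?in_itv /= ?lexx ?ler01// scale1r addrCA subrr addr0.
  have w0 := unique_continuation oU s1 (@segment_connected_rV R d _ _) hD (I0 _ _) near0 (I1 _ _).
  have y'0 := unique_continuation oU s2 (@segment_connected_rV R d _ _) hD (I1 _ _) w0 (I0 _ _).
  exact: nbhs_singleton y'0.
suff QO x : Omega x -> Q x.
  by move=> x /QO[r r0 hr] ox; apply: hr; rewrite ?subrr ?enorm0.
move: x; apply: (@connected_induction _ Omega Q m cO Om).
- by have [r r0 hr] := iffLR (nbhs_enormP _ _) D0; exists r => // y /hr.
- move=> x Ox [r r0 hr]; apply/nbhs_enormP; exists r => // y yr _.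
  exists (r - enorm (y - x)); first by rewrite subr_gt0.
  by move=> z zy; apply: hr; have := enorm_dist z y x; lra.
move=> x Ox nQ; have [r r0 hr] := open_enormP oO Ox.
by apply/nbhs_enormP; exists r => // y yr Oy Qy; apply: nQ; exact: (spread x y r hr r0 yr Qy).
Qed.

End Tubes.

(* Connectedness of the orbit of p excludes disconnected groups such as the one
   generated by the translations of a hyperplane {x_1 = 0} and the reflection
   in it: its typical orbits are {x_1 = a} `|` {x_1 = - a}, and the claim fails
   for M = {x_1 = a} and u(x) = cos (x_1 - a).  It holds whenever G is a
   connected group. *)
Theorem theorem11 (R : realType) (d : nat) (G : set ('rV[R]_d -> 'rV[R]_d))
    (p : 'rV[R]_d) (Omega M : set 'rV[R]_d) (u : 'rV[R]_d -> R) (lambda : R) :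
  isometry_group G -> codimension_one G ->
  principal G p -> connected (isom_orbit G p) ->
  open Omega -> connected Omega ->
  hypersurface M -> M `<=` Omega -> M `<=` isom_orbit G p ->
  Ck 2 Omega u ->
  M `<=` crit Omega u ->
  (forall x, Omega x -> laplacian u x = lambda * u x) ->
  invariant_on G Omega u.
Proof.
move=> hG cod prp cO oOm cOm hM MOm MO Cu Mc eq.
have hO : hypersurface (isom_orbit G p) by exact: cod.2.
have [[m Mm] _] := hM; have Op : isom_orbit G p p := orbit_refl p hG.
have Om := MOm m Mm.
have [nu [un half]] := orbit_halfspace hG hO cO Op.
have [planar|curved] := pselect (forall x, isom_orbit G p x -> dot (x - p) nu = 0).
  have [Y [Y1 [Y2 [Y0 Y10 tY Y2E]]]] := planar_profile lambda (u m).
  pose rho x := dot (x - p) nu.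
  have jr x : jet2 rho x nu 0.
    move=> e e0; exists 1 => // h _.
    have E : rho (x + h) = rho x + dot h nu by rewrite /rho addrAC dotDl.
    have -> : rho (x + h) - rho x - dot h nu - dot (h *m 0) h = 0.
      by rewrite mulmx0 dot0l subr0 E; ring.
    by rewrite normr0 mulr_ge0 ?dot_ge0// ltW.
  have [hD D0] : helmholtz lambda (setT `&` Omega) (fun y => u y + (-1) * Y (rho y)) /\
      \forall y \near m, u y + (-1) * Y (rho y) = 0.
    apply: (@profile_coincidence _ _ _ M _ _ _ _ 0 _ (fun=> nu) (fun=> 0) Y Y1 Y2) => //.
    - exact: openT.
    - by move=> x _; rewrite mxtrace0 mulr0 mul0r add0r un.2 mul1r.
    - by move=> x Mx; exact/planar/MO.
    - by move=> x _ _; rewrite -dot_eq0 un.2 oner_neq0.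
  rewrite setTI in hD.
  have uE x : Omega x -> u x = Y (rho x).
    move=> Ox; have := unique_continuation oOm (fun _ => id) cOm hD Om D0 Ox.
    by move=> /nbhs_singleton; rewrite mulN1r => /eqP; rewrite subr_eq0 => /eqP.
  move=> g x Gg Ox Ogx.
  by rewrite !uE// /rho (planar_invariant hG hO cO prp cod un planar x Gg).
have Knu : outward G p p nu by split.
have [x0 [P [r [b0 [r0 [PT PP] inv [pP pr] [b00 b0P b0p]]]]]] := orbit_tube hG hO cO Knu curved.
have a00 : p - x0 != 0 by rewrite -enorm_gt0 pr.
pose rho := axis_dist2 x0 P.
have rhoG g x : G g -> rho (g x) = rho x.
  by move=> Gg; rewrite /rho /axis_dist2 -!sqr_enorm inv.
have rhop : rho p = r ^+ 2 by rewrite /rho /axis_dist2 pP -sqr_enorm pr.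
have rhoM x : M x -> rho x = r ^+ 2 by move=> /MO[g Gg ->]; rewrite rhoG.
have r20 : 0 < r ^+ 2 by rewrite exprn_gt0.
have [Y [Y1 [Y2 [Y0 Y10 tY ode]]]] := radial_profile lambda (\tr P) (u m) r20.
have [hD D0] : helmholtz lambda ([set x | off_axis x0 P x] `&` Omega) (fun y => u y + (-1) * Y (rho y)) /\
    \forall y \near m, u y + (-1) * Y (rho y) = 0.
  apply: (@profile_coincidence _ _ _ M _ _ _ _ (r ^+ 2) _
    (fun x => (2 : R) *: ((x - x0) *m P)) (fun=> P) Y Y1 Y2) => //.
  - exact: off_axis_open.
  - by rewrite /= off_axis_gt0 -/rho rhoM.
  - by move=> x _; exact: axis_dist2_jet.
  - by move=> x; rewrite /= off_axis_gt0 => /tY.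
  - move=> x; rewrite /= off_axis_gt0 => /ode <-; rewrite dotZl dotZr -/(axis_dist2 _ _ _) -/rho; ring.
  - by move=> x _ ox; rewrite scaler_eq0 negb_or pnatr_eq0.
have uE x : Omega x -> off_axis x0 P x -> u x = Y (rho x).
  move=> Ox ox; have := tube_continuation PT PP pP b0P a00 b00 b0p oOm cOm hD Om D0 Ox ox.
  by rewrite mulN1r => /eqP; rewrite subr_eq0 => /eqP.
move=> g x Gg Ox Ogx; have ig := G_isometry hG Gg.
have offG y : off_axis x0 P (g y) = off_axis x0 P y by rewrite !off_axis_gt0 -/rho rhoG.
have [ox|nx] := boolP (off_axis x0 P x); first by rewrite !uE ?offG// rhoG.
(* On the axis the profile is singular, but [u] is continuous and points off the
   axis are dense. *)
have cu y : Omega y -> {for y, continuous u}.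
  by move=> Oy; exact: jet2_continuous (Ck2_jet oOm Oy Cu).
apply/eqP; rewrite -subr_eq0 -normr_le0; apply: (@le0_eps _ _ 2) => // e e0 _.
have [s1 s10 h1] := iffLR (@continuous_enormP R d R^o _ _) (cu _ Ox) e e0.
have [s2 s20 h2] := iffLR (@continuous_enormP R d R^o _ _) (cu _ Ogx) e e0.
have [s3 s30 h3] := open_enormP oOm Ox.
have [s4 s40 h4] := open_enormP oOm Ogx.
have bn : 0 < enorm b0 by rewrite enorm_gt0.
pose s := Num.min (Num.min s1 s2) (Num.min s3 s4).
have s0 : 0 < s by rewrite !lt_min s10 s20 s30.
pose t := s / (2 * enorm b0); have t0 : 0 < t by rewrite divr_gt0// mulr_gt0.
pose y := x + t *: b0.
have ys : enorm (y - x) < s.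
  rewrite /y addrAC subrr add0r enormZ gtr0_norm//.
  have -> : t * enorm b0 = s / 2 by rewrite /t; field; rewrite gt_eqF.
  lra.
have gys : enorm (g y - g x) < s by rewrite isometry_enorm.
have oy : off_axis x0 P y.
  move: nx; rewrite /off_axis negbK => /eqP xP.
  by rewrite /y addrAC mulmxDl xP add0r -scalemxAl b0P scaler_eq0 negb_or b00 gt_eqF.
move: ys gys; rewrite !lt_min => /andP[/andP[y1 _] /andP[y3 _]] /andP[/andP[_ y2] /andP[_ y4]].
have Oy : Omega y := h3 y y3; have Ogy : Omega (g y) := h4 _ y4.
have E : u (g y) = u y by rewrite (uE y)// (uE (g y)) ?offG// rhoG.
have := h1 y y1; have := h2 _ y2; rewrite E !ltr_norml ler_norml; lra.
Qed.
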